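(* Let $W=\mathbb{R}^3(x,y,z)$ with contact form $\alpha=dz-y\,dx$, and let $\hat G=\mathrm{CSp}(2,\mathbb{R})=\mathrm{GL}(2,\mathbb{R})$ act on $W$ by $$\Phi_A(x,y,z)=\bigl(ax+by,\ cx+dy,\ (ad-bc)(z-\tfrac12xy)+\tfrac12(ax+by)(cx+dy)\bigr),\quad A=\begin{pmatrix}a&b\\c&d\end{pmatrix}.$$ For surfaces $z=z(x,y)$ in $W$ put $$I'_1=\frac{xz_x+yz_y-xy}{2z-xy},\qquad I'_{2c}=\frac{z_x^2z_{yy}-2z_x(z_y-x)z_{xy}+(z_y-x)^2z_{xx}+z_x(z_y-x)}{2z-xy},$$ $$\nabla_1=x\mathcal{D}_x+y\mathcal{D}_y,\qquad \nabla_2=(x-2z_y)\mathcal{D}_x+(2z_x-y)\mathcal{D}_y .$$ Then the algebra of differential invariants of the $\hat G$-action on the space $J^\infty(W,2)$ of infinite jets of surfaces in $W$ is generated as $$\mathcal{A}_{\hat G}=\langle I'_1,I'_{2c}\,;\,\nabla_1,\nabla_2\ |\ \mathcal{R}_1,\mathcal{R}_2\rangle,$$ where $\mathcal{R}_1$ is the relation $$[\nabla_1,\nabla_2]+\frac{\nabla_2(I'_1)}{I'_1}\nabla_1-\Bigl(\frac{\nabla_1(I'_1)}{I'_1}+2(I'_1-1)\Bigr)\nabla_2=0$$ and $\mathcal{R}_2$ is the relation $$\begin{aligned}&\nabla_1^2(I'_1)+2\nabla_1\nabla_2(I'_1)+\nabla_2^2(I'_1)-4\nabla_1(I'_{2c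})\\&-3(I'_1)^{-1}\bigl(\nabla_1(I'_1)^2+2\nabla_1(I'_1)\nabla_2(I'_1)-4\nabla_1(I'_1)I'_{2c}+\nabla_2(I'_1)^2\bigr)\\&-2(I'_1-1)\bigl(3\nabla_1(I'_1)+4\nabla_2(I'_1)-8I'_{2c}\bigr)-4I'_1(I'_1-1)(2I'_1-1)=0.\end{aligned}$$
   Context: $J^k(W,2)$ is the space of $k$-jets of surfaces in $W$, on the chart of graphs $z=z(x,y)$ with coordinates $x,y,z$ and the partial derivatives $z_x,z_y,z_{xx},\dots$ up to order $k$; $\mathcal{D}_x,\mathcal{D}_y$ are the total derivatives. $\hat G$ acts on $J^k(W,2)$ by prolongation. A differential invariant of order $k$ is a function on $J^k(W,2)$ constant on orbits of the prolonged action; differential invariants are taken to be rational functions of the jet-variables (and may be chosen polynomial in jet-variables of sufficiently high order). $\mathcal{A}_{\hat G}$ is the algebra of all differential invariants. An invariant derivation is a combination of total derivatives, with coefficients functions on a finite jet space, commuting with the prolonged action. $\langle I_i;\nabla_j\mid\mathcal{R}_l\rangle$ means: every element of the algebra is a rational expression in finitely many functions $\nabla_JI_i$ ($\nabla_J$ iterated compositions of the $\nabla_j$), and all relations among these (differential syzygies, including commutator relations) are consequences, algebraic and by applying the $\nabla_j$, of the relations $\mathcal{R}_l$. In $\mathcal{R}_2$, $\nabla_i(I)^2$ denotes $(\nabla_i(I))^2$. *)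

(* Defs.v *)
From HB Require Import structures.
From mathcomp Require Import all_boot all_order all_algebra fraction generic_quotient.
From mathcomp Require Import finmap boolp reals.
From mathcomp.multinomials Require Import monalg.

Set Implicit Arguments.
Unset Strict Implicit.
Unset Printing Implicit Defensive.

Import Order.TTheory GRing.Theory Num.Theory.
Local Open Scope ring_scope.

Section PolynomialDomain.
Variables (I : choiceType) (R : idomainType).
Local Notation poly_dom := {malg R[{cmonom I}]}.

Lemma digits_inj (N n : nat) (a b : nat -> nat) :
    (forall k, (k < n -> a k < N)%N) -> (forall k, (k < n -> b k < N)%N) ->
    (\sum_(k < n) a k * N ^ k = \sum_(k < n) b k * N ^ k)%N ->
  forall k, (k < n)%N -> a k = b k.
Proof.
elim: n a b => [//|n IHn] a b ltaN ltbN.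
have N_gt0 : (0 < N)%N by apply: leq_ltn_trans (ltaN 0%N isT).
have shift (c : nat -> nat) : (\sum_(k < n.+1) c k * N ^ k =
    (\sum_(k < n) c k.+1 * N ^ k) * N + c 0)%N.
  rewrite big_ord_recl expn0 muln1 addnC big_distrl /=; congr (_ + _)%N.
  by apply: eq_bigr => k _; rewrite expnSr mulnA.
rewrite !shift => eq_ab.
have eq0 : a 0%N = b 0%N.
  have /= := congr1 (modn^~ N) eq_ab.
  by rewrite !modnMDl !modn_small ?ltaN ?ltbN.
have {}eq_ab : (\sum_(k < n) a k.+1 * N ^ k = \sum_(k < n) b k.+1 * N ^ k)%N.
  by apply/eqP; rewrite -(eqn_pmul2r N_gt0) -(eqn_add2r (a 0%N)) {2}eq0; apply/eqP.
case=> [//|k]; rewrite ltnS => lt_kn.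
by apply: (IHn (a \o S) (b \o S)) => // j ltjn; [apply: ltaN | apply: ltbN].
Qed.

(* Kronecker substitution x_i |-> X ^ (N ^ index i s). *)
Definition kron_exp (s : seq I) (N : nat) (m : {cmonom I}) : nat :=
  (\sum_(k < size s) m (tnth (in_tuple s) k) * N ^ k)%N.
Definition kron (s : seq I) (N : nat) (m : {cmonom I}) : {poly R} :=
  'X^(kron_exp s N m).

Lemma kron_mmorphism s N : mmorphism (kron s N).
Proof.
split=> [m1 m2|]; rewrite /kron /kron_exp.
  rewrite -exprD -big_split /=; congr ('X^_).
  by apply: eq_bigr => k _; rewrite cmM mulnDl.
by rewrite big1 ?expr0 // => k _; rewrite cm1 mul0n.
Qed.
HB.instance Definition _ s N :=
  isMultiplicative.Build {cmonom I} {poly R} (kron s N) (kron_mmorphism s N).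

Lemma kron_neq0 (s : seq I) (N : nat) (p : poly_dom) :
    (forall m i, m \in msupp p -> m i != 0%N -> i \in s) ->
    (forall m i, m \in msupp p -> (m i < N)%N) ->
  p != 0 -> mmap polyC (kron s N) p != 0.
Proof.
move=> p_s p_N; rewrite -msupp_eq0 => /fset0Pn[m0 m0p].
apply/eqP => /(congr1 (fun q : {poly R} => q`_(kron_exp s N m0))) /eqP.
rewrite coef0 mmapE coef_sum (big_fsetD1 m0) //= big_seq_cond big1 => [|m].
  by rewrite addr0 coefCM coefXn eqxx mulr1 mcoeff_eq0 m0p.
rewrite andbT in_fsetD1 => /andP[neq_m m_p].
rewrite coefCM coefXn; case: eqP => [eq_k|]; last by rewrite mulr0.
case/eqP: neq_m; apply/eqP/cmP => i; have [i_s|i_s] := boolP (i \in s); last first.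
  by rewrite (eqP (contraNT (p_s m i m_p) i_s)) (eqP (contraNT (p_s m0 i m0p) i_s)).
have lt_i : (index i s < size s)%N by rewrite index_mem.
have to_nth (m' : {cmonom I}) :
    kron_exp s N m' = (\sum_(k < size s) m' (nth i s k) * N ^ k)%N.
  by apply: eq_bigr => k _; rewrite (tnth_nth i).
move/esym: eq_k; rewrite !to_nth => eq_k.
rewrite -(nth_index i i_s).
by apply: (digits_inj (a := fun k => m (nth i s k))
  (b := fun k => m0 (nth i s k)) (N := N) _ _ eq_k lt_i) => k _; apply: p_N.
Qed.

Lemma malg_integral (p q : poly_dom) : p * q = 0 -> (p == 0) || (q == 0).
Proof.
move=> pq0; apply/contraT; rewrite negb_or => /andP[p0 q0].
pose ms : seq {cmonom I} := (msupp p : seq _) ++ (msupp q : seq _).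
pose s : seq I := flatten [seq (finsupp (cmonom_val m) : seq I) | m <- ms].
pose N := (\max_(m <- ms) \max_(i <- s) (m i)).+1.
have inS m i : m \in ms -> m i != 0%N -> i \in s.
  by move=> mms mi; apply/flatten_mapP; exists m => //; rewrite -cmE_neq0.
have ltN m i : m \in ms -> (m i < N)%N.
  move=> mms; have [->//|mi] := eqVneq (m i) 0%N.
  rewrite ltnS; apply: leq_trans (leq_bigmax_seq _ mms isT).
  exact: (@leq_bigmax_seq _ s predT (fun i => m i) i (inS _ _ mms mi) isT).
have mem_l m : m \in msupp p -> m \in ms by move=> mp; rewrite mem_cat mp.
have mem_r m : m \in msupp q -> m \in ms by move=> mq; rewrite mem_cat mq orbT.
have /negP[] : mmap polyC (kron s N) (p * q) != 0.
  rewrite rmorphM /= mulf_neq0 ?kron_neq0 //.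
  - by move=> m i /mem_l; apply: inS.
  - by move=> m i /mem_l; apply: ltN.
  - by move=> m i /mem_r; apply: inS.
  by move=> m i /mem_r; apply: ltN.
by rewrite pq0 mmap0.
Qed.

Definition malg_unit : pred poly_dom := fun p => `[< exists q, q * p = 1 >].
Definition malg_inv (p : poly_dom) : poly_dom :=
  if pselect (exists q, q * p = 1) is left e then projT1 (cid e) else p.

Lemma malg_mulVr : {in malg_unit, left_inverse 1 malg_inv *%R}.
Proof.
move=> p /asboolP pU; rewrite /malg_inv; case: pselect => // e.
exact: projT2 (cid e).
Qed.
Lemma malg_unitPl (p q : poly_dom) : q * p = 1 -> malg_unit p.
Proof. by move=> qp1; apply/asboolP; exists q. Qed.
Lemma malg_inv_out : {in [predC malg_unit], malg_inv =1 id}.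
Proof.
move=> p /negP pU; rewrite /malg_inv; case: pselect => // e.
by case: pU; apply/asboolP.
Qed.

End PolynomialDomain.

HB.instance Definition _ (I : choiceType) (R : idomainType) :=
  GRing.ComNzRing_hasMulInverse.Build {malg R[{cmonom I}]}
    (@malg_mulVr I R) (@malg_unitPl I R) (@malg_inv_out I R).
HB.instance Definition _ (I : choiceType) (R : idomainType) :=
  GRing.ComUnitRing_isIntegral.Build {malg R[{cmonom I}]} (@malg_integral I R).


Local Notation "x %:F" := (@FracField.tofrac _ x).

Section Calculus.
Variables (I : choiceType) (R : idomainType).
Local Notation P := {malg R[{cmonom I}]}.

Definition mvar (i : I) : P := << ucm i >>.

Definition msubst (S : comNzRingType) (c : R -> S) (h : I -> S) (p : P) : S :=
  mmap c (fun m : {cmonom I} => \prod_(i <- finsupp m) h i ^+ m i) p.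

Definition mpartial (i : I) (p : P) : P :=
  \sum_(m <- msupp p) << p@_m *+ m i *g divcm m (ucm i) >>.

Definition mvars (p : P) : {fset I} :=
  (\bigcup_(m <- msupp p) finsupp (cmonom_val m))%fset.

(* The R-linear derivation with value delta i on the i-th variable. *)
Definition mderiv (delta : I -> P) (p : P) : P :=
  \sum_(i <- mvars p) mpartial i p * delta i.

End Calculus.

(* Extension of a derivation to the fraction field by the quotient rule;
   it does not depend on the representative chosen by repr. *)
Definition fderiv (P : idomainType) (D : P -> P) (f : {fraction P}) :
    {fraction P} :=
  let n := \n_(repr f) in let d := \d_(repr f) in
  (D n * d - n * D d)%:F / (d ^+ 2)%:F.

(* JU i j stands for the i-th x-derivative and j-th y-derivative of z. *)
Inductive jetvar : Set := JX | JY | JU of nat & nat.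

Definition jetvar_encode (v : jetvar) : bool + nat * nat :=
  match v with JX => inl false | JY => inl true | JU i j => inr (i, j) end.
Definition jetvar_decode (s : bool + nat * nat) : jetvar :=
  match s with inl b => if b then JY else JX | inr ij => JU ij.1 ij.2 end.
Lemma jetvar_encodeK : cancel jetvar_encode jetvar_decode.
Proof. by case. Qed.
HB.instance Definition _ := Choice.copy jetvar (can_type jetvar_encodeK).

Section Jets.
Variable R : realType.

Definition jet := jetvar -> R.

(* Polynomial and rational functions on the chart. Each involves finitely many
   jet variables, so it lives on some J^k(W,2), and jet_field is the union over
   k of the rational functions of order k. *)
Definition jet_poly := {malg R[{cmonom jetvar}]}.
Definition jet_field := {fraction jet_poly}.

Definition jet_eval (s : jet) (p : jet_poly) : R := msubst idfun s p.

(* f is defined at s with value c: some representation of f has a denominator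
   that does not vanish at s. *)
Definition takes_value (f : jet_field) (s : jet) (c : R) : Prop :=
  exists n d : jet_poly,
    [/\ f = n%:F / d%:F, jet_eval s d != 0 & c = jet_eval s n / jet_eval s d].

Definition total_x : jet_poly -> jet_poly := mderiv (fun v =>
  match v with JX => 1 | JY => 0 | JU i j => mvar R (JU i.+1 j) end).
Definition total_y : jet_poly -> jet_poly := mderiv (fun v =>
  match v with JX => 0 | JY => 1 | JU i j => mvar R (JU i j.+1) end).

Definition Dx : jet_field -> jet_field := fderiv total_x.
Definition Dy : jet_field -> jet_field := fderiv total_y.

(* The action on W for S = R, which rescales dz - y dx by \det A; with S = jet_poly it expresses the coordinates of
   the image point in terms of those of the source. *)
Definition Phi (S : comAlgType R) (A : 'M[R]_2) (w : S * S * S) : S * S * S :=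
  let: (x, y, z) := w in
  let X := A 0 0 *: x + A 0 1 *: y in
  let Y := A 1 0 *: x + A 1 1 *: y in
  (X, Y, \det A *: (z - 2^-1 *: (x * y)) + 2^-1 *: (X * Y)).

Definition Phi_coord (A : 'M[R]_2) : jet_poly * jet_poly * jet_poly :=
  Phi A (mvar R JX, mvar R JY, mvar R (JU 0 0)).

(* Total derivatives in the new independent variables (X, Y), obtained by
   inverting D_x = a D_X + c D_Y, D_y = b D_X + d D_Y. *)
Definition total_X (A : 'M[R]_2) (p : jet_poly) : jet_poly :=
  (\det A)^-1 *: (A 1 1 *: total_x p - A 1 0 *: total_y p).
Definition total_Y (A : 'M[R]_2) (p : jet_poly) : jet_poly :=
  (\det A)^-1 *: (- A 0 1 *: total_x p + A 0 0 *: total_y p).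

(* Since X and Y do not involve z, the image of a graph over (x, y) is a graph
   over (X, Y), and the prolonged action is defined on the whole chart. *)
Definition prolong_coord (A : 'M[R]_2) (v : jetvar) : jet_poly :=
  match v with
  | JX => (Phi_coord A).1.1
  | JY => (Phi_coord A).1.2
  | JU i j => iter i (total_X A) (iter j (total_Y A) (Phi_coord A).2)
  end.

Definition prolong (A : 'M[R]_2) (s : jet) : jet :=
  fun v => jet_eval s (prolong_coord A v).

Definition diff_invariant (f : jet_field) : Prop :=
  forall (A : 'M[R]_2), A \in unitmx -> forall (s : jet) (c c' : R),
    takes_value f s c -> takes_value f (prolong A s) c' -> c = c'.

(* g is the composite of f with the prolongation of Phi_A. *)
Definition is_pullback (A : 'M[R]_2) (f g : jet_field) : Prop :=
  forall (s : jet) (c c' : R),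
    takes_value g s c -> takes_value f (prolong A s) c' -> c = c'.

Definition invariant_derivation (N : jet_field -> jet_field) : Prop :=
  (exists a b : jet_field, forall f, N f = a * Dx f + b * Dy f) /\
  (forall (A : 'M[R]_2), A \in unitmx -> forall f g : jet_field,
    is_pullback A f g -> is_pullback A (N f) (N g)).

Definition cx : jet_field := (mvar R JX)%:F.
Definition cy : jet_field := (mvar R JY)%:F.
Definition cu (i j : nat) : jet_field := (mvar R (JU i j))%:F.

Local Notation x := cx.
Local Notation y := cy.
Local Notation z := (cu 0 0).
Local Notation zx := (cu 1 0).
Local Notation zy := (cu 0 1).
Local Notation zxx := (cu 2 0).
Local Notation zxy := (cu 1 1).
Local Notation zyy := (cu 0 2).

Definition I1' : jet_field := (x * zx + y * zy - x * y) / (2 * z - x * y).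

Definition I2c' : jet_field :=
  (zx ^+ 2 * zyy - 2 * zx * (zy - x) * zxy + (zy - x) ^+ 2 * zxx
     + zx * (zy - x)) / (2 * z - x * y).

Definition nabla1 (f : jet_field) : jet_field := x * Dx f + y * Dy f.
Definition nabla2 (f : jet_field) : jet_field :=
  (x - 2 * zy) * Dx f + (2 * zx - y) * Dy f.

End Jets.

(* The left-hand sides of R_1 (applied to f) and R_2, over any field with two
   operators, to be used both for actual invariants and for formal symbols. *)
Definition rel1 (F : fieldType) (d1 d2 : F -> F) (I f : F) : F :=
  (d1 (d2 f) - d2 (d1 f)) + d2 I / I * d1 f - (d1 I / I + 2 * (I - 1)) * d2 f.

Definition rel2 (F : fieldType) (d1 d2 : F -> F) (I J : F) : F :=
  d1 (d1 I) + 2 * d1 (d2 I) + d2 (d2 I) - 4 * d1 J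
  - 3 * I^-1 * ((d1 I) ^+ 2 + 2 * d1 I * d2 I - 4 * d1 I * J + (d2 I) ^+ 2)
  - 2 * (I - 1) * (3 * d1 I + 4 * d2 I - 8 * J)
  - 4 * I * (I - 1) * (2 * I - 1).

Section Presentation.
Variable R : realType.

(* The symbol (w, i) stands for nabla_w (I_i), where the letters of the word w
   are applied from right to left and the derivations need not commute. *)
Definition dsymbol : Type := (seq 'I_2 * 'I_2)%type.

Definition diff_poly := {malg R[{cmonom dsymbol}]}.
Definition diff_field := {fraction diff_poly}.

Definition dsym (w : seq 'I_2) (i : 'I_2) : diff_poly := mvar R (w, i).

Definition formal_nabla (j : 'I_2) : diff_field -> diff_field :=
  fderiv (mderiv (fun v : dsymbol => dsym (j :: v.1) v.2)).

Definition nabla_word (nabla : 'I_2 -> jet_field R -> jet_field R)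
    (w : seq 'I_2) (f : jet_field R) : jet_field R :=
  foldr nabla f w.

Definition diff_eval (nabla : 'I_2 -> jet_field R -> jet_field R)
    (I : 'I_2 -> jet_field R) (p : diff_poly) : jet_field R :=
  msubst (fun c : R => ((c *: 1 : jet_poly R)%:F : jet_field R))
    (fun v : dsymbol => nabla_word nabla v.1 (I v.2)) p.

Definition rationally_generated (nabla : 'I_2 -> jet_field R -> jet_field R)
    (I : 'I_2 -> jet_field R) (f : jet_field R) : Prop :=
  exists p q : diff_poly,
    diff_eval nabla I q != 0 /\ f = diff_eval nabla I p / diff_eval nabla I q.

(* Algebraic and differential consequences of the relations Rel: the
   differential ideal they generate in diff_poly[h^-1]. It is used with h the
   symbol of I'_1, the only denominator occurring in R_1 and R_2. *)
Inductive consequence (Rel : diff_field -> Prop) (h : diff_poly) :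
    diff_field -> Prop :=
| Cons_rel e : Rel e -> consequence Rel h e
| Cons_add e1 e2 :
    consequence Rel h e1 -> consequence Rel h e2 -> consequence Rel h (e1 + e2)
| Cons_mul (p : diff_poly) e :
    consequence Rel h e -> consequence Rel h (p%:F * e)
| Cons_div e : consequence Rel h e -> consequence Rel h (e / h%:F)
| Cons_nabla j e : consequence Rel h e -> consequence Rel h (formal_nabla j e).

Definition pick2 (T : Type) (a b : T) (i : 'I_2) : T :=
  if i == 0 then a else b.

(* R_1 is an identity between operators, so it contributes one relation for each
   p. It suffices, and is sound, to take p polynomial: a fraction in diff_field
   may have a denominator that evaluates to 0. *)
Definition R1R2 (e : diff_field) : Prop :=
  let d := formal_nabla in
  let I := (dsym [::] 0)%:F in
  let J := (dsym [::] 1)%:F in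
  (exists p : diff_poly, e = rel1 (d 0) (d 1) I p%:F)
  \/ e = rel2 (d 0) (d 1) I J.

End Presentation.

Arguments pick2 {T}.

(* Main.v *)
From HB Require Import structures.
Require Import Defs.
From mathcomp Require Import all_boot all_order all_algebra fraction generic_quotient.
From mathcomp Require Import finmap boolp reals ring.
From mathcomp.multinomials Require Import monalg.

(* In terms of w = z - xy/2 the matrix A acts by (x, y) |-> A (x, y) and
   w |-> det A w. Then nabla_1 is the Euler field v1 and nabla_2 the Hamiltonian
   field v2 of 2w, and I'_1 = v1(w) / (2w). Let tau i j be the total derivative of
   w of order i + j contracted with i copies of v1 and j copies of v2, divided by
   w. These functions satisfy
     nabla_1 (tau i j) = tau (i+1) j + ...,  nabla_2 (tau i j) = tau i (j+1) + ...,
   where the dots have order at most i + j (for i + j > 1), and I'_1 = tau 1 0 / 2,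
   I'_2c = (tau 2 0 + 2 tau 1 1 + tau 0 2) / 8. The relations R_1 and R_2
   follow from the exact form of this recurrence.

   Generation: moving (v1, v2) to the standard frame by an element of the group
   depending on the jet replaces the jet coordinates by rational functions of the
   tau i j, so an invariant is a rational function of the tau i j, and these are
   generated by I'_1 and I'_2c by the recurrence.

   Syzygies: modulo R_1 and R_2 every formal symbol reduces to a polynomial in
   1/I'_1, the nabla_1^a nabla_2^b I'_1 and the nabla_2^b I'_2c. Their leading terms
   tau (a+1) b / 2 and (tau 2 b + 2 tau 1 (b+1) + tau 0 (b+2)) / 8 are triangular
   in the tau i j, which take arbitrary values on the cross-section v1 = (1, 0),
   v2 = (0, 1); hence these symbols are algebraically independent. *)

Set Implicit Arguments.
Unset Strict Implicit.
Unset Printing Implicit Defensive.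

Import Order.TTheory GRing.Theory Num.Theory.
Local Open Scope ring_scope.
Local Notation "x %:F" := (@FracField.tofrac _ x).

(** * Derivations and polynomial calculus *)

(** The frame [v1], [v2] has determinant [2 w tau 1 0]. Re-expanding derivatives of the frame
    vectors in the frame therefore divides by [tau 1 0 = 2 I'_1], which is why I'_1 is the only
    function to be inverted. A count shows why two relations can suffice: for n >= 2 there are n + 1
    functions [tau i j] of order n, against n symbols nabla_1^a nabla_2^b I'_1 with a + b = n - 1
    and one symbol nabla_2^b I'_2c with b = n - 2. Two obstacles shape the proof. Values at jets and
    evaluations of formal fractions are partial, since a denominator may vanish there. Hence
    [frac_val] is a relation, and pointwise statements become algebraic because a polynomial that
    vanishes at all real jets is zero. Moreover, the denominator of an invariant may vanish on the
    whole cross-section; a fixed group element then has to move it away before the invariant is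
    restricted. *)

Definition derivation (S : pzRingType) (D : S -> S) : Prop :=
  (forall a b, D (a + b) = D a + D b) /\
  (forall a b, D (a * b) = D a * b + a * D b).

Section Derivation.
Variables (S : comNzRingType) (D : S -> S) (derD : derivation D).

Lemma der_add a b : D (a + b) = D a + D b. Proof. exact: derD.1. Qed.
Lemma derM a b : D (a * b) = D a * b + a * D b. Proof. exact: derD.2. Qed.
Lemma der0 : D 0 = 0.
Proof. by apply: (addrI (D 0)); rewrite -der_add !addr0. Qed.
Lemma der1 : D 1 = 0.
Proof. by apply: (addrI (D 1)); rewrite -{1}[D 1]mulr1 -{2}[D 1]mul1r -derM mulr1 addr0. Qed.
Lemma derN a : D (- a) = - D a.
Proof. by apply: (addrI (D a)); rewrite -der_add !subrr der0. Qed.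
Lemma derB a b : D (a - b) = D a - D b.
Proof. by rewrite der_add derN. Qed.
Lemma derMn a n : D (a *+ n) = D a *+ n.
Proof. by elim: n => [|n IH]; rewrite ?mulr0n ?der0 // !mulrS der_add IH. Qed.
Lemma der_nat n : D n%:R = 0.
Proof. by rewrite derMn der1 mul0rn. Qed.

End Derivation.

Lemma leibnizDl (S : comNzRingType) (D : S -> S) (hD : {morph D : a b / a + b})
    (p1 p2 q : S) :
  D (p1 * q) = D p1 * q + p1 * D q -> D (p2 * q) = D p2 * q + p2 * D q ->
  D ((p1 + p2) * q) = D (p1 + p2) * q + (p1 + p2) * D q.
Proof. by move=> h1 h2; rewrite mulrDl !hD h1 h2; ring. Qed.

Lemma leibnizDr (S : comNzRingType) (D : S -> S) (hD : {morph D : a b / a + b})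
    (p q1 q2 : S) :
  D (p * q1) = D p * q1 + p * D q1 -> D (p * q2) = D p * q2 + p * D q2 ->
  D (p * (q1 + q2)) = D p * (q1 + q2) + p * D (q1 + q2).
Proof. by move=> h1 h2; rewrite mulrDr !hD h1 h2; ring. Qed.

Section FieldDerivation.
Variables (K : fieldType) (D : K -> K) (derD : derivation D).

Lemma derV a : a != 0 -> D a^-1 = - (D a / a ^+ 2).
Proof.
move=> a0; apply: (mulfI a0).
have -> : a * D a^-1 = D (a * a^-1) - D a * a^-1 by rewrite (derM derD) addrC addKr.
by rewrite divff // (der1 derD); field.
Qed.
Lemma der_div a b : b != 0 -> D (a / b) = (D a * b - a * D b) / b ^+ 2.
Proof. by move=> b0; rewrite (derM derD) derV //; field. Qed.

End FieldDerivation.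

Lemma lin_comb_derivation (S : comNzRingType) (a b : S) (D1 D2 : S -> S) :
  derivation D1 -> derivation D2 -> derivation (fun f => a * D1 f + b * D2 f).
Proof.
by move=> h1 h2; split=> p q; rewrite ?(der_add h1, der_add h2, derM h1, derM h2); ring.
Qed.

Lemma sum_derivation (S : comNzRingType) (J : Type) (r : seq J) (a : J -> S)
    (D : J -> S -> S) : (forall j, derivation (D j)) ->
  derivation (fun p => \sum_(j <- r) D j p * a j).
Proof.
move=> hD; split=> p q.
  by rewrite -big_split; apply: eq_bigr => j _; rewrite (der_add (hD j)) mulrDl.
rewrite mulr_suml mulr_sumr -big_split; apply: eq_bigr => j _ /=.
by rewrite (derM (hD j)); ring.
Qed.

Section MalgCalculus.
Variables (I : choiceType) (R : idomainType).
Local Notation P := {malg R[{cmonom I}]}.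

Lemma monalgU_mul (c1 c2 : R) (m1 m2 : {cmonom I}) :
  << c1 *g m1 >> * << c2 *g m2 >> = << c1 * c2 *g (mmul m1 m2) >> :> P.
Proof. by rewrite malgM_def fgmulUU. Qed.

Lemma malg_sum_ind (Pr : P -> Prop) :
    (forall c m, Pr << c *g m >>) -> (forall p q, Pr p -> Pr q -> Pr (p + q)) ->
  forall p, Pr p.
Proof.
move=> hm hD p; rewrite [p]monalgE; apply: (big_ind Pr) => //.
by have := hm 0 mone; rewrite monalgU0.
Qed.

(** A monomial is a product of variables, by induction on its degree. Hence morphisms and
    derivations need only be compared on constants and variables. *)
Lemma malg_ind (Pr : P -> Prop) :
    (forall c : R, Pr c%:MP) -> (forall i, Pr (mvar R i)) ->
    (forall p q, Pr p -> Pr q -> Pr (p + q)) ->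
    (forall p q, Pr p -> Pr q -> Pr (p * q)) ->
  forall p, Pr p.
Proof.
move=> hC hX hD hM; apply: malg_sum_ind => // c m.
rewrite -[m]mul1m -[c]mulr1 -monalgU_mul; apply: (hM); first exact: hC.
elim: {m}_.+1 {-2}m (ltnSn (mdeg m)) => // n IH m lt_m.
have [/mdeg_eq0I ->|m0] := eqVneq (mdeg m) 0%N; first exact: hC.
have [i mi] : exists i, (0 < m i)%N.
  have /fset0Pn[i] : finsupp m != fset0.
    by apply: contraNneq m0 => h; rewrite mdegE h big_seq_fset0.
  by rewrite -cmE_neq0 -lt0n => ?; exists i.
have em : m = (mmul (ucm i) (divcm m (ucm i))).
  apply/eqP/cmP => j; rewrite cmM divcmE cmU; case: eqP => [<-|_].
    by rewrite subnKC.
  by rewrite subn0.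
rewrite em -[1]mulr1 -monalgU_mul; apply: hM; first exact: hX.
by apply: IH; move: lt_m; rewrite {1}em mdegM mdegU.
Qed.

Section Msubst.
Variables (S : comNzRingType) (c : {rmorphism R -> S}) (h : I -> S).

Definition monom_subst (m : {cmonom I}) : S := \prod_(i <- finsupp m) h i ^+ m i.

Lemma monom_subst_mmorphism : mmorphism monom_subst.
Proof.
have ext (m : {cmonom I}) (d : {fset I}) : (finsupp m `<=` d)%fset ->
    monom_subst m = \prod_(i <- d) h i ^+ m i.
  move=> le; rewrite /monom_subst (big_fset_incl _ le) // => i _.
  by rewrite -cmE_neq0 negbK => /eqP ->.
split=> [m1 m2|]; last by rewrite /monom_subst mdom1 big_seq_fset0.
rewrite (ext _ _ (fsubset_refl _)) mdomD.
rewrite (ext m1 _ (fsubsetUl _ (finsupp m2))) (ext m2 _ (fsubsetUr (finsupp m1) _)).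
by rewrite -big_split /=; apply: eq_bigr => i _; rewrite cmM exprD.
Qed.
HB.instance Definition _ :=
  isMultiplicative.Build {cmonom I} S monom_subst monom_subst_mmorphism.

Lemma msubst_additive : zmod_morphism (msubst c h).
Proof. exact: (@mmap_is_additive _ _ _ c monom_subst). Qed.
Lemma msubst_multiplicative : monoid_morphism (msubst c h).
Proof. by have [h1 h2] := @mmap_is_multiplicative _ R S c monom_subst; split. Qed.
HB.instance Definition _ := GRing.isZmodMorphism.Build P S (msubst c h)
  msubst_additive.
HB.instance Definition _ := GRing.isMonoidMorphism.Build P S (msubst c h)
  msubst_multiplicative.

Lemma msubstC a : msubst c h a%:MP = c a.
Proof. exact: (@mmapC _ R S c monom_subst). Qed.
Lemma msubstX i : msubst c h (mvar R i) = h i.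
Proof.
have -> : msubst c h (mvar R i) = c 1 * monom_subst (ucm i) by exact: (@mmapU _ _ _ c).
by rewrite rmorph1 mul1r /monom_subst mdomU big_seq_fset1 cmUU expr1.
Qed.
Lemma msubstZ a p : msubst c h (a *: p) = c a * msubst c h p.
Proof. by rewrite -mul_malgC rmorphM /= msubstC. Qed.

End Msubst.

Lemma malg_rmorph_ext (S : comNzRingType) (f g : {rmorphism P -> S}) :
    (forall c, f c%:MP = g c%:MP) -> (forall i, f (mvar R i) = g (mvar R i)) ->
  f =1 g.
Proof.
move=> hC hX; apply: malg_ind => // p q ep eq; first by rewrite !rmorphD ep eq.
by rewrite !rmorphM ep eq.
Qed.

Section Mpartial.
Variable i : I.

Lemma mpartialEw (d : {fset {cmonom I}}) (p : P) : (msupp p `<=` d)%fset ->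
  mpartial i p = \sum_(m <- d) << p@_m *+ m i *g divcm m (ucm i) >>.
Proof.
move=> le; rewrite /mpartial (big_fset_incl _ le) // => m _.
by move/mcoeff_outdom ->; rewrite mul0rn monalgU0.
Qed.

Lemma mpartialU (c : R) (m : {cmonom I}) :
  mpartial i << c *g m >> = << c *+ m i *g divcm m (ucm i) >>.
Proof. by rewrite (mpartialEw msuppU_le) big_seq_fset1 mcoeffUU. Qed.

Lemma mpartial_derivation : derivation (mpartial i : P -> P).
Proof.
have hD (p q : P) : mpartial i (p + q) = mpartial i p + mpartial i q.
  rewrite (mpartialEw (msuppD_le p q)).
  rewrite (mpartialEw (fsubsetUl (msupp p) (msupp q))).
  rewrite (mpartialEw (fsubsetUr (msupp p) (msupp q))) -big_split /=.
  by apply: eq_bigr => m _; rewrite mcoeffD mulrnDl monalgUD.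
split=> //; elim/malg_sum_ind => [c1 m1|p1 p2 IH1 IH2] q; last first.
  exact: (leibnizDl hD (IH1 q) (IH2 q)).
elim/malg_sum_ind: q => [c2 m2|q1 q2 IH1 IH2]; last first.
  exact: (leibnizDr hD IH1 IH2).
have e1 := etrans (congr1 (mpartial i) (monalgU_mul c1 c2 m1 m2)) (mpartialU _ _).
have e2 := etrans (congr1 ( *%R^~ << c2 *g m2 >>) (mpartialU c1 m1)) (monalgU_mul _ _ _ _).
have e3 := etrans (congr1 ( *%R << c1 *g m1 >>) (mpartialU c2 m2)) (monalgU_mul _ _ _ _).
apply: (etrans e1); apply: etrans (esym (congr2 +%R e2 e3)).
rewrite cmM mulrnDr monalgUD mulrnAl mulrnAr {e1 e2 e3}.
(* [divcm] is a truncated division, so it commutes with multiplication by [m'] only if the variable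
   divides [m]. If it does not, the coefficient [m i] is zero and kills the term. *)
have key (m m' : {cmonom I}) : (0 < m i)%N ->
    divcm (mmul m m') (ucm i) = (mmul (divcm m (ucm i)) m').
  move=> mi; apply/eqP/cmP => j; rewrite cmM !divcmE cmM cmU.
  by case: eqP => [<-|_]; rewrite ?subn0 // addnBAC.
apply: (congr2 +%R).
  case: (posnP (m1 i)) => [->|/key e]; first by rewrite mulr0n !monalgU0.
  by rewrite e.
case: (posnP (m2 i)) => [->|mi]; first by rewrite mulr0n !monalgU0.
have -> : divcm (mmul m1 m2) (ucm i) = mmul m1 (divcm m2 (ucm i)).
  by rewrite [mmul m1 m2]mulmC (key _ _ mi) mulmC.
exact: erefl.
Qed.

Lemma mpartialC c : mpartial i (c%:MP : P) = 0.
Proof. by rewrite mpartialU cm1 mulr0n monalgU0. Qed.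

Lemma mpartialX j : mpartial i (mvar R j) = (i == j)%:R :> P.
Proof.
rewrite mpartialU cmU eq_sym; case: eqP => [->|_]; last by rewrite mulr0n monalgU0.
rewrite mulr1n; suff -> : divcm (ucm j) (ucm j) = mone by []; apply/eqP/cmP => k.
by rewrite divcmE subnn cm1.
Qed.

Lemma mpartial_outdom (p : P) : i \notin mvars p -> mpartial i p = 0.
Proof.
move=> hi; rewrite /mpartial big_seq big1 // => m mp.
have -> : m i = 0%N; last by rewrite mulr0n monalgU0.
apply/eqP; rewrite cmE_eq0; apply: contra hi => him.
by apply/bigfcupP; exists m; rewrite ?mp.
Qed.

End Mpartial.

Section Mderiv.
Variable delta : I -> P.

Lemma mderivEw (d : {fset I}) (p : P) : (mvars p `<=` d)%fset ->
  mderiv delta p = \sum_(i <- d) mpartial i p * delta i.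
Proof.
move=> le; rewrite /mderiv (big_fset_incl _ le) // => i _ /mpartial_outdom ->.
by rewrite mul0r.
Qed.

Lemma mderiv_derivation : derivation (mderiv delta).
Proof.
have sumD (d : {fset I}) := sum_derivation d delta mpartial_derivation.
split=> p q.
  pose d := (mvars (p + q) `|` (mvars p `|` mvars q))%fset.
  rewrite !(@mderivEw d) ?fsubsetUl //; first exact: (sumD d).1.
  - by rewrite /d fsetUA fsubsetUr.
  by rewrite /d fsetUC -fsetUA fsubsetUl.
pose d := (mvars (p * q) `|` (mvars p `|` mvars q))%fset.
rewrite !(@mderivEw d) ?fsubsetUl //; first exact: (sumD d).2.
- by rewrite /d fsetUA fsubsetUr.
by rewrite /d fsetUC -fsetUA fsubsetUl.
Qed.

Lemma mderivC c : mderiv delta c%:MP = 0.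
Proof. by rewrite /mderiv big1 // => i _; rewrite mpartialC mul0r. Qed.

Lemma mderivX i : mderiv delta (mvar R i) = delta i.
Proof.
have le : (mvars (mvar R i) `<=` [fset i])%fset.
  by rewrite /mvars /mvar msuppU1 big_seq_fset1 mdomU fsubset_refl.
by rewrite (mderivEw le) big_seq_fset1 mpartialX eqxx mul1r.
Qed.

Lemma mderivZ c p : mderiv delta (c *: p) = c *: mderiv delta p.
Proof. by rewrite -!mul_malgC (derM mderiv_derivation) mderivC mul0r add0r. Qed.

End Mderiv.

(** Derivations over a common morphism [f] are determined by the generators. Chain rules such as
    [T (pull p) = pull (t p)] follow, both sides being derivations over [pull]. *)
Lemma malg_derivation_ext (S : comNzRingType) (f : {rmorphism P -> S})
    (D1 D2 : P -> S) :
    (forall p q, D1 (p + q) = D1 p + D1 q) ->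
    (forall p q, D2 (p + q) = D2 p + D2 q) ->
    (forall p q, D1 (p * q) = D1 p * f q + f p * D1 q) ->
    (forall p q, D2 (p * q) = D2 p * f q + f p * D2 q) ->
    (forall c, D1 c%:MP = D2 c%:MP) -> (forall i, D1 (mvar R i) = D2 (mvar R i)) ->
  D1 =1 D2.
Proof.
move=> a1 a2 m1 m2 hC hX; apply: malg_ind => // p q ep eq.
  by rewrite a1 a2 ep eq.
by rewrite m1 m2 ep eq.
Qed.

(** Kronecker substitution with [N] above all exponents turns [p] into a nonzero polynomial in one
    variable, which has fewer roots than its size. A non-root [x] gives the point
    [x ^+ (N ^ index i s)]. *)
Lemma malg_nonvanishing (p : P) : (forall n, exists s : seq R, uniq s /\ size s = n) ->
  p != 0 -> exists t : I -> R, msubst idfun t p != 0.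
Proof.
move=> Rinf p0.
pose s : seq I := mvars p.
pose N := (\max_(m <- msupp p) \max_(i <- s) (m i)).+1.
have inS m i : m \in msupp p -> m i != 0%N -> i \in s.
  by move=> mp mi; apply/bigfcupP; exists m; rewrite ?mp // -cmE_neq0.
have ltN m i : m \in msupp p -> (m i < N)%N.
  move=> mms; have [->//|mi] := eqVneq (m i) 0%N.
  rewrite ltnS; apply: leq_trans (leq_bigmax_seq _ mms isT).
  exact: (@leq_bigmax_seq _ s predT (fun i => m i) i (inS _ _ mms mi) isT).
have := kron_neq0 inS ltN p0; set k := mmap _ _ _ => k0.
have [r [ru rs]] := Rinf (size k).
have /allPn[x _ kx] : ~~ all (root k) r.
  by apply/negP => /(max_poly_roots k0)/(_ ru); rewrite rs ltnn.
exists (fun i => x ^+ (N ^ index i s)).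
rewrite /root /k mmapE horner_sum in kx; apply: contra kx => /eqP e0.
apply/eqP; rewrite -[RHS]e0 /msubst mmapE; apply: eq_big_seq => m mp /=.
rewrite hornerCM hornerXn; congr (_ * _).
have -> : kron_exp s N m = (\sum_(i <- s) m i * N ^ index i s)%N.
  rewrite /kron_exp big_tnth; apply: eq_bigr => k' _; congr (_ * _ ^ _)%N.
  by rewrite (tnth_nth (tnth (in_tuple s) k')) index_uniq // fset_uniq.
have le : (finsupp m `<=` mvars p)%fset by apply/fsubsetP => i; rewrite -cmE_neq0; apply: inS.
rewrite (big_fset_incl _ le) => [|i _]; last first.
  by rewrite -cmE_neq0 negbK => /eqP ->.
rewrite (big_morph _ (exprD x) (expr0 x)); apply: eq_bigr => i _.
by rewrite -exprM mulnC.
Qed.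

End MalgCalculus.

(** * Fraction fields: derivations and partial evaluation *)

Section Fractions.
Variable P : idomainType.
Implicit Types (f g : {fraction P}) (n d : P).

Lemma frac_numden f : f = (\n_(repr f))%:F / (\d_(repr f))%:F.
Proof.
rewrite -{1}[f]reprK; set r := repr f.
have dF0 : (\d_r)%:F != 0 by rewrite tofrac_eq0 denom_ratioP.
apply: (mulIf dF0); rewrite divfK //; unlock FracField.tofrac.
rewrite -[LHS]FracField.pi_mul; apply/eqmodP.
rewrite /= FracField.equivfE /FracField.mulf !numden_Ratio ?oner_neq0 ?mulr1 ?denom_ratioP //.
by rewrite mulrC.
Qed.

Lemma fracP f : exists n d, d != 0 /\ f = n%:F / d%:F.
Proof. by exists (\n_(repr f)), (\d_(repr f)); rewrite denom_ratioP -frac_numden. Qed.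

Lemma frac_cross n d n' d' : d != 0 -> d' != 0 ->
  n%:F / d%:F = n'%:F / d'%:F -> n * d' = n' * d.
Proof.
move=> d0 d'0 /eqP; rewrite eqr_div ?tofrac_eq0 // -!tofracM => /eqP.
by move/eqP; rewrite tofrac_eq => /eqP.
Qed.

Section Fderiv.
Variables (D : P -> P) (derD : derivation D).

(** Independence of the representative: the difference of the two quotient rules is a combination of
    the equation [n * d' = n' * d] and of its derivative. *)
Lemma fderivE n d : d != 0 ->
  fderiv D (n%:F / d%:F) = (D n * d - n * D d)%:F / (d ^+ 2)%:F.
Proof.
move=> d0; rewrite /fderiv; set f := n%:F / d%:F.
set n' := \n_(repr f); set d' := \d_(repr f).
have d'0 : d' != 0 by exact: denom_ratioP.
have e : n * d' = n' * d by apply: frac_cross => //; exact: frac_numden.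
have {}e' : D n * d' + n * D d' = D n' * d + n' * D d by rewrite -!(derM derD) e.
apply/eqP; rewrite eqr_div ?tofrac_eq0 ?expf_neq0 // -!tofracM tofrac_eq.
rewrite -subr_eq0; apply/eqP.
transitivity (d * d' * (D n' * d + n' * D d - (D n * d' + n * D d'))
   + (d * D d' + d' * D d) * (n * d' - n' * d)); first by ring.
by rewrite e' e !subrr !mulr0 addr0.
Qed.

Lemma fderivF n : fderiv D n%:F = (D n)%:F.
Proof.
have -> : n%:F = n%:F / (1 : P)%:F by rewrite tofrac1 divr1.
by rewrite fderivE ?oner_neq0 // (der1 derD) mulr0 mulr1 subr0 expr1n tofrac1 divr1.
Qed.

Lemma fderiv_derivation : derivation (fderiv D).
Proof.
split=> f g; have [n [d [d0 ->]]] := fracP f; have [n' [d' [d'0 ->]]] := fracP g.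
  rewrite addf_div ?tofrac_eq0 // -!tofracM -tofracD !fderivE ?mulf_neq0 //.
  rewrite addf_div ?tofrac_eq0 ?expf_neq0 // -!tofracM -tofracD.
  apply/eqP; rewrite eqr_div ?tofrac_eq0 ?mulf_neq0 ?expf_neq0 ?mulf_neq0 //.
  by rewrite -!tofracM tofrac_eq !(derM derD, der_add derD); apply/eqP; ring.
rewrite mulf_div -!tofracM !fderivE ?mulf_neq0 // !mulf_div -!tofracM.
rewrite addf_div ?tofrac_eq0 ?mulf_neq0 ?expf_neq0 // -!tofracM -tofracD.
apply/eqP; rewrite eqr_div ?tofrac_eq0 ?mulf_neq0 ?expf_neq0 ?mulf_neq0 //.
by rewrite -!tofracM tofrac_eq !(derM derD, der_add derD); apply/eqP; ring.
Qed.

End Fderiv.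
End Fractions.

(* The partial extension to fractions of a ring morphism phi into a field. For
   phi = jet_eval s this is takes_value, for phi the pullback by a prolonged
   transformation it is is_pullback, and for phi = diff_eval it evaluates formal
   differential fractions. *)
Definition frac_val (P : idomainType) (K : fieldType) (phi : P -> K)
    (f : {fraction P}) (c : K) : Prop :=
  exists n d : P, [/\ f = n%:F / d%:F, phi d != 0 & c = phi n / phi d].

Section FracVal.
Variables (P : idomainType) (K : fieldType) (phi : {rmorphism P -> K}).
Implicit Types (f g : {fraction P}) (a b c : K).
Local Notation val := (frac_val phi).

Let phi_neq0 p : phi p != 0 -> p != 0.
Proof. by apply: contraNneq => ->; rewrite rmorph0. Qed.

Lemma fval_uniq f a b : val f a -> val f b -> a = b.
Proof.
move=> [n [d [ef d0 ->]]] [n' [d' [ef' d'0 ->]]]; apply/eqP.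
rewrite eqr_div // -!rmorphM /=; apply/eqP; congr (phi _).
by apply: frac_cross; rewrite ?phi_neq0 // -ef -ef'.
Qed.

Lemma fval_tofrac p : val p%:F (phi p).
Proof. by exists p, 1; rewrite tofrac1 rmorph1 !divr1 oner_neq0. Qed.

Lemma fval_frac n d : phi d != 0 -> val (n%:F / d%:F) (phi n / phi d).
Proof. by move=> d0; exists n, d. Qed.

Lemma fval0 : val 0 0.
Proof. by have := fval_tofrac 0; rewrite tofrac0 rmorph0. Qed.

Lemma fval1 : val 1 1.
Proof. by have := fval_tofrac 1; rewrite tofrac1 rmorph1. Qed.

Lemma fvalD f g a b : val f a -> val g b -> val (f + g) (a + b).
Proof.
move=> [n [d [-> d0 ->]]] [n' [d' [-> d'0 ->]]].
exists (n * d' + n' * d), (d * d').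
rewrite !rmorphD !rmorphM /= mulf_neq0 //; split=> //.
  by rewrite addf_div ?tofrac_eq0 ?phi_neq0.
by rewrite addf_div.
Qed.

Lemma fvalM f g a b : val f a -> val g b -> val (f * g) (a * b).
Proof.
move=> [n [d [-> d0 ->]]] [n' [d' [-> d'0 ->]]].
by exists (n * n'), (d * d'); rewrite !rmorphM /= mulf_neq0 // !mulf_div.
Qed.

Lemma fvalN f a : val f a -> val (- f) (- a).
Proof.
by move=> [n [d [-> d0 ->]]]; exists (- n), d; rewrite !rmorphN /= !mulNr.
Qed.

Lemma fvalB f g a b : val f a -> val g b -> val (f - g) (a - b).
Proof. by move=> hf /fvalN; apply: fvalD. Qed.

Lemma fvalV f a : val f a -> a != 0 -> val f^-1 a^-1.
Proof.
move=> [n [d [-> d0 ->]]]; rewrite mulf_eq0 invr_eq0 (negPf d0) orbF => n0.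
by exists d, n; rewrite !invf_div.
Qed.

Lemma fval_div f g a b : val f a -> val g b -> b != 0 -> val (f / g) (a / b).
Proof. by move=> hf hg b0; apply: fvalM => //; apply: fvalV. Qed.

Lemma fvalX f a k : val f a -> val (f ^+ k) (a ^+ k).
Proof.
move=> hf; elim: k => [|k IH]; first by rewrite !expr0; apply: fval1.
by rewrite !exprS; apply: fvalM.
Qed.

Lemma fval_nat k : val k%:R k%:R.
Proof.
elim: k => [|k IH]; first exact: fval0.
by rewrite !mulrS; apply: fvalD => //; apply: fval1.
Qed.

Lemma fval_total f : (forall p, p != 0 -> phi p != 0) -> exists c, val f c.
Proof.
move=> phi_inj; have [n [d [d0 ->]]] := fracP f.
by exists (phi n / phi d); apply/fval_frac/phi_inj.
Qed.

Lemma fval_der (D : P -> P) (D' : K -> K) f c : derivation D -> derivation D' ->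
  (forall p, D' (phi p) = phi (D p)) -> val f c -> val (fderiv D f) (D' c).
Proof.
move=> hD hD' com [n [d [-> d0 ->]]].
rewrite (fderivE hD) ?phi_neq0 // (der_div hD' _ d0) !com -!rmorphM -rmorphB -rmorphXn.
by apply: fval_frac; rewrite rmorphXn expf_neq0.
Qed.

End FracVal.

Section FracValSubst.
Variables (I : choiceType) (R : idomainType) (P : idomainType) (K : fieldType).
Variables (phi : {rmorphism P -> K}) (c : {rmorphism R -> {fraction P}})
  (c' : {rmorphism R -> K}) (h : I -> {fraction P}) (h' : I -> K).

Lemma fval_msubst : (forall a, frac_val phi (c a) (c' a)) ->
    (forall i, frac_val phi (h i) (h' i)) ->
  forall p, frac_val phi (msubst c h p) (msubst c' h' p).
Proof.
move=> hc hh; apply: malg_ind => [a|i|p q hp hq|p q hp hq].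
- by rewrite !msubstC.
- by rewrite !msubstX.
- by rewrite !rmorphD; apply: fvalD.
- by rewrite !rmorphM; apply: fvalM.
Qed.

End FracValSubst.

Lemma der_divn (K : fieldType) (D : K -> K) (hD : derivation D) (a : K) (n : nat) :
  n%:R != 0 :> K -> D (a / n%:R) = D a / n%:R.
Proof.
by move=> n0; rewrite (der_div hD _ n0) (der_nat hD); field.
Qed.

(** * Recurrence formulas for the invariants tau *)

Section Contraction.
Variable S : comPzRingType.

(** A symmetric tensor is stored by its entries: [a k m] has [k] slots in the direction x and [m] in
    the direction y. Contraction fills one further slot with [v]; by symmetry the order of
    contractions is irrelevant. *)
Definition contr (v : S * S) (a : nat -> nat -> S) (k m : nat) : S :=
  v.1 * a k.+1 m + v.2 * a k m.+1.

Lemma contrC u v a : contr u (contr v a) = contr v (contr u a).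
Proof. by apply/funext => k; apply/funext => m; rewrite /contr; ring. Qed.

Lemma contr_iterC u v n a : contr u (iter n (contr v) a) = iter n (contr v) (contr u a).
Proof. by elim: n => //= n IH; rewrite contrC IH. Qed.

(* The symmetric form of the k-th derivatives of w, applied to i copies of v1
   and j copies of v2; the remaining indices k, m count slots filled with the
   coordinate directions. *)
Definition frame_contr (v1 v2 : S * S) (w : nat -> nat -> S) (i j : nat) :=
  iter i (contr v1) (iter j (contr v2) w).

Lemma frame_contrSr v1 v2 w i j :
  contr v2 (frame_contr v1 v2 w i j) = frame_contr v1 v2 w i j.+1.
Proof. by rewrite /frame_contr contr_iterC. Qed.

End Contraction.

Lemma frame_contr_morph (S S' : comPzRingType) (f : {rmorphism S -> S'})
    (v1 v2 : S * S) (v1' v2' : S' * S') (w : nat -> nat -> S) (w' : nat -> nat -> S') :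
    f v1.1 = v1'.1 -> f v1.2 = v1'.2 -> f v2.1 = v2'.1 -> f v2.2 = v2'.2 ->
    (forall k m, f (w k m) = w' k m) ->
  forall i j k m, f (frame_contr v1 v2 w i j k m) = frame_contr v1' v2' w' i j k m.
Proof.
move=> h11 h12 h21 h22 hw.
have step (v : S * S) (v' : S' * S') a a' : f v.1 = v'.1 -> f v.2 = v'.2 ->
    (forall k m, f (a k m) = a' k m) -> forall k m, f (contr v a k m) = contr v' a' k m.
  by move=> h1 h2 h k m; rewrite /contr rmorphD !rmorphM h1 h2 !h.
elim=> [|i IHi] j.
  elim: j => [|j IHj]; first exact: hw.
  exact: (step v2 v2' _ (frame_contr v1' v2' w' 0 j) h21 h22 IHj).
exact: (step v1 v1' _ (frame_contr v1' v2' w' i j) h11 h12 (IHi j)).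
Qed.

Section Recurrence.
Variables (K : fieldType) (two_neq0 : 2 != 0 :> K).
Variables (Dx Dy : K -> K) (derDx : derivation Dx) (derDy : derivation Dy).
Variables (x y : K) (w : nat -> nat -> K).
Hypotheses (Dxx : Dx x = 1) (Dxy : Dx y = 0) (Dyx : Dy x = 0) (Dyy : Dy y = 1).
Hypotheses (Dxw : forall i j, Dx (w i j) = w i.+1 j)
           (Dyw : forall i j, Dy (w i j) = w i j.+1).

Definition euler_field : K * K := (x, y).
Definition hamilton_field : K * K := (- 2 * w 0 1, 2 * w 1 0).
Local Notation v1 := euler_field.
Local Notation v2 := hamilton_field.
Local Notation T := (frame_contr v1 v2 w).

Definition along (v : K * K) (f : K) : K := v.1 * Dx f + v.2 * Dy f.
Local Notation n1 := (along v1).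
Local Notation n2 := (along v2).

Lemma along_derivation v : derivation (along v).
Proof. exact: lin_comb_derivation. Qed.

(** Leibniz rule: [u] differentiates the tensor of [w], which adds a slot filled by [u], or one of
    the [i] copies of [v1] or [j] copies of [v2]. Exchanging a frame vector for the other shifts
    [(i, j)] along the antidiagonal; at [i = 0] or [j = 0] the truncated predecessor has coefficient
    zero. *)
Lemma along_frame_contr u c11 c12 c21 c22 :
    along u v1.1 = c11 * v1.1 + c12 * v2.1 -> along u v1.2 = c11 * v1.2 + c12 * v2.2 ->
    along u v2.1 = c21 * v1.1 + c22 * v2.1 -> along u v2.2 = c21 * v1.2 + c22 * v2.2 ->
  forall i j k m, along u (T i j k m) = contr u (T i j) k m
    + i%:R * (c11 * T i j k m + c12 * T i.-1 j.+1 k m)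
    + j%:R * (c21 * T i.+1 j.-1 k m + c22 * T i j k m).
Proof.
move=> h11 h12 h21 h22.
have hD := along_derivation u.
have Dw k m : along u (w k m) = contr u w k m by rewrite /along Dxw Dyw.
have Dcontr v a k m : along u (contr v a k m) = along u v.1 * a k.+1 m +
    along u v.2 * a k m.+1 + contr v (fun k m => along u (a k m)) k m.
  by rewrite /contr (der_add hD) !(derM hD); ring.
elim=> [|i IHi].
  elim=> [|j IHj] k m; first by rewrite Dw; ring.
  rewrite -[T 0 j.+1]/(contr v2 (T 0 j)) Dcontr h21 h22.
  rewrite [in X in _ + X = _]/contr !IHj {IHj}.
  rewrite -[T 1 j]/(contr v1 (T 0 j)).
  rewrite -[T 0 j.+2]/(contr v2 (contr v2 (T 0 j))).
  case: j => [|j]; first by rewrite /contr /=; ring.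
  rewrite -[T 0 j.+1]/(contr v2 (T 0 j)) -[T 1 j.+1.-1]/(contr v1 (T 0 j)).
  by rewrite /contr -!natr1; ring.
move=> j k m.
rewrite -[T i.+1 j]/(contr v1 (T i j)) Dcontr h11 h12.
rewrite [in X in _ + X = _]/contr !IHi {IHi}.
rewrite -[T i.+2 j.-1]/(contr v1 (T i.+1 j.-1)) -[i.+1.-1]/i.
rewrite -(frame_contrSr v1 v2 w i j).
case: i => [|i]; first by rewrite /contr /=; ring.
rewrite -[i.+1.-1]/i -(frame_contrSr v1 v2 w i j) -[T i.+1 j]/(contr v1 (T i j)).
by rewrite /contr -!natr1; ring.
Qed.

Hypotheses (w_neq0 : w 0 0 != 0) (E_neq0 : x * w 1 0 + y * w 0 1 != 0).

(** It depends on [x], [y], [w] alone, so it applies both to the coordinate functions and to the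
    real values of a jet. *)
Definition tau i j : K := T i j 0%N 0%N / w 0 0.

Lemma tau00 : tau 0 0 = 1.
Proof. by rewrite /tau divff. Qed.
(** A Hamiltonian field annihilates its Hamiltonian. *)
Lemma tau01 : tau 0 1 = 0.
Proof. by rewrite /tau /frame_contr /contr /=; ring. Qed.
Lemma tau10 : tau 1 0 = (x * w 1 0 + y * w 0 1) / w 0 0.
Proof. by []. Qed.
Lemma tau10_neq0 : tau 1 0 != 0.
Proof. by rewrite tau10 mulf_neq0 ?invr_eq0. Qed.

(** Cramer's rule for a frame of determinant [2 * w 0 0 * tau 1 0]. Since [v2] is the rotated
    gradient of [2 w], its derivative along [v1] has second-order contractions of [w] as
    components. *)
Lemma frame1 :
  [/\ n1 v1.1 = v1.1, n1 v1.2 = v1.2,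
      n1 v2.1 = - (tau 1 1 / tau 1 0) * v1.1 + tau 2 0 / tau 1 0 * v2.1 &
      n1 v2.2 = - (tau 1 1 / tau 1 0) * v1.2 + tau 2 0 / tau 1 0 * v2.2].
Proof.
have n_w k m : n1 (w k m) = x * w k.+1 m + y * w k m.+1 by rewrite /along Dxw Dyw.
have n_2 : n1 2 = 0 by apply: der_nat; apply: along_derivation.
have hD := along_derivation v1.
rewrite tau10 /tau /frame_contr /contr /= (derM hD 2) (derM hD (-2)) (derN hD) n_2 !n_w.
split.
- by rewrite /along /= Dxx Dyx; ring.
- by rewrite /along /= Dxy Dyy; ring.
- by field; rewrite w_neq0 E_neq0.
- by field; rewrite w_neq0 E_neq0.
Qed.

Lemma frame2 :
  [/\ n2 v1.1 = v2.1, n2 v1.2 = v2.2,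
      n2 v2.1 = - (tau 0 2 / tau 1 0) * v1.1 + tau 1 1 / tau 1 0 * v2.1 &
      n2 v2.2 = - (tau 0 2 / tau 1 0) * v1.2 + tau 1 1 / tau 1 0 * v2.2].
Proof.
have n_w k m : n2 (w k m) = - 2 * w 0 1 * w k.+1 m + 2 * w 1 0 * w k m.+1.
  by rewrite /along Dxw Dyw.
have n_2 : n2 2 = 0 by apply: der_nat; apply: along_derivation.
have hD := along_derivation v2.
rewrite tau10 /tau /frame_contr /contr /= (derM hD 2) (derM hD (-2)) (derN hD) n_2 !n_w.
split.
- by rewrite /along /= Dxx Dyx; ring.
- by rewrite /along /= Dxy Dyy; ring.
- by field; rewrite w_neq0 E_neq0.
- by field; rewrite w_neq0 E_neq0.
Qed.

(** The last term comes from the division by [w], because [v1(w) / w = tau 1 0]. It has no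
    counterpart along [v2], which annihilates [w]. *)
Lemma along1_tau i j : n1 (tau i j) = tau i.+1 j + i%:R * tau i j
  + j%:R * (- (tau 1 1 / tau 1 0) * tau i.+1 j.-1 + tau 2 0 / tau 1 0 * tau i j)
  - tau i j * tau 1 0.
Proof.
have [h1 h2 h3 h4] := frame1; have hD := along_derivation v1.
set a := - (_ / _) in h3 h4 *; set b := tau 2 0 / _ in h3 h4 *.
rewrite -[X in _ = X]mul1r -[X in _ = X * _](divff w_neq0) /tau (der_div hD) //.
rewrite (@along_frame_contr v1 1 0 a b) ?mul1r ?mul0r ?addr0 //.
rewrite -[contr v1 (T i j)]/(T i.+1 j) -[along v1 (w 0 0)]/(n1 (w 0 0)).
have -> : n1 (w 0 0) = T 1 0 0%N 0%N by rewrite /along Dxw Dyw.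
by field.
Qed.

Lemma along2_tau i j : n2 (tau i j) = tau i j.+1 + i%:R * tau i.-1 j.+1
  + j%:R * (- (tau 0 2 / tau 1 0) * tau i.+1 j.-1 + tau 1 1 / tau 1 0 * tau i j).
Proof.
have [h1 h2 h3 h4] := frame2; have hD := along_derivation v2.
set a := - (_ / _) in h3 h4 *; set b := tau 1 1 / _ in h3 h4 *.
rewrite /tau (der_div hD) //.
rewrite (@along_frame_contr v2 0 1 a b) ?mul1r ?mul0r ?add0r //.
rewrite (frame_contrSr v1 v2 w i j).
have -> : n2 (w 0 0) = 0 by rewrite /along Dxw Dyw /=; ring.
by field.
Qed.

Lemma along1_tau_rest i j : n1 (tau i j) - tau i.+1 j = i%:R * tau i j
  + j%:R * (- (tau 1 1 / tau 1 0) * tau i.+1 j.-1 + tau 2 0 / tau 1 0 * tau i j)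
  - tau i j * tau 1 0.
Proof. by rewrite along1_tau; ring. Qed.

Lemma along2_tau_rest i j : n2 (tau i j) - tau i j.+1 = i%:R * tau i.-1 j.+1
  + j%:R * (- (tau 0 2 / tau 1 0) * tau i.+1 j.-1 + tau 1 1 / tau 1 0 * tau i j).
Proof. by rewrite along2_tau; ring. Qed.

Definition tauI : K := tau 1 0 / 2.
Definition tauJ : K := (tau 2 0 + 2 * tau 1 1 + tau 0 2) / 8.

Lemma tauI_neq0 : tauI != 0.
Proof. by rewrite mulf_neq0 ?tau10_neq0 ?invr_eq0. Qed.

Lemma along1_tauI : n1 tauI = (tau 2 0 + tau 1 0 - tau 1 0 * tau 1 0) / 2.
Proof.
by rewrite /tauI (der_divn (along_derivation v1)) // along1_tau mul1r mul0r addr0.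
Qed.

Lemma along2_tauI : n2 tauI = tau 1 1 / 2.
Proof.
rewrite /tauI (der_divn (along_derivation v2)) // along2_tau mul1r mul0r addr0.
by rewrite /= tau01 addr0.
Qed.

(** As [Dx] and [Dy] commute on [f], the bracket is the vector field [n1 v2 - n2 v1], that is [-
    (tau 1 1 / tau 1 0) v1 + (tau 2 0 / tau 1 0 - 1) v2]. The derivatives of [tauI] identify both
    coefficients with those of R_1. *)
Lemma along_rel1 f : Dx (Dy f) = Dy (Dx f) -> rel1 n1 n2 tauI f = 0.
Proof.
move=> com; have [h1 h2 h3 h4] := frame1; have [g1 g2 g3 g4] := frame2.
have n12 : n1 (n2 f) - n2 (n1 f) =
    (n1 v2.1 - n2 v1.1) * Dx f + (n1 v2.2 - n2 v1.2) * Dy f.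
  rewrite {2}/along {3}/along (der_add (along_derivation _)) (derM (along_derivation _)).
  rewrite (derM (along_derivation _)) (der_add (along_derivation _)).
  rewrite !(derM (along_derivation _)).
  rewrite [n1 (Dx f)]/along [n1 (Dy f)]/along [n2 (Dx f)]/along [n2 (Dy f)]/along com.
  by ring.
rewrite /rel1 n12 h3 h4 g1 g2 along1_tauI along2_tauI /tauI.
rewrite [n1 f]/along [n2 f]/along.
by field; rewrite two_neq0 tau10_neq0.
Qed.

(** The combination is chosen so that third order cancels: the three second derivatives of [tauI]
    and the term [4 * n1 tauJ] both have leading part [(tau 3 0 + 2 tau 2 1 + tau 1 2) / 2]. The
    rest is a rational identity in the [tau] of order at most two. *)
Lemma along_rel2 : rel2 n1 n2 tauI tauJ = 0.
Proof.
have h1 := along_derivation v1; have h2 := along_derivation v2.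
have e8 : 8 = 2 ^+ 3 :> K by ring.
have eight_neq0 : 8 != 0 :> K by rewrite e8 expf_neq0.
rewrite /rel2 along1_tauI along2_tauI /tauI /tauJ !(der_divn h1) // (der_divn h2) //.
rewrite (derB h1) !(der_add h1) (derM h1 (tau 1 0) (tau 1 0)) (derM h1 2 (tau 1 1)).
rewrite (der_nat h1) !along1_tau along2_tau.
rewrite /=.
by field; rewrite two_neq0 tau10_neq0 eight_neq0.
Qed.

End Recurrence.

(** * Prolonged action *)

Section DerivationMorphism.
Variables (S S' : comNzRingType) (f : {rmorphism S -> S'}).
Variables (D : S -> S) (D' : S' -> S') (hD : derivation D) (hD' : derivation D').

Lemma der_rmorphD p q : D' (f (p + q)) = D' (f p) + D' (f q).
Proof. by rewrite rmorphD (der_add hD'). Qed.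
Lemma der_rmorphM p q : D' (f (p * q)) = D' (f p) * f q + f p * D' (f q).
Proof. by rewrite rmorphM (derM hD'). Qed.
Lemma rmorph_derD p q : f (D (p + q)) = f (D p) + f (D q).
Proof. by rewrite (der_add hD) rmorphD. Qed.
Lemma rmorph_derM p q : f (D (p * q)) = f (D p) * f q + f p * f (D q).
Proof. by rewrite (derM hD) rmorphD !rmorphM. Qed.

End DerivationMorphism.

Lemma iter_comm (T : Type) (f g : T -> T) (com : forall x, f (g x) = g (f x)) n x :
  f (iter n g x) = iter n g (f x).
Proof. by elim: n => //= n IH; rewrite com IH. Qed.

Section Bracket.
Variables (S : comNzRingType) (D1 D2 : S -> S).
Hypotheses (h1 : derivation D1) (h2 : derivation D2).

Lemma bracket_derivation : derivation (fun p => D1 (D2 p) - D2 (D1 p)).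
Proof.
split=> p q; first by rewrite !(der_add h1, der_add h2); ring.
by rewrite !(derM h1, derM h2, der_add h1, der_add h2); ring.
Qed.

End Bracket.

Lemma scale_derivation (R : comNzRingType) (S : comAlgType R) (a b : R)
    (D1 D2 : S -> S) :
  derivation D1 -> derivation D2 -> derivation (fun f => a *: D1 f + b *: D2 f).
Proof.
move=> h1 h2; split=> p q; rewrite ?(der_add h1, der_add h2, derM h1, derM h2).
  by rewrite !scalerDr addrACA.
by rewrite !scalerDr mulrDl mulrDr -!scalerAl -!scalerAr addrACA.
Qed.

Lemma lin_comb_comm (R : comNzRingType) (V : lmodType R) (D1 D2 : V -> V)
    (hD1 : {morph D1 : p q / p + q}) (hD2 : {morph D2 : p q / p + q})
    (hZ1 : forall c, {morph D1 : p / c *: p}) (hZ2 : forall c, {morph D2 : p / c *: p})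
    (com : forall p, D1 (D2 p) = D2 (D1 p)) a b a' b' p :
  a *: D1 (a' *: D1 p + b' *: D2 p) + b *: D2 (a' *: D1 p + b' *: D2 p) =
  a' *: D1 (a *: D1 p + b *: D2 p) + b' *: D2 (a *: D1 p + b *: D2 p).
Proof.
rewrite !hD1 !hD2 !hZ1 !hZ2 com !scalerDr !scalerA.
rewrite [a' * a]mulrC [b' * b]mulrC [a' * b]mulrC [b' * a]mulrC -!addrA.
by congr (_ + _); rewrite !addrA; congr (_ + _); rewrite addrC.
Qed.

Lemma lin_comb_linear (R : comNzRingType) (S : comAlgType R) (D1 D2 : S -> S)
    (hD1 : {morph D1 : p q / p + q}) (hD2 : {morph D2 : p q / p + q})
    (hZ1 : forall c, {morph D1 : p / c *: p}) (hZ2 : forall c, {morph D2 : p / c *: p})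
    a b c d x y : D1 x = 1 -> D1 y = 0 -> D2 x = 0 -> D2 y = 1 ->
  a *: D1 (c *: x + d *: y) + b *: D2 (c *: x + d *: y) = (a * c + b * d)%:A.
Proof.
move=> h1 h2 h3 h4; rewrite hD1 hD2 !hZ1 !hZ2 h1 h2 h3 h4.
by rewrite !scaler0 addr0 add0r !scalerA -scalerDl.
Qed.

Lemma scale_sub_comb (R : comNzRingType) (V : lmodType R) (c a b : R) (u v : V) :
  c *: (a *: u - b *: v) = (c * a) *: u + (- (c * b)) *: v.
Proof. by rewrite scalerBr !scalerA scaleNr. Qed.

Lemma scale_opp_comb (R : comNzRingType) (V : lmodType R) (c a b : R) (u v : V) :
  c *: (- a *: u + b *: v) = (- (c * a)) *: u + (c * b) *: v.
Proof. by rewrite scalerDr !scalerA mulrN. Qed.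

Section Combinations.
Variables (R : comNzRingType) (V : lmodType R).
Implicit Types (a b c d : R) (u v : V).

Lemma lin_combZ a b c u v : a *: (c *: u) + b *: (c *: v) = c *: (a *: u + b *: v).
Proof. by rewrite scalerDr !scalerA ![_ * c]mulrC. Qed.

Lemma lin_map_sub (f : V -> V) (hB : {morph f : p q / p - q})
    (hZ : forall c, {morph f : p / c *: p}) c a b u v :
  f (c *: (a *: u - b *: v)) = c *: (a *: f u - b *: f v).
Proof. by rewrite hZ hB !hZ. Qed.

Lemma lin_map_add (f : V -> V) (hD : {morph f : p q / p + q})
    (hZ : forall c, {morph f : p / c *: p}) c a b u v :
  f (c *: (a *: u + b *: v)) = c *: (a *: f u + b *: f v).
Proof. by rewrite hZ hD !hZ. Qed.

Lemma lin_map2 (f : V -> V) (hD : {morph f : p q / p + q})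
    (hZ : forall c, {morph f : p / c *: p}) a b u v u' v' : f u = u' -> f v = v' ->
  f (a *: u + b *: v) = a *: u' + b *: v'.
Proof. by move=> <- <-; rewrite hD !hZ. Qed.

Lemma lin_map_fix (f : V -> V) (hD : {morph f : p q / p + q})
    (hZ : forall c, {morph f : p / c *: p}) b u v : f u = u -> f v = v ->
  f (u + b *: v) = u + b *: v.
Proof. by move=> hu hv; rewrite hD hZ hu hv. Qed.

Lemma scale_mul1 a b u : a * b = 1 -> a *: (b *: u) = u.
Proof. by move=> e; rewrite scalerA e scale1r. Qed.

Lemma lin_comb10 a b u v : a = 1 -> b = 0 -> a *: u + b *: v = u.
Proof. by move=> -> ->; rewrite scale1r scale0r addr0. Qed.

Lemma lin_comb01 a b u v : a = 0 -> b = 1 -> a *: u + b *: v = v.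
Proof. by move=> -> ->; rewrite scale1r scale0r add0r. Qed.

Lemma lin_comb2 a b a1 b1 a2 b2 u v :
  a *: (a1 *: u + b1 *: v) + b *: (a2 *: u + b2 *: v) =
  (a * a1 + b * a2) *: u + (a * b1 + b * b2) *: v.
Proof. by rewrite !scalerDr !scalerA addrACA -!scalerDl. Qed.

Section Inverse.
Variables (d b11 b10 b01 b00 : R) (u v p q : V).
Hypotheses (ep : p = d *: (b11 *: u - b10 *: v)) (eq : q = d *: (- b01 *: u + b00 *: v)).

Lemma lin_comb_inv c a11 a10 : c *: (a11 *: p - a10 *: q) =
  (c * d * (a11 * b11 + a10 * b01)) *: u + (- (c * d * (a11 * b10 + a10 * b00))) *: v.
Proof.
rewrite ep eq -(scaleNr b10) -(scaleNr a10) !scalerDr !scalerA addrACA -!scalerDl.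
by congr (_ *: _ + _ *: _); ring.
Qed.

Lemma lin_comb_inv' c a01 a00 : c *: (- a01 *: p + a00 *: q) =
  (- (c * d * (a01 * b11 + a00 * b01))) *: u + (c * d * (a01 * b10 + a00 * b00)) *: v.
Proof.
rewrite ep eq -(scaleNr b10) !scalerDr !scalerA addrACA -!scalerDl.
by congr (_ *: _ + _ *: _); ring.
Qed.

End Inverse.
End Combinations.

(** Constant frame vectors contribute nothing to the Leibniz rule, so differentiation along [u] just
    fills one more slot. *)
Lemma der_const_frame (S : comNzRingType) (D : S -> S) (u r1 r2 : S * S)
    (w : nat -> nat -> S) : derivation D ->
    (forall k m, D (w k m) = contr u w k m) ->
    D r1.1 = 0 -> D r1.2 = 0 -> D r2.1 = 0 -> D r2.2 = 0 ->
  forall i j k m, D (frame_contr r1 r2 w i j k m) = contr u (frame_contr r1 r2 w i j) k m.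
Proof.
move=> hD Dw h11 h12 h21 h22.
have step (r : S * S) a : D r.1 = 0 -> D r.2 = 0 ->
    (forall k m, D (a k m) = contr u a k m) ->
    forall k m, D (contr r a k m) = contr u (contr r a) k m.
  move=> h1 h2 Da k m; rewrite contrC /contr (der_add hD) !(derM hD) h1 h2.
  by rewrite !Da /contr; ring.
elim=> [|i IHi] j; last exact: (step r1 (frame_contr r1 r2 w i j) h11 h12 (IHi j)).
by elim: j => [|j IHj]; [exact: Dw|exact: (step r2 (frame_contr r1 r2 w 0 j) h21 h22 IHj)].
Qed.

Lemma malg_derivation0 (I : choiceType) (R : idomainType)
    (D : {malg R[{cmonom I}]} -> {malg R[{cmonom I}]}) : derivation D ->
  (forall c, D c%:MP = 0) -> (forall i, D (mvar R i) = 0) -> forall p, D p = 0.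
Proof.
move=> [hD hM] hC hX; apply: malg_ind => // p q ep eq; first by rewrite hD ep eq addr0.
by rewrite hM ep eq mul0r mulr0 addr0.
Qed.

Lemma det_mx22 (R : comNzRingType) (A : 'M[R]_2) :
  \det A = A 0 0 * A 1 1 - A 0 1 * A 1 0.
Proof.
rewrite (expand_det_row _ 0) !big_ord_recl big_ord0 /cofactor !det_mx11 !mxE /=.
have e0 : (lift 0 0 : 'I_2) = 1 by apply/val_inj.
have e1 : (lift 1 0 : 'I_2) = 0 by apply/val_inj.
by rewrite e0 e1 /bump /= !add0n expr0 expr1; ring.
Qed.

Lemma mulmx22E (R : comNzRingType) (A B : 'M[R]_2) i j :
  (A *m B) i j = A i 0 * B 0 j + A i 1 * B 1 j.
Proof.
rewrite !mxE !big_ord_recl big_ord0 addr0.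
by have -> : (lift 0 0 : 'I_2) = 1 by apply/val_inj.
Qed.

(* The jets of xy, by which those of z differ from those of w = z - xy/2. *)
Definition xy_jet (S : pzSemiRingType) (x y : S) (i j : nat) : S :=
  match i, j with
  | 0, 0 => x * y | 1, 0 => y | 0, 1 => x | 1, 1 => 1 | _, _ => 0
  end.

Lemma xy_jet_morph (S S' : pzSemiRingType) (f : {rmorphism S -> S'}) x y x' y' i j :
  f x = x' -> f y = y' -> f (xy_jet x y i j) = xy_jet x' y' i j.
Proof.
by move=> <- <-; case: i j => [|[|i]] [|[|j]] /=; rewrite ?rmorphM ?rmorph1 ?rmorph0.
Qed.

Lemma xy_jet_derx (S : comNzRingType) (D : S -> S) x y i j : derivation D ->
  D x = 1 -> D y = 0 -> D (xy_jet x y i j) = xy_jet x y i.+1 j.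
Proof.
move=> hD Dx Dy; case: i j => [|[|i]] [|[|j]]; rewrite /= ?(der0 hD) ?(der1 hD) //.
by rewrite (derM hD) Dx Dy; ring.
Qed.

Lemma xy_jet_dery (S : comNzRingType) (D : S -> S) x y i j : derivation D ->
  D x = 0 -> D y = 1 -> D (xy_jet x y i j) = xy_jet x y i j.+1.
Proof.
move=> hD Dx Dy; case: i j => [|[|i]] [|[|j]]; rewrite /= ?(der0 hD) ?(der1 hD) //.
by rewrite (derM hD) Dx Dy; ring.
Qed.

(** * Jet polynomials and their pullback by the prolonged group *)

Section JetPolynomials.
Variable R : realType.
Local Notation P := (jet_poly R).
Local Notation X := (mvar R JX).
Local Notation Y := (mvar R JY).
Local Notation U i j := (mvar R (JU i j)).

Lemma total_x_derivation : derivation (@total_x R).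
Proof. exact: mderiv_derivation. Qed.
Lemma total_y_derivation : derivation (@total_y R).
Proof. exact: mderiv_derivation. Qed.

Lemma total_xX v : total_x (mvar R v) =
  match v with JX => 1 | JY => 0 | JU i j => U i.+1 j end.
Proof. exact: mderivX. Qed.
Lemma total_yX v : total_y (mvar R v) =
  match v with JX => 0 | JY => 1 | JU i j => U i j.+1 end.
Proof. exact: mderivX. Qed.
Lemma total_xZ c p : total_x (c *: p) = c *: total_x p :> P.
Proof. exact: mderivZ. Qed.
Lemma total_yZ c p : total_y (c *: p) = c *: total_y p :> P.
Proof. exact: mderivZ. Qed.

(** The bracket of two derivations is a derivation, and this one vanishes on constants and
    variables. *)
Lemma total_comm p : total_x (total_y p) = total_y (total_x p) :> P.
Proof.
apply/eqP; rewrite -subr_eq0; apply/eqP; move: p.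
apply: malg_derivation0 => [|c|v].
- exact: bracket_derivation total_x_derivation total_y_derivation.
- have -> : total_y (c%:MP : P) = 0 by exact: mderivC.
  have -> : total_x (c%:MP : P) = 0 by exact: mderivC.
  by rewrite (der0 total_x_derivation) (der0 total_y_derivation) subr0.
rewrite total_xX total_yX; case: v => [||i j]; last by rewrite total_xX total_yX subrr.
  by rewrite (der0 total_x_derivation) (der1 total_y_derivation) subr0.
by rewrite (der1 total_x_derivation) (der0 total_y_derivation) subr0.
Qed.

(* On w the group acts linearly: (x, y) |-> A (x, y) and w |-> \det A w. *)
Definition wpoly (i j : nat) : P := U i j - 2^-1 *: xy_jet X Y i j.

Lemma wpolyK i j : wpoly i j + 2^-1 *: xy_jet X Y i j = U i j.
Proof. exact: subrK. Qed.

Lemma total_x_wpoly i j : total_x (wpoly i j) = wpoly i.+1 j.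
Proof.
rewrite /wpoly (derB total_x_derivation) total_xX total_xZ; congr (_ - _ *: _).
exact: (xy_jet_derx i j total_x_derivation (total_xX JX) (total_xX JY)).
Qed.

Lemma total_y_wpoly i j : total_y (wpoly i j) = wpoly i j.+1.
Proof.
rewrite /wpoly (derB total_y_derivation) total_yX total_yZ; congr (_ - _ *: _).
exact: (xy_jet_dery i j total_y_derivation (total_yX JX) (total_yX JY)).
Qed.

Lemma jet_eval_morphism (s : jet R) : zmod_morphism (jet_eval s) * monoid_morphism (jet_eval s).
Proof. by split; [exact: msubst_additive|exact: msubst_multiplicative]. Qed.
HB.instance Definition _ s := GRing.isZmodMorphism.Build P R (jet_eval s)
  (jet_eval_morphism s).1.
HB.instance Definition _ s := GRing.isMonoidMorphism.Build P R (jet_eval s)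
  (jet_eval_morphism s).2.

Lemma jet_evalX (s : jet R) v : jet_eval s (mvar R v) = s v.
Proof. exact: (msubstX idfun). Qed.
Lemma jet_evalD (s : jet R) (p q : P) : jet_eval s (p + q) = jet_eval s p + jet_eval s q.
Proof. exact: raddfD. Qed.
Lemma jet_evalB (s : jet R) (p q : P) : jet_eval s (p - q) = jet_eval s p - jet_eval s q.
Proof. exact: raddfB. Qed.
Lemma jet_evalM (s : jet R) (p q : P) : jet_eval s (p * q) = jet_eval s p * jet_eval s q.
Proof. exact: rmorphM. Qed.
Lemma jet_evalC (s : jet R) (c : R) : jet_eval s c%:MP = c.
Proof. exact: (msubstC idfun). Qed.
Lemma jet_evalZ (s : jet R) (c : R) (p : P) : jet_eval s (c *: p) = c * jet_eval s p.
Proof. exact: (msubstZ idfun). Qed.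

Section Pullback.
Variable A : 'M[R]_2.

Definition pull : P -> P := msubst malgC (prolong_coord A).

Lemma pull_morphism : zmod_morphism pull * monoid_morphism pull.
Proof. by split; [exact: msubst_additive|exact: msubst_multiplicative]. Qed.
HB.instance Definition _ := GRing.isZmodMorphism.Build P P pull pull_morphism.1.
HB.instance Definition _ := GRing.isMonoidMorphism.Build P P pull pull_morphism.2.

Lemma pullX v : pull (mvar R v) = prolong_coord A v.
Proof. exact: msubstX. Qed.
Lemma pullC c : pull c%:MP = c%:MP.
Proof. exact: msubstC. Qed.
Lemma pullZ c p : pull (c *: p) = c *: pull p.
Proof. by rewrite -!mul_malgC rmorphM /= pullC. Qed.

Lemma pullD p q : pull (p + q) = pull p + pull q.
Proof. exact: raddfD. Qed.
Lemma pullB p q : pull (p - q) = pull p - pull q.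
Proof. exact: raddfB. Qed.
Lemma pull_xy i j :
  pull (xy_jet X Y i j) = xy_jet (prolong_coord A JX) (prolong_coord A JY) i j.
Proof.
exact: (xy_jet_morph (f := pull) i j (pullX JX) (pullX JY)).
Qed.

Lemma jet_eval_prolong s p : jet_eval (prolong A s) p = jet_eval s (pull p).
Proof.
apply: (malg_rmorph_ext (f := jet_eval (prolong A s)) (g := jet_eval s \o pull)) => [c|v] /=.
  by rewrite pullC !jet_evalC.
by rewrite pullX jet_evalX.
Qed.

#[local] Opaque total_x total_y pull.

Definition total_along (a b : R) (p : P) : P := a *: total_x p + b *: total_y p.

Lemma total_along_derivation a b : derivation (total_along a b).
Proof. exact: scale_derivation total_x_derivation total_y_derivation. Qed.

Lemma total_along_comm a b a' b' p :
  total_along a b (total_along a' b' p) = total_along a' b' (total_along a b p).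
Proof.
exact: (lin_comb_comm total_x_derivation.1 total_y_derivation.1 total_xZ total_yZ total_comm).
Qed.

Lemma total_XE : total_X A = total_along ((\det A)^-1 * A 1 1) (- ((\det A)^-1 * A 1 0)).
Proof.
by apply/funext => p; exact: scale_sub_comb.
Qed.
Lemma total_YE : total_Y A = total_along (- ((\det A)^-1 * A 0 1)) ((\det A)^-1 * A 0 0).
Proof.
by apply/funext => p; exact: scale_opp_comb.
Qed.

Hypothesis Aunit : A \in unitmx.

Let detA : \det A != 0. Proof. by rewrite -unitfE -unitmxE. Qed.

Lemma total_along_XY a b c d :
  total_along a b (c *: X + d *: Y) = (a * c + b * d)%:MP.
Proof.
apply: etrans (lin_comb_linear total_x_derivation.1 total_y_derivation.1 total_xZ total_yZ
  a b c d (total_xX JX) (total_xX JY) (total_yX JX) (total_yX JY)) _.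
by rewrite -mul_malgC mulr1.
Qed.

Lemma total_X_XY : total_X A (prolong_coord A JX) = 1 /\ total_X A (prolong_coord A JY) = 0.
Proof.
have e1 : (\det A)^-1 * A 1 1 * A 0 0 + - ((\det A)^-1 * A 1 0) * A 0 1 = 1.
  by apply: (mulfI detA); rewrite [RHS]mulr1 {4}det_mx22; field.
have e0 : (\det A)^-1 * A 1 1 * A 1 0 + - ((\det A)^-1 * A 1 0) * A 1 1 = 0 by ring.
rewrite total_XE; split.
  exact: (etrans (total_along_XY _ _ (A 0 0) (A 0 1)) (congr1 malgC e1)).
exact: (etrans (total_along_XY _ _ (A 1 0) (A 1 1)) (etrans (congr1 malgC e0) (@malgC0E _ _))).
Qed.

Lemma total_Y_XY : total_Y A (prolong_coord A JX) = 0 /\ total_Y A (prolong_coord A JY) = 1.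
Proof.
have e1 : - ((\det A)^-1 * A 0 1) * A 1 0 + (\det A)^-1 * A 0 0 * A 1 1 = 1.
  by apply: (mulfI detA); rewrite [RHS]mulr1 {4}det_mx22; field.
have e0 : - ((\det A)^-1 * A 0 1) * A 0 0 + (\det A)^-1 * A 0 0 * A 0 1 = 0 by ring.
rewrite total_YE; split.
  exact: (etrans (total_along_XY _ _ (A 0 0) (A 0 1)) (etrans (congr1 malgC e0) (@malgC0E _ _))).
exact: (etrans (total_along_XY _ _ (A 1 0) (A 1 1)) (congr1 malgC e1)).
Qed.

Lemma pull_total (T t : P -> P) : derivation T -> derivation t ->
    (forall c, T c%:MP = 0) -> (forall c, t c%:MP = 0) ->
    (forall v, T (prolong_coord A v) = pull (t (mvar R v))) ->
  forall p, T (pull p) = pull (t p).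
Proof.
move=> hT ht T0 t0 hv.
apply: (malg_derivation_ext (f := pull)) => [p q|p q|p q|p q|c|v].
- exact: (der_rmorphD pull hT).
- exact: (rmorph_derD pull ht).
- exact: (der_rmorphM pull hT).
- exact: (rmorph_derM pull ht).
- by rewrite pullC T0 t0 raddf0.
by rewrite pullX hv.
Qed.

Lemma total_alongC a b c : total_along a b c%:MP = 0.
Proof.
have h1 : total_x (c%:MP : P) = 0 by exact: mderivC.
have h2 : total_y (c%:MP : P) = 0 by exact: mderivC.
by rewrite /total_along h1 h2 !scaler0 addr0.
Qed.

(** Chain rule. On the variables [JU i j] it is the definition of the prolongation, in which
    [total_X] is applied last. *)
Lemma pull_total_x p : total_X A (pull p) = pull (total_x p).
Proof.
move: p; apply: pull_total.
- by rewrite total_XE; apply: total_along_derivation.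
- exact: total_x_derivation.
- by move=> c; rewrite total_XE total_alongC.
- by move=> c; exact: mderivC.
case=> [||i j]; rewrite total_xX.
- by rewrite total_X_XY.1 rmorph1.
- by rewrite total_X_XY.2 raddf0.
by rewrite pullX.
Qed.

Lemma pull_total_y p : total_Y A (pull p) = pull (total_y p).
Proof.
move: p; apply: pull_total.
- by rewrite total_YE; apply: total_along_derivation.
- exact: total_y_derivation.
- by move=> c; rewrite total_YE total_alongC.
- by move=> c; exact: mderivC.
case=> [||i j]; rewrite total_yX.
- by rewrite total_Y_XY.1 raddf0.
- by rewrite total_Y_XY.2 rmorph1.
(* Here [total_Y] has to pass through the [i] outer applications of [total_X], which is possible
   because operators [total_along] with constant coefficients commute. *)
apply: etrans (esym (pullX (JU i j.+1))); apply: iter_comm => p.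
by rewrite total_XE total_YE; apply: total_along_comm.
Qed.

Lemma pull_w00 : pull (wpoly 0 0) = \det A *: wpoly 0 0.
Proof.
apply: etrans (pullB _ _) _.
have eU := pullX (JU 0 0).
have eZ := etrans (pullZ 2^-1 (xy_jet X Y 0 0)) (congr1 ( *:%R 2^-1) (pull_xy 0 0)).
by apply: etrans (congr2 (fun a b => a - b) eU eZ) _; apply: addrK.
Qed.

(** The columns of the inverse of [A], that is, the coefficients of [total_X] and [total_Y] in terms
    of [total_x] and [total_y]. *)
Definition inv_col1 : P * P := (((\det A)^-1 * A 1 1)%:MP, (- ((\det A)^-1 * A 1 0))%:MP).
Definition inv_col2 : P * P := ((- ((\det A)^-1 * A 0 1))%:MP, ((\det A)^-1 * A 0 0)%:MP).
Local Notation F := (frame_contr inv_col1 inv_col2 wpoly).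

Lemma total_along_frame a b i j k m :
  total_along a b (F i j k m) = contr (a%:MP, b%:MP) (F i j) k m.
Proof.
apply: (der_const_frame (total_along_derivation a b)); rewrite ?total_alongC //.
move=> k' m'; rewrite /total_along total_x_wpoly total_y_wpoly.
exact: (congr2 +%R (esym (mul_malgC a (wpoly k'.+1 m'))) (esym (mul_malgC b (wpoly k' m'.+1)))).
Qed.

Lemma total_alongZ a b c p : total_along a b (c *: p) = c *: total_along a b p.
Proof.
rewrite /total_along total_xZ total_yZ.
exact: (lin_combZ a b c (total_x p) (total_y p)).
Qed.

(** This is the gain from using [w]: its prolongation is tensorial, with no lower-order terms,
    because the new total derivatives have constant coefficients. Any frame can thus be normalized
    by a choice of [A]. *)
Lemma pull_wpoly i j : pull (wpoly i j) = \det A *: F i j 0%N 0%N.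
Proof.
elim: i => [|i IHi].
  elim: j => [|j IHj]; first exact: pull_w00.
  apply: etrans (congr1 pull (esym (total_y_wpoly 0 j))) _.
  apply: etrans (esym (pull_total_y (wpoly 0 j))) _; rewrite {}IHj total_YE total_alongZ.
  exact: (congr1 (fun p => \det A *: p) (total_along_frame _ _ 0 j 0%N 0%N)).
apply: etrans (congr1 pull (esym (total_x_wpoly i j))) _.
apply: etrans (esym (pull_total_x (wpoly i j))) _; rewrite {}IHi total_XE total_alongZ.
exact: (congr1 (fun p => \det A *: p) (total_along_frame _ _ i j 0%N 0%N)).
Qed.

End Pullback.

Section PullbackInverse.
Variables A B : 'M[R]_2.
Hypothesis AB1 : A *m B = 1%:M.

Let entry i j : A i 0 * B 0 j + A i 1 * B 1 j = (i == j)%:R.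
Proof. by rewrite -mulmx22E AB1 mxE. Qed.
Let detAB : \det A * \det B = 1.
Proof. by rewrite -det_mulmx AB1 det1. Qed.
Let detAVB : (\det A)^-1 * (\det B)^-1 = 1.
Proof. by rewrite -invfM detAB invr1. Qed.
Let Aunit : A \in unitmx. Proof. by case: (mulmx1_unit AB1). Qed.
Let Bunit : B \in unitmx. Proof. by case: (mulmx1_unit AB1). Qed.

Lemma pull_inv_total_x p : pull B (pull A (total_x p)) = total_x (pull B (pull A p)).
Proof.
rewrite -(pull_total_x Aunit) {1}/total_X; move: (pull A p) => q.
apply: etrans (lin_map_sub (pullB B) (pullZ B) _ _ _ _ _) _.
apply: etrans (lin_comb_inv
  (esym (pull_total_x Bunit q)) (esym (pull_total_y Bunit q)) (\det A)^-1 (A 1 1) (A 1 0)) _.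
have -> : (\det A)^-1 * (\det B)^-1 * (A 1 1 * B 1 1 + A 1 0 * B 0 1) = 1.
  by rewrite detAVB mul1r addrC (entry 1 1).
have -> : - ((\det A)^-1 * (\det B)^-1 * (A 1 1 * B 1 0 + A 1 0 * B 0 0)) = 0.
  by rewrite addrC (entry 1 0) mulr0 oppr0.
by rewrite scale1r scale0r addr0.
Qed.

Lemma pull_inv_total_y p : pull B (pull A (total_y p)) = total_y (pull B (pull A p)).
Proof.
rewrite -(pull_total_y Aunit) {1}/total_Y; move: (pull A p) => q.
apply: etrans (lin_map_add (pullD B) (pullZ B) _ _ _ _ _) _.
apply: etrans (lin_comb_inv'
  (esym (pull_total_x Bunit q)) (esym (pull_total_y Bunit q)) (\det A)^-1 (A 0 1) (A 0 0)) _.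
have -> : - ((\det A)^-1 * (\det B)^-1 * (A 0 1 * B 1 1 + A 0 0 * B 0 1)) = 0.
  by rewrite addrC (entry 0 1) mulr0 oppr0.
have -> : (\det A)^-1 * (\det B)^-1 * (A 0 1 * B 1 0 + A 0 0 * B 0 0) = 1.
  by rewrite detAVB mul1r addrC (entry 0 0).
by rewrite scale1r scale0r add0r.
Qed.

Lemma pull_linear (M : 'M[R]_2) c d :
  pull M (c *: X + d *: Y) = c *: prolong_coord M JX + d *: prolong_coord M JY.
Proof.
exact: (lin_map2 (pullD M) (pullZ M) c d (pullX M JX) (pullX M JY)).
Qed.

(** Pullback reverses composition, so this is the pullback by the product [A *m B]. It commutes with
    the total derivatives, hence only x, y and z matter; z is treated through [w], which is scaled
    by the two determinants in turn. *)
Lemma pullK p : pull B (pull A p) = p.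
Proof.
apply: (malg_rmorph_ext (f := pull B \o pull A) (g := idfun)) => [c|v] /=.
  by rewrite !pullC.
have [e00 e01] := (entry 0 0, entry 0 1); have [e10 e11] := (entry 1 0, entry 1 1).
rewrite /= in e00 e01 e10 e11.
have hX : pull B (pull A X) = X.
  apply: etrans (congr1 (pull B) (pullX A JX)) _.
  apply: etrans (pull_linear B (A 0 0) (A 0 1)) _.
  apply: etrans (lin_comb2 (A 0 0) (A 0 1) (B 0 0) (B 0 1) (B 1 0) (B 1 1) X Y) _.
  exact: (lin_comb10 _ _ e00 e01).
have hY : pull B (pull A Y) = Y.
  apply: etrans (congr1 (pull B) (pullX A JY)) _.
  apply: etrans (pull_linear B (A 1 0) (A 1 1)) _.
  apply: etrans (lin_comb2 (A 1 0) (A 1 1) (B 0 0) (B 0 1) (B 1 0) (B 1 1) X Y) _.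
  exact: (lin_comb01 _ _ e10 e11).
move=> {e00 e01 e10 e11}.
case: v => [||i j]; [exact: hX|exact: hY|].
pose f p := pull B (pull A p).
have fD : {morph f : p q / p + q}.
  by move=> p' q; apply: etrans (congr1 (pull B) (pullD A _ _)) _; apply: pullD.
have fZ c : {morph f : p / c *: p}.
  by move=> p'; apply: etrans (congr1 (pull B) (pullZ A _ _)) _; apply: pullZ.
elim: i => [|i IHi]; last first.
  apply: etrans (congr1 f (esym (total_xX (JU i j)))) _.
  apply: etrans (pull_inv_total_x (U i j)) _.
  by apply: etrans (congr1 (@total_x R) IHi) _; apply: total_xX.
elim: j => [|j IHj]; last first.
  apply: etrans (congr1 f (esym (total_yX (JU 0 j)))) _.
  apply: etrans (pull_inv_total_y (U 0 j)) _.
  by apply: etrans (congr1 (@total_y R) IHj) _; apply: total_yX.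
have hw : f (wpoly 0 0) = wpoly 0 0.
  apply: etrans (congr1 (pull B) (pull_w00 A)) _; apply: etrans (pullZ B _ _) _.
  apply: etrans (congr1 (fun p => \det A *: p) (pull_w00 B)) _.
  exact: scale_mul1.
have hxy : f (xy_jet X Y 0 0) = xy_jet X Y 0 0.
  apply: etrans (congr1 (pull B) (pull_xy A 0 0)) _.
  apply: (xy_jet_morph (f := pull B) 0 0).
    exact: etrans (congr1 (pull B) (esym (pullX A JX))) hX.
  exact: etrans (congr1 (pull B) (esym (pullX A JY))) hY.
move=> {hX hY}; have e := wpolyK 0 0.
apply: etrans (congr1 f (esym e)) _; apply: etrans _ e.
exact: (lin_map_fix fD fZ 2^-1 hw hxy).
Qed.

End PullbackInverse.
End JetPolynomials.

(** * Invariants and derivations in terms of w *)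

Section ChartIdentities.
Variables (K : fieldType) (two_neq0 : 2 != 0 :> K).
Variables x y z zx zy zxy w00 w10 w01 w20 w11 w02 : K.
Hypotheses (hz : z = w00 + x * y / 2) (hzx : zx = w10 + y / 2) (hzy : zy = w01 + x / 2)
  (hzxy : zxy = w11 + 1 / 2) (w_neq0 : w00 != 0).

Lemma hamilton_chart p q :
  (x - 2 * zy) * p + (2 * zx - y) * q = (- 2 * w01) * p + (2 * w10) * q.
Proof. by rewrite hzx hzy; field. Qed.

Lemma I1_chart : (x * zx + y * zy - x * y) / (2 * z - x * y) =
  (x * w10 + y * w01) / w00 / 2.
Proof.
have -> : 2 * z - x * y = 2 * w00 by rewrite hz; field.
by rewrite hzx hzy; field; rewrite two_neq0 w_neq0.
Qed.

(** The last term of the numerator of I'_2c absorbs the [1 / 2] in [zxy = w11 + 1 / 2], so that a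
    pure Hessian of [w] is left. *)
Lemma I2c_chart :
  (zx ^+ 2 * w02 - 2 * zx * (zy - x) * zxy + (zy - x) ^+ 2 * w20 + zx * (zy - x))
    / (2 * z - x * y) =
  ((w10 + y / 2) ^+ 2 * w02 - 2 * (w10 + y / 2) * (w01 - x / 2) * w11
     + (w01 - x / 2) ^+ 2 * w20) / (2 * w00).
Proof.
have -> : 2 * z - x * y = 2 * w00 by rewrite hz; field.
rewrite hzx hzy hzxy; congr (_ / _); by field.
Qed.

End ChartIdentities.

(** [tauJ] is the Hessian of [w] on [v1 + v2], divided by [8 w]. As [v1 + v2] is [-2] times the
    vector [(w 0 1 - x / 2, - (w 1 0 + y / 2))], squaring the factor leaves the denominator
    [2 w]. *)
Lemma I2c_tauJ (K : fieldType) (two_neq0 : 2 != 0 :> K) (x y : K) (w : nat -> nat -> K) :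
  w 0 0 != 0 -> tauJ x y w =
  ((w 1 0 + y / 2) ^+ 2 * w 0 2 - 2 * (w 1 0 + y / 2) * (w 0 1 - x / 2) * w 1 1
     + (w 0 1 - x / 2) ^+ 2 * w 2 0) / (2 * w 0 0).
Proof.
move=> w0; rewrite /tauJ /tau /frame_contr /contr /=.
have e8 : 8 = 2 ^+ 3 :> K by ring.
have eight_neq0 : 8 != 0 :> K by rewrite e8 expf_neq0.
by field; rewrite two_neq0 w0 eight_neq0.
Qed.

Section EquivarianceIdentities.
Variables (K : fieldType) (two_neq0 : 2 != 0 :> K) (x y : K) (w : nat -> nat -> K).
Variables (a b c d : K).
Let D := a * d - b * c.
Hypotheses (D_neq0 : D != 0) (w_neq0 : w 0 0 != 0).
Let X := a * x + b * y.
Let Y := c * x + d * y.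
Let W i j := D * frame_contr (D^-1 * d, - (D^-1 * c)) (- (D^-1 * b), D^-1 * a) w i j 0%N 0%N.

Lemma tauI_equiv : tauI X Y W = tauI x y w.
Proof.
rewrite /tauI /tau /W /frame_contr /contr /= /X /Y.
by move: D_neq0; rewrite /D => D0; field; rewrite two_neq0 w_neq0 D0.
Qed.

Lemma tauJ_equiv : tauJ X Y W = tauJ x y w.
Proof.
rewrite !I2c_tauJ // ?mulf_neq0 //; rewrite /W /frame_contr /contr /= /X /Y.
by move: D_neq0; rewrite /D => D0; field; rewrite two_neq0 w_neq0 D0.
Qed.

(** The coefficients of the Euler field at the image point, paired with [D_X] and [D_Y] written in
    the old coordinates, give back the same operator. [hamilton_equiv] is the analogue for [v2],
    where the factor [D] of [W] compensates the inverse determinants. *)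
Lemma euler_equiv p q :
  X * (D^-1 * d * p + - (D^-1 * c) * q) + Y * (- (D^-1 * b) * p + D^-1 * a * q) = x * p + y * q.
Proof. by rewrite /X /Y; move: D_neq0; rewrite /D => D0; field. Qed.

Lemma hamilton_equiv p q :
  (- 2 * W 0 1) * (D^-1 * d * p + - (D^-1 * c) * q) + (2 * W 1 0) * (- (D^-1 * b) * p + D^-1 * a * q)
   = - 2 * w 0 1 * p + 2 * w 1 0 * q.
Proof.
rewrite /W /frame_contr /contr /=.
by move: D_neq0; rewrite /D => D0; field.
Qed.

End EquivarianceIdentities.

Section JetField.
Variable R : realType.
Local Notation P := (jet_poly R).
Local Notation K := (jet_field R).
Local Notation X := (mvar R JX).
Local Notation Y := (mvar R JY).
Local Notation x := (cx R).
Local Notation y := (cy R).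

Definition const_field (c : R) : K := ((c%:MP : P))%:F.
Lemma const_field_morphism : zmod_morphism const_field * monoid_morphism const_field.
Proof.
split; first exact: (raddfB ((@FracField.tofrac P) \o malgC)).
split; first exact: (rmorph1 ((@FracField.tofrac P) \o malgC)).
exact: (rmorphM ((@FracField.tofrac P) \o malgC)).
Qed.
HB.instance Definition _ := GRing.isZmodMorphism.Build R K const_field
  const_field_morphism.1.
HB.instance Definition _ := GRing.isMonoidMorphism.Build R K const_field
  const_field_morphism.2.

Lemma natK_neq0 n : n.+1%:R != 0 :> K.
Proof.
have -> : n.+1%:R = const_field n.+1%:R by rewrite rmorph_nat.
by rewrite fmorph_eq0 pnatr_eq0.
Qed.
Let two_neq0 : 2 != 0 :> K. Proof. exact: natK_neq0. Qed.

Lemma tofracZ c (p : P) : (c *: p)%:F = const_field c * p%:F.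
Proof. by rewrite -mul_malgC tofracM. Qed.

Lemma const_field_half : const_field 2^-1 = 2^-1.
Proof. by rewrite fmorphV rmorph_nat. Qed.

Definition wF (i j : nat) : K := (wpoly R i j)%:F.
Local Notation w := wF.

Lemma cu_wF i j : cu R i j = w i j + xy_jet x y i j / 2.
Proof.
rewrite /cu -(wpolyK R i j) tofracD tofracZ const_field_half mulrC.
congr (_ + _ / _); exact: (xy_jet_morph (f := @FracField.tofrac P)).
Qed.

Lemma Dx_derivation : derivation (@Dx R).
Proof. exact: fderiv_derivation (total_x_derivation R). Qed.
Lemma Dy_derivation : derivation (@Dy R).
Proof. exact: fderiv_derivation (total_y_derivation R). Qed.
Lemma DxF (p : P) : Dx p%:F = (total_x p)%:F.
Proof. exact: fderivF (total_x_derivation R) p. Qed.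
Lemma DyF (p : P) : Dy p%:F = (total_y p)%:F.
Proof. exact: fderivF (total_y_derivation R) p. Qed.

Lemma Dx_x : Dx x = 1. Proof. by rewrite /cx DxF total_xX tofrac1. Qed.
Lemma Dx_y : Dx y = 0. Proof. by rewrite /cy DxF total_xX tofrac0. Qed.
Lemma Dy_x : Dy x = 0. Proof. by rewrite /cx DyF total_yX tofrac0. Qed.
Lemma Dy_y : Dy y = 1. Proof. by rewrite /cy DyF total_yX tofrac1. Qed.
Lemma Dx_w i j : Dx (w i j) = w i.+1 j.
Proof. by rewrite /wF DxF total_x_wpoly. Qed.
Lemma Dy_w i j : Dy (w i j) = w i j.+1.
Proof. by rewrite /wF DyF total_y_wpoly. Qed.

Lemma Dx_Dy_comm (f : K) : Dx (Dy f) = Dy (Dx f).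
Proof.
have [n [d [d0 ->]]] := fracP f.
pose C (g : K) : K := Dx (Dy g) - Dy (Dx g); suff : C (n%:F / d%:F) = 0 by move/eqP; rewrite subr_eq0 => /eqP.
have hC : derivation C := bracket_derivation Dx_derivation Dy_derivation.
have C0 (p : P) : C p%:F = 0 by rewrite /C DyF !DxF DyF total_comm subrr.
by rewrite (der_div hC) ?tofrac_eq0 // !C0 mul0r mulr0 subrr mul0r.
Qed.

(* Here u prescribes the derivatives of w = z - xy/2 at (a, b). *)
Definition jet_of (a b : R) (u : nat -> nat -> R) : jet R := fun v =>
  match v with JX => a | JY => b | JU i j => u i j + 2^-1 * xy_jet a b i j end.

Lemma jet_eval_wpoly s i j :
  jet_eval s (wpoly R i j) = s (JU i j) - 2^-1 * xy_jet (s JX) (s JY) i j.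
Proof.
apply: etrans (jet_evalB s _ _) _; apply: (congr2 (fun u v : R => u - v) (jet_evalX s (JU i j))).
apply: etrans (jet_evalZ s _ _) _; congr (_ * _).
exact: (xy_jet_morph (f := jet_eval s) i j (jet_evalX s JX) (jet_evalX s JY)).
Qed.

Lemma jet_of_wpoly a b u i j : jet_eval (jet_of a b u) (wpoly R i j) = u i j.
Proof. by rewrite jet_eval_wpoly /= addrK. Qed.

(** This is [v1(w)], half the determinant of the frame: the frame can be normalized where it does
    not vanish. *)
Definition Epoly : P := X * wpoly R 1 0 + Y * wpoly R 0 1.

Lemma jet_eval_Epoly (s : jet R) u v :
  jet_eval s (wpoly R 1 0) = u -> jet_eval s (wpoly R 0 1) = v ->
  jet_eval s Epoly = s JX * u + s JY * v.
Proof.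
move=> <- <-.
apply: etrans (jet_evalD s _ _) _; apply: (congr2 +%R).
  exact: etrans (jet_evalM s _ _) (congr1 (fun u : R => u * _) (jet_evalX s JX)).
exact: etrans (jet_evalM s _ _) (congr1 (fun u : R => u * _) (jet_evalX s JY)).
Qed.

Lemma EpolyF : Epoly%:F = x * w 1 0 + y * w 0 1.
Proof. exact: etrans (tofracD _ _) (congr2 +%R (tofracM _ _) (tofracM _ _)). Qed.

Lemma jet_eval_neq0 (s : jet R) (p : P) : jet_eval s p != 0 -> p != 0.
Proof. by apply: contraNneq => ->; rewrite raddf0. Qed.

Lemma w_neq0 : w 0 0 != 0.
Proof.
rewrite /wF tofrac_eq0; apply: (@jet_eval_neq0 (jet_of 1 0 (fun _ _ => 1))).
by rewrite jet_of_wpoly oner_neq0.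
Qed.

Lemma E_neq0 : x * w 1 0 + y * w 0 1 != 0.
Proof.
rewrite -EpolyF tofrac_eq0; apply: (@jet_eval_neq0 (jet_of 1 0 (fun _ _ => 1))).
rewrite (jet_eval_Epoly (jet_of_wpoly 1 0 _ 1 0) (jet_of_wpoly 1 0 _ 0 1)).
by rewrite mul0r addr0 mulr1 oner_neq0.
Qed.

Local Notation v1 := (euler_field x y).
Local Notation v2 := (hamilton_field w).

Lemma nabla2E : @nabla2 R = along (@Dx R) (@Dy R) v2.
Proof.
apply/funext => f.
exact: (hamilton_chart two_neq0 (cu_wF 1 0) (cu_wF 0 1)).
Qed.

Lemma I1E : I1' R = tauI x y w.
Proof. exact: (I1_chart two_neq0 (cu_wF 0 0) (cu_wF 1 0) (cu_wF 0 1) w_neq0). Qed.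

Lemma cu_wF0 i j : xy_jet x y i j = 0 -> cu R i j = w i j.
Proof. by move=> e; rewrite cu_wF e mul0r addr0. Qed.

Lemma I2cE : I2c' R = tauJ x y w.
Proof.
rewrite (I2c_tauJ two_neq0 x y w_neq0) -(@cu_wF0 2 0) // -(@cu_wF0 0 2) //.
exact: (I2c_chart two_neq0 (cu R 2 0) (cu R 0 2) (cu_wF 0 0) (cu_wF 1 0) (cu_wF 0 1) (cu_wF 1 1)).
Qed.

End JetField.

Lemma cross_diff_morph (S S' : comNzRingType) (f : {rmorphism S -> S'}) h n d n' d' :
  f (h * (n * d' - n' * d) * (d * d')) =
  f h * (f n * f d' - f n' * f d) * (f d * f d').
Proof. by rewrite !rmorphM rmorphB !rmorphM. Qed.

Section FracValFrames.
Variables (P : idomainType) (K : fieldType) (phi : {rmorphism P -> K}).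
Local Notation L := {fraction P}.
Local Notation val := (frac_val phi).

Lemma fval_contr (v : L * L) (v' : K * K) a a' : val v.1 v'.1 -> val v.2 v'.2 ->
    (forall k m, val (a k m) (a' k m)) ->
  forall k m, val (contr v a k m) (contr v' a' k m).
Proof. by move=> h1 h2 ha k m; apply: fvalD; apply: fvalM. Qed.

Lemma fval_frame_contr (v1 v2 : L * L) (v1' v2' : K * K) w w' :
    val v1.1 v1'.1 -> val v1.2 v1'.2 -> val v2.1 v2'.1 -> val v2.2 v2'.2 ->
    (forall k m, val (w k m) (w' k m)) ->
  forall i j k m, val (frame_contr v1 v2 w i j k m) (frame_contr v1' v2' w' i j k m).
Proof.
move=> h11 h12 h21 h22 hw; elim=> [|i IHi] j.
  by elim: j => [|j IHj]; [exact: hw|exact: (fval_contr h21 h22 IHj)].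
exact: (fval_contr h11 h12 (IHi j)).
Qed.

Variables (x y : L) (w : nat -> nat -> L) (x' y' : K) (w' : nat -> nat -> K).
Hypotheses (hx : val x x') (hy : val y y') (hw : forall k m, val (w k m) (w' k m)).
Hypotheses (w'_neq0 : w' 0 0 != 0).

Lemma fval_tau i j : val (tau x y w i j) (tau x' y' w' i j).
Proof.
have v2k : val 2 2 := fval_nat phi 2.
apply: fval_div => //; apply: fval_frame_contr => //=; last exact: fvalM.
by apply: fvalM => //; apply: fvalN.
Qed.

Lemma fval_tauI : 2 != 0 :> K -> val (tauI x y w) (tauI x' y' w').
Proof. by move=> two; apply: fval_div two; [exact: fval_tau|exact: fval_nat]. Qed.

Lemma fval_tauJ : 2 != 0 :> K -> val (tauJ x y w) (tauJ x' y' w').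
Proof.
move=> two; have e8 : 8 = 2 ^+ 3 :> K by ring.
apply: fval_div; [|exact: fval_nat|by rewrite e8 expf_neq0].
have := fval_nat phi 2 => v2k.
apply: fvalD; last exact: fval_tau.
by apply: fvalD; [exact: fval_tau|apply: fvalM => //; exact: fval_tau].
Qed.

End FracValFrames.

(** * Pointwise and algebraic pullback; invariance of the generators *)

Section Pullbacks.
Variable R : realType.
Local Notation P := (jet_poly R).
Local Notation K := (jet_field R).
Local Notation X := (mvar R JX).
Local Notation Y := (mvar R JY).
Local Notation x := (cx R).
Local Notation y := (cy R).
Local Notation w := (@wF R).
Local Notation kc := (@const_field R).

Lemma real_infinite n : exists s : seq R, uniq s /\ size s = n.
Proof.
exists [seq i%:R | i <- iota 0 n]; split; last by rewrite size_map size_iota.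
rewrite map_inj_uniq ?iota_uniq // => i j /eqP; by rewrite eqr_nat => /eqP.
Qed.

Lemma jet_poly_nonvanishing (p : P) : p != 0 -> exists s : jet R, jet_eval s p != 0.
Proof. exact: (malg_nonvanishing real_infinite). Qed.

(** If the cross difference were nonzero, its product with [h] and both denominators would be
    nonzero at some jet, where both functions have values. The factor [h] allows the hypothesis to
    be restricted to a convenient dense set. *)
Lemma jet_field_density (h : P) (f g : K) : h != 0 ->
    (forall s c c', jet_eval s h != 0 -> takes_value f s c -> takes_value g s c' -> c = c') ->
  f = g.
Proof.
move=> h0 H; have [n [d [d0 ef]]] := fracP f; have [n' [d' [d'0 eg]]] := fracP g.
rewrite ef eg; apply/eqP; rewrite eqr_div ?tofrac_eq0 // -subr_eq0.
apply/eqP; rewrite -!tofracM -tofracB; apply/eqP; rewrite tofrac_eq0.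
apply/negP => /negP q0; have hh := mulf_neq0 (mulf_neq0 h0 q0) (mulf_neq0 d0 d'0).
have [s hs0] := jet_poly_nonvanishing hh.
have := eq_ind _ (fun u => u != 0) hs0 _ (cross_diff_morph (jet_eval s) h n d n' d').
rewrite !mulf_eq0 !negb_or.
case/andP => /andP[hs qs] /andP[ds d's].
have := H s _ _ hs (ex_intro _ n (ex_intro _ d (And3 ef ds erefl)))
  (ex_intro _ n' (ex_intro _ d' (And3 eg d's erefl))).
move/eqP; rewrite eqr_div // -subr_eq0 => /eqP e.
by rewrite e eqxx in qs.
Qed.

Section Fixed.
Variable A : 'M[R]_2.
Definition pullF (p : P) : K := (pull A p)%:F.

Lemma pullF_morphism : zmod_morphism pullF * monoid_morphism pullF.
Proof.
split; first exact: (raddfB ((@FracField.tofrac P) \o pull A)).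
split; first exact: (rmorph1 ((@FracField.tofrac P) \o pull A)).
exact: (rmorphM ((@FracField.tofrac P) \o pull A)).
Qed.
HB.instance Definition _ := GRing.isZmodMorphism.Build P K pullF pullF_morphism.1.
HB.instance Definition _ := GRing.isMonoidMorphism.Build P K pullF pullF_morphism.2.

Hypothesis Aunit : A \in unitmx.
Let a := kc (A 0 0).
Let b := kc (A 0 1).
Let c := kc (A 1 0).
Let d := kc (A 1 1).
Let D := a * d - b * c.

Lemma const_det : kc (\det A) = D.
Proof. by rewrite det_mx22 rmorphB !rmorphM. Qed.

Lemma det_neq0 : \det A != 0. Proof. by rewrite -unitfE -unitmxE. Qed.

Lemma D_neq0 : D != 0.
Proof. by rewrite -const_det fmorph_eq0 det_neq0. Qed.

Lemma pullF_neq0 p : p != 0 -> pullF p != 0.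
Proof.
rewrite tofrac_eq0; apply: contraNneq => e.
by rewrite -(pullK (mulmxV Aunit) p) e raddf0.
Qed.

Lemma pullF_x : pullF X = a * x + b * y.
Proof.
rewrite /pullF pullX; apply: etrans (tofracD _ _) _.
by apply: congr2; exact: tofracZ.
Qed.

Lemma pullF_y : pullF Y = c * x + d * y.
Proof.
rewrite /pullF pullX; apply: etrans (tofracD _ _) _.
by apply: congr2; exact: tofracZ.
Qed.

Lemma kcV u : kc ((\det A)^-1 * u) = D^-1 * kc u.
Proof. have kV v : kc v^-1 = (kc v)^-1 by exact: fmorphV.
have kM v v' : kc (v * v') = kc v * kc v' by exact: rmorphM.
by rewrite kM kV const_det. Qed.
Lemma kcVN u : kc (- ((\det A)^-1 * u)) = - (D^-1 * kc u).
Proof.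
have kN v : kc (- v) = - kc v by exact: raddfN.
by rewrite kN kcV.
Qed.

Lemma pullF_w i j : pullF (wpoly R i j) =
  D * frame_contr (D^-1 * d, - (D^-1 * c)) (- (D^-1 * b), D^-1 * a) w i j 0%N 0%N.
Proof.
rewrite /pullF pull_wpoly //; apply: etrans (tofracZ _ _) _; rewrite const_det.
apply: (congr1 ( *%R D)).
apply: (frame_contr_morph (f := @FracField.tofrac P)) => [||||k m];
  [exact: kcV|exact: kcVN|exact: kcVN|exact: kcV|by []].
Qed.

Let two_neq0 : 2 != 0 :> K. Proof. exact: natK_neq0. Qed.

Let W i j := D * frame_contr (D^-1 * d, - (D^-1 * c)) (- (D^-1 * b), D^-1 * a) w i j 0%N 0%N.

Lemma fval_pull_x : frac_val pullF x (a * x + b * y).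
Proof. by rewrite -pullF_x; apply: fval_tofrac. Qed.
Lemma fval_pull_y : frac_val pullF y (c * x + d * y).
Proof. by rewrite -pullF_y; apply: fval_tofrac. Qed.
Lemma fval_pull_w i j : frac_val pullF (w i j) (W i j).
Proof. by rewrite /W -pullF_w; apply: fval_tofrac. Qed.

Lemma I1_fixed : frac_val pullF (I1' R) (I1' R).
Proof.
rewrite I1E -{2}(tauI_equiv two_neq0 x y D_neq0 (w_neq0 R)).
apply: fval_tauI two_neq0; [exact: fval_pull_x|exact: fval_pull_y|exact: fval_pull_w|].
exact: mulf_neq0 D_neq0 (w_neq0 R).
Qed.

Lemma I2c_fixed : frac_val pullF (I2c' R) (I2c' R).
Proof.
rewrite I2cE -{2}(tauJ_equiv two_neq0 x y D_neq0 (w_neq0 R)).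
apply: fval_tauJ two_neq0; [exact: fval_pull_x|exact: fval_pull_y|exact: fval_pull_w|].
exact: mulf_neq0 D_neq0 (w_neq0 R).
Qed.

Definition DX (f : K) : K := D^-1 * d * Dx f + - (D^-1 * c) * Dy f.
Definition DY (f : K) : K := - (D^-1 * b) * Dx f + D^-1 * a * Dy f.

Lemma DX_pullF p : DX (pull A p)%:F = (pull A (total_x p))%:F.
Proof.
rewrite /DX DxF DyF; apply: etrans _ (congr1 (@FracField.tofrac P) (pull_total_x Aunit p)).
move: (pull A p) => q; rewrite total_XE; apply: esym; apply: etrans (tofracD _ _) _.
by apply: congr2; apply: etrans (tofracZ _ _) (congr1 (fun u => u * _) _);
  [exact: kcV|exact: kcVN].
Qed.

Lemma DY_pullF p : DY (pull A p)%:F = (pull A (total_y p))%:F.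
Proof.
rewrite /DY DxF DyF; apply: etrans _ (congr1 (@FracField.tofrac P) (pull_total_y Aunit p)).
move: (pull A p) => q; rewrite total_YE; apply: esym; apply: etrans (tofracD _ _) _.
by apply: congr2; apply: etrans (tofracZ _ _) (congr1 (fun u => u * _) _);
  [exact: kcVN|exact: kcV].
Qed.

Lemma fval_pull_Dx f g : frac_val pullF f g -> frac_val pullF (Dx f) (DX g).
Proof.
apply: fval_der; first exact: total_x_derivation.
  exact: lin_comb_derivation (Dx_derivation R) (Dy_derivation R).
exact: DX_pullF.
Qed.

Lemma fval_pull_Dy f g : frac_val pullF f g -> frac_val pullF (Dy f) (DY g).
Proof.
apply: fval_der; first exact: total_y_derivation.
  exact: lin_comb_derivation (Dx_derivation R) (Dy_derivation R).
exact: DY_pullF.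
Qed.

Lemma fval_pull_nabla1 f g : frac_val pullF f g -> frac_val pullF (nabla1 f) (nabla1 g).
Proof.
move=> h; apply: (eq_ind _ (frac_val pullF (nabla1 f)) _ _
  (euler_equiv x y D_neq0 (Dx g) (Dy g))).
exact: fvalD (fvalM fval_pull_x (fval_pull_Dx h)) (fvalM fval_pull_y (fval_pull_Dy h)).
Qed.

Lemma fval_pull_nabla2 f g : frac_val pullF f g -> frac_val pullF (nabla2 f) (nabla2 g).
Proof.
move=> h; rewrite nabla2E; apply: (eq_ind _ (frac_val pullF _) _ _
  (hamilton_equiv w D_neq0 (Dx g) (Dy g))).
have v2k : frac_val pullF 2 2 := fval_nat pullF 2.
exact: fvalD (fvalM (fvalM (fvalN v2k) (fval_pull_w 0 1)) (fval_pull_Dx h))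
  (fvalM (fvalM v2k (fval_pull_w 1 0)) (fval_pull_Dy h)).
Qed.

(** A representative of [f] that is regular at the image jet pulls back to a representative of [g]
    that is regular at [s]. *)
Lemma takes_value_prolong f g s u : frac_val pullF f g ->
  takes_value f (prolong A s) u -> takes_value g s u.
Proof.
move=> fg [n [e [ef es ->]]]; rewrite !jet_eval_prolong in es *.
exists (pull A n), (pull A e); split=> //.
have e0 : pullF e != 0 by rewrite tofrac_eq0; apply: jet_eval_neq0 es.
by apply: (fval_uniq fg); rewrite ef; exact: fval_frac.
Qed.

(** Since [pull A] is injective, [f] has an algebraic pullback [g']. A pointwise pullback [g] has
    the same values as [g'] outside the zeros of the pulled-back denominator, so density gives
    [g = g']. *)
Lemma is_pullbackE f g : is_pullback A f g <-> frac_val pullF f g.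
Proof.
split=> [fg|fg s u u' gu fu']; last first.
  exact: (fval_uniq (phi := jet_eval s) gu (takes_value_prolong fg fu')).
have [g' fg'] := fval_total f pullF_neq0.
suff -> : g = g' by [].
have [n [e [e0 ef]]] := fracP f.
have h0 : pull A e != 0 by have := pullF_neq0 e0; rewrite tofrac_eq0.
apply: (jet_field_density h0) => s u u' es gu g'u'.
have fv : takes_value f (prolong A s) (jet_eval (prolong A s) n / jet_eval (prolong A s) e).
  by exists n, e; rewrite jet_eval_prolong.
rewrite (fg s _ _ gu fv); apply/esym.
exact: (fval_uniq (phi := jet_eval s) g'u' (takes_value_prolong fg' fv)).
Qed.

End Fixed.

Lemma diff_invariantE f : diff_invariant f <->
  forall A : 'M[R]_2, A \in unitmx -> frac_val (pullF A) f f.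
Proof.
split=> h A hA; first exact/is_pullbackE/h.
by move=> s u u'; have /is_pullbackE := h A hA; apply.
Qed.

Lemma I1_invariant : diff_invariant (I1' R).
Proof. by apply/diff_invariantE => A; apply: I1_fixed. Qed.
Lemma I2c_invariant : diff_invariant (I2c' R).
Proof. by apply/diff_invariantE => A; apply: I2c_fixed. Qed.

Lemma nabla1_invariant : invariant_derivation (@nabla1 R).
Proof.
split; first by exists x, y.
move=> A hA f g /(is_pullbackE hA) h; apply/(is_pullbackE hA).
exact: fval_pull_nabla1.
Qed.

Lemma nabla2_invariant : invariant_derivation (@nabla2 R).
Proof.
split; first by exists (x - 2 * cu R 0 1), (2 * cu R 1 0 - y).
move=> A hA f g /(is_pullbackE hA) h; apply/(is_pullbackE hA).
exact: fval_pull_nabla2.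
Qed.

End Pullbacks.

(** * Generation *)

Section TauClosed.
Variables (K : fieldType) (Dx Dy : K -> K) (derDx : derivation Dx) (derDy : derivation Dy).
Variables (x y : K) (w : nat -> nat -> K).
Hypotheses (two_neq0 : 2 != 0 :> K)
  (Dxx : Dx x = 1) (Dxy : Dx y = 0) (Dyx : Dy x = 0) (Dyy : Dy y = 1)
  (Dxw : forall i j, Dx (w i j) = w i.+1 j) (Dyw : forall i j, Dy (w i j) = w i j.+1)
  (w_neq0 : w 0 0 != 0) (E_neq0 : x * w 1 0 + y * w 0 1 != 0).
Local Notation n1 := (along Dx Dy (euler_field x y)).
Local Notation n2 := (along Dx Dy (hamilton_field w)).
Local Notation t := (tau x y w).

Variable G : K -> Prop.
Hypotheses (G0 : G 0) (G1 : G 1) (GD : forall f g, G f -> G g -> G (f + g))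
  (GN : forall f, G f -> G (- f)) (GM : forall f g, G f -> G g -> G (f * g))
  (GV : forall f, G f -> G f^-1)
  (Gn1 : forall f, G f -> G (n1 f)) (Gn2 : forall f, G f -> G (n2 f))
  (GI : G (tauI x y w)) (GJ : G (tauJ x y w)).

Let Gnat n : G n%:R.
Proof. by elim: n => // n IH; rewrite mulrS; apply: GD. Qed.

(** From order 3 on, the recurrence is solved for its leading term. It cannot produce [tau 0 2]: for
    [n2 (tau 0 1)] the correction term is [- tau 0 2] and both sides are zero. This is why [tauJ] is
    needed as a second generator. *)
Lemma tau_closed i j : G (t i j).
Proof.
have G10 : G (t 1 0).
  have -> : t 1 0 = 2 * tauI x y w by rewrite /tauI; field.
  exact: GM.
have G20 : G (t 2 0).
  have -> : t 2 0 = 2 * n1 (tauI x y w) + t 1 0 * t 1 0 - t 1 0.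
    by rewrite (along1_tauI two_neq0) //; field.
  by apply: GD; [apply: GD; apply: GM|apply: GN] => //; apply: Gn1.
have G11 : G (t 1 1).
  have -> : t 1 1 = 2 * n2 (tauI x y w) by rewrite (along2_tauI two_neq0) //; field.
  by apply: GM => //; apply: Gn2.
have G02 : G (t 0 2).
  have e8 : 8 = 2 ^+ 3 :> K by ring.
  have -> : t 0 2 = 8 * tauJ x y w - t 2 0 - 2 * t 1 1.
    by rewrite /tauJ; field; rewrite e8 expf_neq0.
  by do 2?[apply: GD; last apply: GN] => //; apply: GM.
move: {2}(i + j)%N (leqnn (i + j)) => n; elim: n i j => [|n IHn] i j.
  by rewrite leqn0 addn_eq0 => /andP[/eqP-> /eqP->]; rewrite tau00.
rewrite leq_eqVlt ltnS => /orP[/eqP eij|]; last exact: IHn.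
case: n IHn eij => [|[|n]] IHn eij.
- case: i j eij => [|[|i]] [|[|j]] //= _; by rewrite tau01.
- by case: i j eij => [|[|[|i]]] [|[|[|j]]].
(* The bound [k <= v] makes the coefficient vanish at [v = 0], where [t u.+1 v.-1] could exceed the
   order covered by induction. *)
have Gfix a b u v k : G a -> G b -> (u + v <= n.+2)%N -> (k <= v)%N ->
    G (k%:R * (a * t u.+1 v.-1 + b * t u v)).
  move=> Ga Gb huv hk; case: k hk => [|k] hk; first by rewrite mul0r.
  apply: GM => //; apply: GD; apply: GM => //; apply: IHn => //.
  by case: v hk huv => // v _; rewrite addSnnS.
case: i eij => [|i] eij.
  case: j eij => // j eij.
  have -> : t 0 j.+1 = n2 (t 0 j) - j%:R * (- (t 0 2 / t 1 0) * t 1 j.-1 + t 1 1 / t 1 0 * t 0 j).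
    by rewrite along2_tau //; ring.
  apply: GD; first by apply/Gn2/IHn; rewrite -ltnS -eij.
  apply/GN/Gfix => //; [by apply/GN/GM => //; apply: GV|by apply: GM => //; apply: GV|].
  by rewrite -ltnS -eij.
have le_ij : (i + j <= n.+2)%N by rewrite -ltnS -addSn eij.
have -> : t i.+1 j = n1 (t i j) - i%:R * t i j
   - j%:R * (- (t 1 1 / t 1 0) * t i.+1 j.-1 + t 2 0 / t 1 0 * t i j) + t i j * t 1 0.
  by rewrite along1_tau //; ring.
have Gij := IHn _ _ le_ij.
apply: GD; last exact: GM.
apply: GD; first by apply: GD; [exact: Gn1|apply/GN/GM].
by apply/GN/Gfix => //; [apply/GN/GM => //; apply: GV|apply: GM => //; apply: GV].
Qed.

End TauClosed.

Section FrameMatrix.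
Variables (F : numFieldType) (a b p q : F).
Let E := a * p + b * q.
Hypothesis E_neq0 : E != 0.

(* The inverse of the matrix with columns v1 = (a, b) and v2 = (- 2 q, 2 p). *)
Definition frame_matrix : 'M[F]_2 := \matrix_(i < 2, j < 2)
  ((if i == 0 then (if j == 0 then 2 * p else 2 * q)
    else (if j == 0 then - b else a)) / (2 * E)).

Lemma frame_matrixE : [/\ frame_matrix 0 0 = 2 * p / (2 * E),
  frame_matrix 0 1 = 2 * q / (2 * E),
  frame_matrix 1 0 = - b / (2 * E) & frame_matrix 1 1 = a / (2 * E)].
Proof. by split; rewrite mxE. Qed.

Lemma det_frame_matrix : \det frame_matrix = (2 * E)^-1.
Proof.
have [h00 h01 h10 h11] := frame_matrixE; rewrite det_mx22 h00 h01 h10 h11.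
by move: E_neq0; rewrite /E => E0; field.
Qed.

Lemma frame_matrix_unit : frame_matrix \in unitmx.
Proof.
by rewrite unitmxE det_frame_matrix unitfE invr_eq0 mulf_neq0 // pnatr_eq0.
Qed.

Lemma frame_matrix_x : frame_matrix 0 0 * a + frame_matrix 0 1 * b = 1.
Proof.
have [-> -> _ _] := frame_matrixE.
by move: E_neq0; rewrite /E => E0; field.
Qed.

Lemma frame_matrix_y : frame_matrix 1 0 * a + frame_matrix 1 1 * b = 0.
Proof. by have [_ _ -> ->] := frame_matrixE; ring. Qed.

Lemma frame_matrix_inv : let D := \det frame_matrix in
  [/\ D^-1 * frame_matrix 1 1 = a, - (D^-1 * frame_matrix 1 0) = b,
      - (D^-1 * frame_matrix 0 1) = - 2 * q & D^-1 * frame_matrix 0 0 = 2 * p].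
Proof.
have [-> -> -> ->] := frame_matrixE; move=> D; rewrite /D det_frame_matrix invrK.
by move: E_neq0; rewrite /E => E0; split; field.
Qed.

End FrameMatrix.

Section Generation.
Variable R : realType.
Local Notation P := (jet_poly R).
Local Notation K := (jet_field R).
Local Notation x := (cx R).
Local Notation y := (cy R).
Local Notation w := (@wF R).
Local Notation kc := (@const_field R).
Local Notation DP := (diff_poly R).

Definition invs : 'I_2 -> K := pick2 (I1' R) (I2c' R).
Definition nablas : 'I_2 -> K -> K := pick2 (@nabla1 R) (@nabla2 R).
(** The embedding of constants in the form used by [diff_eval]; it coincides with [const_field]. *)
Definition scal_field (c : R) : K := (c *: 1 : P)%:F.

Lemma scal_fieldE c : scal_field c = kc c.
Proof. by rewrite /scal_field /const_field -mul_malgC mulr1. Qed.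

Lemma scal_field_morphism : zmod_morphism scal_field * monoid_morphism scal_field.
Proof.
split; first by move=> u v; rewrite !scal_fieldE; exact: raddfB.
by split; [rewrite scal_fieldE; exact: rmorph1|move=> u v; rewrite !scal_fieldE; exact: rmorphM].
Qed.
HB.instance Definition _ := GRing.isZmodMorphism.Build R K scal_field scal_field_morphism.1.
HB.instance Definition _ := GRing.isMonoidMorphism.Build R K scal_field scal_field_morphism.2.

Definition evalD : DP -> K := diff_eval nablas invs.

Lemma evalD_morphism : zmod_morphism evalD * monoid_morphism evalD.
Proof.
by split; [exact: (msubst_additive scal_field)|exact: (msubst_multiplicative scal_field)].
Qed.
HB.instance Definition _ := GRing.isZmodMorphism.Build DP K evalD evalD_morphism.1.
HB.instance Definition _ := GRing.isMonoidMorphism.Build DP K evalD evalD_morphism.2.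

Lemma evalDX u i : evalD (dsym R u i) = nabla_word nablas u (invs i).
Proof. exact: (msubstX scal_field). Qed.
Lemma evalDC (c : R) : evalD c%:MP = kc c.
Proof. by rewrite -scal_fieldE; exact: (msubstC scal_field). Qed.

Lemma nablas_derivation j : derivation (nablas j).
Proof.
have [hx hy] := (Dx_derivation R, Dy_derivation R).
rewrite /nablas /pick2; case: ifP => _; first exact: (lin_comb_derivation x y hx hy).
exact: (lin_comb_derivation (x - 2 * cu R 0 1) (2 * cu R 1 0 - y) hx hy).
Qed.

Lemma nablas_const j c : nablas j (kc c) = 0.
Proof.
have h1 : Dx (kc c) = 0 by rewrite /const_field DxF [total_x _]mderivC tofrac0.
have h2 : Dy (kc c) = 0 by rewrite /const_field DyF [total_y _]mderivC tofrac0.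
have zero (K' : fieldType) (a b u v : K') : u = 0 -> v = 0 -> a * u + b * v = 0.
  by move=> -> ->; rewrite !mulr0 addr0.
by rewrite /nablas /pick2; case: ifP => _; exact: (zero _ _ _ _ _ h1 h2).
Qed.

Definition formal_delta (j : 'I_2) (v : dsymbol) : DP := dsym R (j :: v.1) v.2.

Lemma evalD_mderiv j p : nablas j (evalD p) = evalD (mderiv (formal_delta j) p).
Proof.
have hd := mderiv_derivation (formal_delta j); have hn := nablas_derivation j.
move: p; apply: (malg_derivation_ext (f := evalD)).
- exact: (der_rmorphD evalD hn).
- exact: (rmorph_derD evalD hd).
- exact: (der_rmorphM evalD hn).
- exact: (rmorph_derM evalD hd).
- by move=> c; rewrite evalDC mderivC nablas_const raddf0.
move=> [u i]; rewrite mderivX.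
exact: etrans (congr1 (nablas j) (evalDX u i)) (esym (evalDX (j :: u) i)).
Qed.

Lemma fval_formal_nabla j e f :
  frac_val evalD e f -> frac_val evalD (formal_nabla j e) (nablas j f).
Proof.
apply: fval_der; [exact: mderiv_derivation|exact: nablas_derivation|].
exact: evalD_mderiv.
Qed.

Local Notation gen := (rationally_generated nablas invs).

(** Seen as values of formal fractions, the generated functions inherit closure under field
    operations and derivations from [frac_val]. *)
Lemma genP f : gen f <-> exists e, frac_val evalD e f.
Proof.
split=> [[p [q [q0 ->]]]|[e [p [q [_ q0 ->]]]]]; last by exists p, q.
by exists (p%:F / q%:F); exact: (fval_frac (phi := evalD)).
Qed.

Lemma gen_eval p : gen (evalD p).
Proof. by apply/genP; exists p%:F; apply: fval_tofrac. Qed.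
Lemma gen_const c : gen (kc c).
Proof. by rewrite -evalDC; apply: gen_eval. Qed.
Lemma gen0 : gen 0.
Proof. by apply/genP; exists 0; apply: fval0. Qed.
Lemma gen1 : gen 1.
Proof. by apply/genP; exists 1; apply: fval1. Qed.
Lemma genD f g : gen f -> gen g -> gen (f + g).
Proof. by move=> /genP[e h] /genP[e' h']; apply/genP; exists (e + e'); apply: fvalD. Qed.
Lemma genN f : gen f -> gen (- f).
Proof. by move=> /genP[e h]; apply/genP; exists (- e); apply: fvalN. Qed.
Lemma genM f g : gen f -> gen g -> gen (f * g).
Proof. by move=> /genP[e h] /genP[e' h']; apply/genP; exists (e * e'); apply: fvalM. Qed.
Lemma genV f : gen f -> gen f^-1.
Proof.
have [->|f0] := eqVneq f 0; first by rewrite invr0.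
by move=> /genP[e h]; apply/genP; exists e^-1; apply: fvalV.
Qed.
Lemma gen_nabla j f : gen f -> gen (nablas j f).
Proof.
by move=> /genP[e h]; apply/genP; exists (formal_nabla j e); apply: fval_formal_nabla.
Qed.
Lemma gen_inv i : gen (invs i).
Proof. exact: (eq_ind _ gen (gen_eval (dsym R [::] i)) _ (evalDX [::] i)). Qed.

Lemma gen_tau i j : gen (tau x y w i j).
Proof.
apply: (@tau_closed _ (@Dx R) (@Dy R)).
- exact: Dx_derivation.
- exact: Dy_derivation.
- exact: natK_neq0.
- exact: Dx_x.
- exact: Dx_y.
- exact: Dy_x.
- exact: Dy_y.
- exact: Dx_w.
- exact: Dy_w.
- exact: w_neq0.
- exact: E_neq0.
- exact: gen0.
- exact: gen1.
- exact: genD.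
- exact: genN.
- exact: genM.
- exact: genV.
- exact: (gen_nabla 0).
- by move=> f h; rewrite -nabla2E; exact: (gen_nabla 1).
- by rewrite -I1E; exact: (gen_inv 0).
- by rewrite -I2cE; exact: (gen_inv 1).
Qed.

Lemma fval_pull_nablas (A : 'M[R]_2) (hA : A \in unitmx) j f g :
  frac_val (pullF A) f g -> frac_val (pullF A) (nablas j f) (nablas j g).
Proof.
rewrite /nablas /pick2; case: ifP => _; first exact: fval_pull_nabla1.
exact: fval_pull_nabla2.
Qed.

Lemma word_fixed (A : 'M[R]_2) (hA : A \in unitmx) u i :
  frac_val (pullF A) (nabla_word nablas u (invs i)) (nabla_word nablas u (invs i)).
Proof.
elim: u => [|j u IH]; last exact: (fval_pull_nablas hA j IH).
by rewrite /= /invs /pick2; case: ifP => _; [exact: I1_fixed|exact: I2c_fixed].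
Qed.

Lemma generated_invariant f : gen f -> diff_invariant f.
Proof.
move=> [p [q [q0 ->]]]; apply/diff_invariantE => A hA.
have fixed r : frac_val (pullF A) (evalD r) (evalD r).
  apply: (fval_msubst (c := scal_field) (c' := scal_field) (phi := pullF A)) => [c|v].
    have h := fval_tofrac (pullF A) c%:MP.
    have e : pullF A c%:MP = kc c := congr1 (@FracField.tofrac P) (pullC A c).
    have {}h := eq_ind _ (frac_val (pullF A) (kc c)) h _ e.
    exact: (eq_ind _ (fun u => frac_val (pullF A) u u) h _ (esym (scal_fieldE c))).
  exact: word_fixed.
exact: fval_div (fixed p) (fixed q) q0.
Qed.

Section NormalizedFrame.
Variable s : jet R.
Local Notation ws := (fun i j => jet_eval s (wpoly R i j)).
Definition frame_mx : 'M[R]_2 :=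
  frame_matrix (s JX) (s JY) (jet_eval s (wpoly R 1 0)) (jet_eval s (wpoly R 0 1)).
Let E := s JX * jet_eval s (wpoly R 1 0) + s JY * jet_eval s (wpoly R 0 1).
Hypotheses (ws0 : jet_eval s (wpoly R 0 0) != 0) (Es : E != 0).

Lemma frame_mx_unit : frame_mx \in unitmx.
Proof. exact: frame_matrix_unit. Qed.

Lemma prolong_frame_x : prolong frame_mx s JX = 1.
Proof.
apply: etrans (frame_matrix_x Es); apply: etrans (jet_evalD s _ _) _.
apply: (congr2 +%R).
  exact: etrans (jet_evalZ s _ _) (congr1 _ (jet_evalX s JX)).
exact: etrans (jet_evalZ s _ _) (congr1 _ (jet_evalX s JY)).
Qed.

Lemma prolong_frame_y : prolong frame_mx s JY = 0.
Proof.
apply: etrans (frame_matrix_y (s JX) (s JY) (jet_eval s (wpoly R 1 0)) (jet_eval s (wpoly R 0 1))).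
apply: etrans (jet_evalD s _ _) _; apply: (congr2 +%R).
  exact: etrans (jet_evalZ s _ _) (congr1 _ (jet_evalX s JX)).
exact: etrans (jet_evalZ s _ _) (congr1 _ (jet_evalX s JY)).
Qed.

(** The inverse of [frame_mx] has columns [v1] and [v2] at [s], so the tensorial rule contracts the
    jet with exactly this frame. The determinant [1 / (2 E)] with [E = w * tau 1 0] gives the
    scaling. *)
Lemma prolong_frame_w i j : jet_eval (prolong frame_mx s) (wpoly R i j) =
  tau (s JX) (s JY) ws i j / (2 * tau (s JX) (s JY) ws 1 0).
Proof.
have hdet : \det frame_mx = (2 * E)^-1 := det_frame_matrix Es.
have hT : jet_eval s (frame_contr (inv_col1 frame_mx) (inv_col2 frame_mx) (wpoly R) i j 0 0) =
    frame_contr (euler_field (s JX) (s JY)) (hamilton_field ws) ws i j 0%N 0%N.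
  have [h1 h2 h3 h4] := frame_matrix_inv Es.
  exact: (frame_contr_morph (f := jet_eval s) (v1 := inv_col1 frame_mx)
    (v2 := inv_col2 frame_mx) (v1' := euler_field (s JX) (s JY))
    (v2' := hamilton_field ws) (w := wpoly R) (w' := ws) (etrans (jet_evalC s _) h1)
    (etrans (jet_evalC s _) h2) (etrans (jet_evalC s _) h3) (etrans (jet_evalC s _) h4)
    (fun k m => erefl)).
have e := etrans (congr1 (jet_eval s) (pull_wpoly frame_mx_unit i j)) (jet_evalZ s _ _).
apply: etrans (jet_eval_prolong _ _ _) _; apply: etrans e _.
apply: etrans (congr2 *%R hdet hT) _.
have fin (a b c : R) : b != 0 -> c != 0 -> (2 * b)^-1 * a = a / c / (2 * (b / c)).
  by move=> hb hc; field; rewrite hb hc.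
exact: fin.
Qed.

End NormalizedFrame.

Lemma takes_value_const s c : takes_value (kc c) s c.
Proof.
have h := fval_tofrac (jet_eval s) (c%:MP : P).
exact: (eq_ind _ (frac_val (jet_eval s) (kc c)) h _ (jet_evalC s c)).
Qed.

Lemma takes_value_var s v : takes_value (mvar R v)%:F s (s v).
Proof.
have h := fval_tofrac (jet_eval s) (mvar R v).
exact: (eq_ind _ (frac_val (jet_eval s) _) h _ (jet_evalX s v)).
Qed.

Lemma takes_value_w s i j : takes_value (w i j) s (jet_eval s (wpoly R i j)).
Proof. exact: fval_tofrac. Qed.

(** The coordinates of the normalized jet [prolong (frame_mx s) s] as rational functions of [s]. The
    summand with [xy_jet] passes from [w] back to z. *)
Definition kappa_coord (v : jetvar) : K :=
  match v with
  | JX => 1 | JY => 0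
  | JU i j => tau x y w i j / (2 * tau x y w 1 0) + kc (2^-1 * xy_jet 1 0 i j)
  end.
Definition kappa : P -> K := msubst kc kappa_coord.

Lemma kappa_takes_value s p : jet_eval s (wpoly R 0 0) != 0 -> jet_eval s (Epoly R) != 0 ->
  takes_value (kappa p) s (jet_eval (prolong (frame_mx s) s) p).
Proof.
move=> ws0 Es; move: (Es); rewrite (jet_eval_Epoly erefl erefl) => Es'.
have two : 2 != 0 :> R by rewrite pnatr_eq0.
have vC : forall c, frac_val (jet_eval s) (kc c) c := takes_value_const s.
have vt := fval_tau (takes_value_var s JX) (takes_value_var s JY) (takes_value_w s) ws0.
have tau10 : tau (s JX) (s JY) (fun i j => jet_eval s (wpoly R i j)) 1 0 != 0.
  exact: tau10_neq0.
apply: (fval_msubst (c' := idfun) (phi := jet_eval s)) => // -[||i j] /=.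
- by have := fval1 (jet_eval s); rewrite prolong_frame_x.
- by have := fval0 (jet_eval s); rewrite prolong_frame_y.
have e := jet_eval_wpoly (prolong (frame_mx s) s) i j.
rewrite prolong_frame_x // prolong_frame_y // prolong_frame_w // in e.
move/esym/(canRL (subrK _)): e => ->.
have v2 : frac_val (jet_eval s) 2 2 := fval_nat (jet_eval s) 2.
exact: fvalD (fval_div (vt i j) (fvalM v2 (vt 1 0)) (mulf_neq0 two tau10)) (vC _).
Qed.

Lemma gen_kappa p : gen (kappa p).
Proof.
move: p; apply: malg_ind => [c|v|p q hp hq|p q hp hq].
- by rewrite /kappa msubstC; apply: gen_const.
- rewrite /kappa msubstX; case: v => [||i j] /=; [exact: gen1|exact: gen0|].
  apply: genD; last exact: gen_const.
  apply: genM; first exact: gen_tau.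
  by apply/genV/genM; [apply: genD; apply: gen1|apply: gen_tau].
- by apply: (eq_ind _ gen (genD hp hq)); rewrite /kappa raddfD.
by apply: (eq_ind _ gen (genM hp hq)); rewrite /kappa rmorphM.
Qed.

(** An invariant has the same value at [s] and at the normalized jet, which suggests
    [f = kappa n / kappa d]; but [kappa d] may be zero. So [n] and [d] are first pulled back by [B],
    the inverse of the frame matrix of a jet [s0] with [d] nonzero at [s0]. At the normalization of
    [s0], the pullback [dB] has the value of [d] at [s0]. *)
Lemma invariant_generated f : diff_invariant f -> gen f.
Proof.
move=> finv; have [n [d [d0 ef]]] := fracP f.
pose g0 := Epoly R * wpoly R 0 0.
have Ep0 : Epoly R != 0 by have := E_neq0 R; rewrite -EpolyF tofrac_eq0.
have wp0 : wpoly R 0 0 != 0 by have := w_neq0 R; rewrite tofrac_eq0.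
have g00 : g0 != 0 by exact: mulf_neq0.
have split_g (s : jet R) (q : P) : jet_eval s (g0 * q) != 0 ->
    [/\ jet_eval s (Epoly R) != 0, jet_eval s (wpoly R 0 0) != 0 & jet_eval s q != 0].
  rewrite jet_evalM (jet_evalM s (Epoly R)) !mulf_eq0 !negb_or => /andP[/andP[h1 h2] h3].
  by split.
have [s0 /split_g[Es0 ws0 ds0]] := jet_poly_nonvanishing (mulf_neq0 g00 d0).
pose A0 := frame_mx s0; pose B := invmx A0.
have unitA (s : jet R) : jet_eval s (wpoly R 0 0) != 0 -> jet_eval s (Epoly R) != 0 ->
    frame_mx s \in unitmx.
  by move=> h1 h2; apply: frame_mx_unit => //; move: h2; rewrite (jet_eval_Epoly erefl erefl).
have A0unit := unitA s0 ws0 Es0.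
have Bunit : B \in unitmx by rewrite unitmx_inv.
pose nB := pull B n; pose dB := pull B d.
have efB : f = nB%:F / dB%:F.
  have fB : frac_val (pullF B) f (pullF B n / pullF B d).
    by rewrite {1}ef; exact: (fval_frac (phi := pullF B) n (pullF_neq0 Bunit d0)).
  have fBf := (diff_invariantE f).1 finv B Bunit.
  exact: (fval_uniq fBf fB).
have kd0 : kappa dB != 0.
  apply/eqP => e; have := kappa_takes_value dB ws0 Es0; rewrite e => v.
  have := fval_uniq (phi := jet_eval s0) v (fval0 (jet_eval s0)).
  rewrite jet_eval_prolong (pullK (mulVmx A0unit)) => e0.
  by rewrite e0 eqxx in ds0.
(* Where [n1 * d1] is nonzero, [kappa dB] has a nonzero value, so [dB] does not vanish at the
   normalized jet and [f] has a value there. *)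
have [n1 [d1 [d10 ek]]] := fracP (kappa dB).
have n10 : n1 != 0.
  by apply: contraNneq kd0 => e; rewrite ek e tofrac0 mul0r.
suff -> : f = kappa nB / kappa dB by apply: genM; [|apply: genV]; apply: gen_kappa.
apply: (jet_field_density (mulf_neq0 g00 (mulf_neq0 n10 d10))) => s c c' /split_g[Es ws hs].
move=> fc kc'.
have [n1s d1s] : jet_eval s n1 != 0 /\ jet_eval s d1 != 0.
  by move: hs; rewrite jet_evalM mulf_eq0 negb_or => /andP.
have vd := kappa_takes_value dB ws Es; have vn := kappa_takes_value nB ws Es.
have vd' : takes_value (kappa dB) s (jet_eval s n1 / jet_eval s d1) by exists n1, d1.
have dB0 : jet_eval (prolong (frame_mx s) s) dB != 0.
  by rewrite (fval_uniq (phi := jet_eval s) vd vd') mulf_neq0 ?invr_eq0.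
have fA : takes_value f (prolong (frame_mx s) s) (jet_eval (prolong (frame_mx s) s) nB /
    jet_eval (prolong (frame_mx s) s) dB) by exists nB, dB.
rewrite (finv _ (unitA s ws Es) s _ _ fc fA).
exact: (fval_uniq (phi := jet_eval s) (fval_div vn vd dB0) kc').
Qed.

End Generation.

(** * Reduction to normal symbols *)

Inductive ring_closure (F : pzRingType) (B : F -> Prop) : F -> Prop :=
| Ring_base b : B b -> ring_closure B b
| Ring_add e1 e2 : ring_closure B e1 -> ring_closure B e2 -> ring_closure B (e1 + e2)
| Ring_mul e1 e2 : ring_closure B e1 -> ring_closure B e2 -> ring_closure B (e1 * e2).

(* C is the set of consequences and L a ring of fractions in which it is an
   ideal. By R1, d1 commutes with d0 up to first-order terms, so the ring of the
   d0^a d1^b I is stable under d0 and d1 modulo C; R2 then expresses d0 J. *)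
Section Reduction.
Variables (F : fieldType) (d0 d1 : F -> F) (h0 : derivation d0) (h1 : derivation d1).
Variables (L C W const : F -> Prop) (I J : F).
Hypotheses (I_neq0 : I != 0) (four_neq0 : 4 != 0 :> F).
Hypotheses (LD : forall e f, L e -> L f -> L (e + f)) (LM : forall e f, L e -> L f -> L (e * f))
  (Ld0 : forall e, L e -> L (d0 e)) (Ld1 : forall e, L e -> L (d1 e))
  (LI : L I) (LV : L I^-1) (LJ : L J) (Lc : forall c, const c -> L c).
Hypotheses (C0 : C 0) (CD : forall e f, C e -> C f -> C (e + f))
  (CM : forall a e, L a -> C e -> C (a * e))
  (Cd0 : forall e, C e -> C (d0 e)) (Cd1 : forall e, C e -> C (d1 e)).
Hypotheses (c0 : const 0) (cN1 : const (-1)) (cnat : forall n, const n%:R)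
  (c4 : const 4^-1) (const0 : forall c, const c -> d0 c = 0) (const1 : forall c, const c -> d1 c = 0).
Hypotheses (WI : W I) (WJ : W J) (Wd0 : forall e, W e -> W (d0 e)) (Wd1 : forall e, W e -> W (d1 e))
  (WL : forall e, W e -> L e).
Hypotheses (R1 : forall e, W e -> C (rel1 d0 d1 I e)) (R2 : C (rel2 d0 d1 I J)).

Definition normal_I (e : F) : Prop :=
  [\/ const e, e = I^-1 | exists a b, e = iter a d0 (iter b d1 I)].
Definition normal (e : F) : Prop := normal_I e \/ exists b, e = iter b d1 J.

(** Membership in [L] is carried along because [C] is an ideal over [L] only: congruences can be
    multiplied by elements of [L]. *)
Definition reduces (B : F -> Prop) (e : F) : Prop :=
  L e /\ exists e', ring_closure B e' /\ C (e - e').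

Let LN1 : L (-1). Proof. exact: Lc. Qed.
Let CN e : C e -> C (- e). Proof. by rewrite -mulN1r; apply: CM. Qed.

Section Closure.
Variable B : F -> Prop.
Hypotheses (BL : forall b, B b -> L b) (Bc : forall c, const c -> B c).

Lemma closure_L e : ring_closure B e -> L e.
Proof. by elim=> [b|e1 e2 _ l1 _ l2|e1 e2 _ l1 _ l2]; auto. Qed.

Lemma red_closure e : ring_closure B e -> reduces B e.
Proof. by move=> he; split; [exact: closure_L|exists e; rewrite subrr]. Qed.

Lemma red_base e : B e -> reduces B e.
Proof. by move=> he; apply/red_closure/Ring_base. Qed.

Lemma redD e f : reduces B e -> reduces B f -> reduces B (e + f).
Proof.
move=> [le [e' [he ce]]] [lf [f' [hf cf]]]; split; first exact: LD.
exists (e' + f'); split; first exact: Ring_add.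
have -> : e + f - (e' + f') = (e - e') + (f - f') by ring.
exact: CD.
Qed.

Lemma redM e f : reduces B e -> reduces B f -> reduces B (e * f).
Proof.
move=> [le [e' [he ce]]] [lf [f' [hf cf]]]; split; first exact: LM.
exists (e' * f'); split; first exact: Ring_mul.
have -> : e * f - e' * f' = e * (f - f') + f' * (e - e') by ring.
by apply: CD; apply: CM => //; apply: closure_L.
Qed.

Lemma redN e : reduces B e -> reduces B (- e).
Proof. by rewrite -mulN1r; apply: redM; apply/red_base/Bc. Qed.

Lemma redB e f : reduces B e -> reduces B f -> reduces B (e - f).
Proof. by move=> he hf; apply: redD => //; apply: redN. Qed.

Lemma red_nat n : reduces B n%:R. Proof. exact/red_base/Bc. Qed.

Lemma red_congr e f : L e -> C (e - f) -> reduces B f -> reduces B e.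
Proof.
move=> le cef [lf [f' [hf cf]]]; split=> //; exists f'; split=> //.
have -> : e - f' = (e - f) + (f - f') by ring.
exact: CD.
Qed.

(** [C] is stable under [d], so [d] passes to the reduced form, where the Leibniz rule leaves only
    the generators in [B] to be checked. *)
Lemma red_der (d : F -> F) : derivation d -> (forall e, L e -> L (d e)) ->
    (forall e, C e -> C (d e)) -> (forall b, B b -> reduces B (d b)) ->
  forall e, reduces B e -> reduces B (d e).
Proof.
move=> hd Ld Cd dB e [le [e' [he' ce]]].
have de' : reduces B (d e').
  elim: he' => {ce} [b /dB //|e1 e2 _ r1 _ r2|e1 e2 h1' r1 h2' r2].
    by rewrite (der_add hd); apply: redD.
  by rewrite (derM hd); apply: redD; apply: redM => //; apply: red_closure.
by apply: red_congr de'; [exact: Ld|rewrite -(derB hd); exact: Cd].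
Qed.

Hypothesis BV : B I^-1.

Lemma red_derV (d : F -> F) : derivation d -> reduces B (d I) -> reduces B (d I^-1).
Proof.
move=> hd rd; rewrite (derV hd I_neq0).
have -> : - (d I / I ^+ 2) = - (d I * (I^-1 * I^-1)) by field.
by apply: redN; apply: redM => //; apply: redM; apply: red_base.
Qed.

(** R_1 exchanges the two derivations at the cost of first-order terms. Both directions are used:
    symbols of [I] keep [d0] outermost, while in symbols of [J] the derivation [d0] has to move
    inwards. *)
Lemma red_R1 e : W e -> reduces B I -> reduces B (d0 I) -> reduces B (d1 I) ->
    reduces B (d0 e) -> reduces B (d1 e) ->
  (reduces B (d1 (d0 e)) <-> reduces B (d0 (d1 e))).
Proof.
move=> We rI r0I r1I r0 r1; have rV := red_base BV.
pose rest := d1 I / I * d0 e - (d0 I / I + 2 * (I - 1)) * d1 e.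
have rr : reduces B rest.
  apply: redB; apply: redM => //; first exact: redM.
  by apply: redD; apply: redM => //; [apply: red_nat|apply: redB => //; exact: (red_nat 1)].
have cr : C (d0 (d1 e) - d1 (d0 e) + rest).
  by have := R1 We; rewrite /rel1 /rest addrA.
have [l01 l10] : L (d0 (d1 e)) /\ L (d1 (d0 e)) by split; auto.
split=> h.
  apply: (red_congr l01 (f := d1 (d0 e) - rest)); last exact: redB.
  by have -> : d0 (d1 e) - (d1 (d0 e) - rest) = d0 (d1 e) - d1 (d0 e) + rest by ring.
apply: (red_congr l10 (f := d0 (d1 e) + rest)); last exact: redD.
have -> : d1 (d0 e) - (d0 (d1 e) + rest) = - (d0 (d1 e) - d1 (d0 e) + rest) by ring.
exact: CN.
Qed.

End Closure.

Let Liter a b e : L e -> L (iter a d0 (iter b d1 e)).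
Proof. by move=> le; elim: a => [|a IH] /=; [elim: b => //= b; exact: Ld1|exact: Ld0]. Qed.
Let Witer a b e : W e -> W (iter a d0 (iter b d1 e)).
Proof. by move=> le; elim: a => [|a IH] /=; [elim: b => //= b; exact: Wd1|exact: Wd0]. Qed.

Lemma normal_I_L b : normal_I b -> L b.
Proof. by case=> [/Lc //|->//|[a [b' ->]]]; apply: Liter. Qed.
Lemma normal_L b : normal b -> L b.
Proof. by case=> [/normal_I_L //|[b' ->]]; apply: (Liter 0). Qed.

Let rI := @red_base _ normal_I_L.
Let sym a b : reduces normal_I (iter a d0 (iter b d1 I)).
Proof. by apply: rI; apply: Or33; exists a, b. Qed.
Let cI c : const c -> normal_I c. Proof. by move=> h; apply: Or31. Qed.
Let vI : normal_I I^-1. Proof. exact: Or32. Qed.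

Lemma red_I_d0 e : reduces normal_I e -> reduces normal_I (d0 e).
Proof.
apply: (red_der normal_I_L h0 Ld0 Cd0) => u [hu|->|[a [b ->]]].
- rewrite (const0 hu); exact: rI (cI c0).
- exact: (red_derV normal_I_L cI vI h0 (sym 1 0)).
exact: (sym a.+1 b).
Qed.

(** Induction on [a]: R_1 moves [d1] inside the outermost [d0], which is then absorbed by
    [red_I_d0]. *)
Lemma red_I_d1 e : reduces normal_I e -> reduces normal_I (d1 e).
Proof.
apply: (red_der normal_I_L h1 Ld1 Cd1) => u [hu|->|[a [b ->]]].
- rewrite (const1 hu); exact: rI (cI c0).
- exact: (red_derV normal_I_L cI vI h1 (sym 0 1)).
elim: a => [|a IH]; first exact: (sym 0 b.+1).
apply/(red_R1 normal_I_L cI vI (Witer a b WI) (sym 0 0) (sym 1 0) (sym 0 1) (sym a.+1 b) IH).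
exact: red_I_d0.
Qed.

Lemma red_I_normal e : reduces normal_I e -> reduces normal e.
Proof.
move=> [le [e' [he ce]]]; split=> //; exists e'; split=> //.
elim: he => [b hb|e1 e2 _ r1 _ r2|e1 e2 _ r1 _ r2]; [|exact: Ring_add|exact: Ring_mul].
by apply: Ring_base; left.
Qed.

Let cN c : const c -> normal c. Proof. by move=> h; left; apply: Or31. Qed.
Let vN : normal I^-1. Proof. by left; apply: Or32. Qed.
Let symN a b := red_I_normal (sym a b).
Let symJ b : reduces normal (iter b d1 J).
Proof. by apply: (red_base normal_L); right; exists b. Qed.

Lemma red_d1 e : reduces normal e -> reduces normal (d1 e).
Proof.
apply: (red_der normal_L h1 Ld1 Cd1) => u [hb|[b ->]]; last exact: (symJ b.+1).
by apply/red_I_normal/red_I_d1/rI.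
Qed.

(** In R_2 the symbol [d0 J] occurs only with the constant coefficient -4, so R_2 can be solved for
    it; [rest] collects the other terms, which all reduce already. *)
Lemma red_d0J : reduces normal (d0 J).
Proof.
have rD := @redD normal; have rM := @redM normal normal_L.
have rB := @redB normal normal_L cN; have rn := @red_nat normal normal_L cN.
have rV := red_base normal_L vN; have rJ := symJ 0; have r0 := symN 1 0; have r1 := symN 0 1.
pose rest := d0 (d0 I) + 2 * d0 (d1 I) + d1 (d1 I)
  - 3 * I^-1 * (d0 I * d0 I + 2 * d0 I * d1 I - 4 * d0 I * J + d1 I * d1 I)
  - 2 * (I - 1) * (3 * d0 I + 4 * d1 I - 8 * J)
  - 4 * I * (I - 1) * (2 * I - 1).
have rI1 : reduces normal (I - 1) by apply: rB (symN 0 0) (rn 1).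
have rr : reduces normal rest.
  apply: (rB); last first.
    apply: (rM); last by apply: (rB) (rn 1); apply: rM (rn 2) (symN 0 0).
    by apply: (rM) rI1; apply: rM (rn 4) (symN 0 0).
  apply: (rB); last first.
    apply: (rM); first exact: rM (rn 2) rI1.
    by apply: (rB); [apply: (rD); apply: (rM)|apply: (rM)] => //; exact: rn.
  apply: (rB); last first.
    apply: (rM); first exact: rM (rn 3) rV.
    apply: (rD); last exact: (rM _ _ r1 r1).
    apply: (rB); last by apply: (rM) => //; exact: rM (rn 4) r0.
    by apply: (rD); [exact: rM|apply: (rM) => //; exact: rM (rn 2) r0].
  apply: (rD); last exact: (symN 0 2).
  by apply: (rD); [exact: (symN 2 0)|exact: rM (rn 2) (symN 1 1)].
apply: (red_congr (f := 4^-1 * rest)); first exact: Ld0.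
  have -> : d0 J - 4^-1 * rest = (-1) * (4^-1 * rel2 d0 d1 I J).
    by rewrite /rel2 /rest; field; rewrite I_neq0 four_neq0.
  by apply: CM => //; apply: CM => //; exact: Lc.
by apply: (rM) rr; apply: (red_base normal_L); apply: cN.
Qed.

Lemma red_d0 e : reduces normal e -> reduces normal (d0 e).
Proof.
apply: (red_der normal_L h0 Ld0 Cd0) => u [hb|[b ->]].
  by apply/red_I_normal/red_I_d0/rI.
elim: b => [|b IH]; first exact: red_d0J.
apply/(red_R1 normal_L cN vN (Witer 0 b WJ) (symN 0 0) (symN 1 0) (symN 0 1) IH (symJ b.+1)).
exact: red_d1.
Qed.

End Reduction.

(** * Consequences of the relations *)

Section Localization.
Variables (P : idomainType) (h : P).
Hypothesis h_neq0 : h != 0.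
Implicit Types (p : P) (e f : {fraction P}).

Definition localized e : Prop := exists p n, e = p%:F / h%:F ^+ n.

Let hF : h%:F != 0. Proof. by rewrite tofrac_eq0. Qed.

Lemma localized_tofrac p : localized p%:F.
Proof. by exists p, 0%N; rewrite expr0 divr1. Qed.

Lemma localizedV : localized (h%:F)^-1.
Proof. by exists 1, 1%N; rewrite tofrac1 mul1r expr1. Qed.

Lemma localizedD e f : localized e -> localized f -> localized (e + f).
Proof.
move=> [p [n ->]] [q [m ->]]; exists (p * h ^+ m + q * h ^+ n), (n + m)%N.
by rewrite addf_div ?expf_neq0 // exprD tofracD !tofracM !tofracXn.
Qed.

Lemma localizedM e f : localized e -> localized f -> localized (e * f).
Proof.
move=> [p [n ->]] [q [m ->]]; exists (p * q), (n + m)%N.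
by rewrite mulf_div exprD tofracM.
Qed.

Lemma localized_fderiv (D : P -> P) e : derivation D ->
  localized e -> localized (fderiv D e).
Proof.
move=> hD [p [n ->]]; exists (D p * h ^+ n - p * D (h ^+ n)), (n * 2)%N.
by rewrite -tofracXn (fderivE hD) ?expf_neq0 // exprM !tofracXn.
Qed.

End Localization.

Section RelationValues.
Variables (P : idomainType) (K : fieldType) (phi : {rmorphism P -> K}).
Variables (d0 d1 : {fraction P} -> {fraction P}) (D0 D1 : K -> K).
Local Notation val := (frac_val phi).
Hypotheses (val0 : forall e f, val e f -> val (d0 e) (D0 f))
  (val1 : forall e f, val e f -> val (d1 e) (D1 f)).
Variables (I J e : {fraction P}) (I' J' f : K).
Hypotheses (vI : val I I') (vJ : val J J') (ve : val e f) (I'_neq0 : I' != 0).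

Lemma fval_rel1 : val (rel1 d0 d1 I e) (rel1 D0 D1 I' f).
Proof.
have v2 : val 2 2 := fval_nat phi 2; have v1 : val 1 1 := fval1 phi.
have vV : val I^-1 I'^-1 by apply: fvalV.
by rewrite /rel1; repeat first [apply: fvalB | apply: fvalD | apply: fvalM | apply: val0 | apply: val1].
Qed.

Lemma fval_rel2 : val (rel2 d0 d1 I J) (rel2 D0 D1 I' J').
Proof.
have vn n : val n%:R n%:R := fval_nat phi n; have v1 : val 1 1 := fval1 phi.
have vV : val I^-1 I'^-1 by apply: fvalV.
have w0 := val0 vI; have w1 := val1 vI; have w00 := val0 w0; have w01 := val0 w1.
have w11 := val1 w1; have wJ := val0 vJ; have vI1 := fvalB vI v1.
apply: fvalB; last first.
  by apply: (fvalM (fvalM (fvalM (vn 4) vI) vI1) (fvalB (fvalM (vn 2) vI) v1)).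
apply: fvalB; last first.
  apply: (fvalM (fvalM (vn 2) vI1)).
  exact: fvalB (fvalD (fvalM (vn 3) w0) (fvalM (vn 4) w1)) (fvalM (vn 8) vJ).
apply: fvalB; last first.
  apply: (fvalM (fvalM (vn 3) vV)); apply: fvalD; last exact: fvalX.
  apply: fvalB; last exact: fvalM (fvalM (vn 4) w0) vJ.
  exact: fvalD (fvalX 2 w0) (fvalM (fvalM (vn 2) w0) w1).
apply: fvalB; last exact: fvalM (vn 4) wJ.
exact: fvalD (fvalD w00 (fvalM (vn 2) w01)) w11.
Qed.

End RelationValues.

Section Consequences.
Variable R : realType.
Local Notation K := (jet_field R).
Local Notation DP := (diff_poly R).
Local Notation DF := (diff_field R).
Local Notation evalD := (@evalD R).
Local Notation d := (@formal_nabla R).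
Local Notation h := (dsym R [::] 0).
Local Notation I := ((dsym R [::] 0)%:F : DF).
Local Notation J := ((dsym R [::] 1)%:F : DF).
Local Notation C := (consequence (@R1R2 R) h).

Lemma I1_neq0 : I1' R != 0.
Proof. by rewrite I1E; exact: (tauI_neq0 (natK_neq0 R 1) (w_neq0 R) (E_neq0 R)). Qed.

Lemma nablas_rel1 f : rel1 (@nabla1 R) (@nabla2 R) (I1' R) f = 0.
Proof.
rewrite nabla2E I1E; apply: (along_rel1 (natK_neq0 R 1)).
- exact: Dx_derivation.
- exact: Dy_derivation.
- exact: Dx_x.
- exact: Dx_y.
- exact: Dy_x.
- exact: Dy_y.
- exact: Dx_w.
- exact: Dy_w.
- exact: w_neq0.
- exact: E_neq0.
exact: Dx_Dy_comm.
Qed.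

Lemma nablas_rel2 : rel2 (@nabla1 R) (@nabla2 R) (I1' R) (I2c' R) = 0.
Proof.
rewrite nabla2E I1E I2cE; apply: (along_rel2 (natK_neq0 R 1)).
- exact: Dx_derivation.
- exact: Dy_derivation.
- exact: Dx_x.
- exact: Dx_y.
- exact: Dy_x.
- exact: Dy_y.
- exact: Dx_w.
- exact: Dy_w.
- exact: w_neq0.
exact: E_neq0.
Qed.

Lemma evalD_h : evalD h = I1' R.
Proof. exact: (@evalDX R [::] 0). Qed.

Lemma h_neq0 : h != 0.
Proof.
apply/eqP => e; have := evalD_h; rewrite e raddf0 => /esym/eqP.
by apply/negP; exact: I1_neq0.
Qed.

Lemma val_I : frac_val evalD I (I1' R).
Proof. exact: (eq_ind _ (frac_val evalD I) (fval_tofrac evalD h) _ evalD_h). Qed.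
Lemma val_J : frac_val evalD J (I2c' R).
Proof.
exact: (eq_ind _ (frac_val evalD J) (fval_tofrac evalD (dsym R [::] 1)) _ (@evalDX R [::] 1)).
Qed.

(** Every consequence has a value because the only symbol inverted is [h], which evaluates to the
    nonzero function I'_1. *)
Lemma consequence_sound e : C e -> frac_val evalD e 0.
Proof.
elim=> {e} [e [[p ->]|->]|e1 e2 _ v1 _ v2|p e _ v|e _ v|j e _ v].
- have := fval_rel1 (@fval_formal_nabla R 0) (@fval_formal_nabla R 1) val_I
    (fval_tofrac evalD p) I1_neq0.
  by move=> v; apply: (eq_ind _ (frac_val evalD _) v); exact: nablas_rel1.
- have := fval_rel2 (@fval_formal_nabla R 0) (@fval_formal_nabla R 1) val_I val_J I1_neq0.
  by move=> v; apply: (eq_ind _ (frac_val evalD _) v); exact: nablas_rel2.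
- by apply: (eq_ind _ (frac_val evalD _) (fvalD v1 v2)); rewrite addr0.
- by apply: (eq_ind _ (frac_val evalD _) (fvalM (fval_tofrac evalD p) v)); rewrite mulr0.
- by apply: (eq_ind _ (frac_val evalD _) (fval_div v val_I I1_neq0)); rewrite mul0r.
apply: (eq_ind _ (frac_val evalD _) (fval_formal_nabla j v)).
exact: der0 (nablas_derivation R j).
Qed.

Definition constD (c : R) : DF := ((c%:MP : DP))%:F.
Lemma constD_morphism : zmod_morphism constD * monoid_morphism constD.
Proof.
split; first exact: (raddfB ((@FracField.tofrac DP) \o malgC)).
split; first exact: (rmorph1 ((@FracField.tofrac DP) \o malgC)).
exact: (rmorphM ((@FracField.tofrac DP) \o malgC)).
Qed.
HB.instance Definition _ := GRing.isZmodMorphism.Build R DF constD constD_morphism.1.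
HB.instance Definition _ := GRing.isMonoidMorphism.Build R DF constD constD_morphism.2.

Lemma d_derivation j : derivation (d j).
Proof. exact: fderiv_derivation (mderiv_derivation _). Qed.
Lemma dF j p : d j p%:F = (mderiv (@formal_delta R j) p)%:F.
Proof. exact: fderivF (mderiv_derivation _) p. Qed.
Lemma d_sym j u i : d j (dsym R u i)%:F = (dsym R (j :: u) i)%:F.
Proof. rewrite dF; congr (_%:F); exact: mderivX. Qed.
Lemma d_const j c : d j (constD c) = 0.
Proof. rewrite /constD dF -tofrac0; congr (_%:F); exact: mderivC. Qed.

Local Notation L := (localized h).
Local Notation const := (fun e : DF => exists c, e = constD c).
Local Notation W := (fun e : DF => exists p : DP, e = p%:F).

Lemma consequence0 : C 0.
Proof.
have := Cons_mul 0 (Cons_rel h (or_intror erefl : R1R2 (rel2 (d 0) (d 1) I J))).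
by rewrite tofrac0 mul0r.
Qed.

Lemma consequenceM a e : L a -> C e -> C (a * e).
Proof.
move=> [p [n ->]] ce; rewrite mulrAC.
elim: n => [|n IH]; first by rewrite expr0 divr1; apply: Cons_mul.
by have := Cons_div IH; rewrite exprSr invfM mulrA.
Qed.

Lemma four_neq0 : 4 != 0 :> DF.
Proof.
have -> : 4 = constD 4 by rewrite rmorph_nat.
by rewrite fmorph_eq0 pnatr_eq0.
Qed.

Local Notation red := (reduces L C (normal (d 0) (d 1) const I J)).

Let hyps : [/\ forall e, W e -> L e, L I & L I^-1] /\ (forall c, const c -> L c).
Proof.
split; last by move=> _ [c ->]; apply: localized_tofrac.
by split; [move=> _ [p ->]; exact: localized_tofrac|exact: localized_tofrac|exact: localizedV].
Qed.

Let Ld j e : L e -> L (d j e).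
Proof. exact: (localized_fderiv h_neq0 (mderiv_derivation _)). Qed.

Let IF_neq0 : I != 0. Proof. by rewrite tofrac_eq0 h_neq0. Qed.

Let Wd j e : W e -> W (d j e).
Proof. by move=> [p ->]; exists (mderiv (@formal_delta R j) p); rewrite dF. Qed.

Let constn n : const n%:R.
Proof. by exists n%:R; rewrite rmorph_nat. Qed.
Let constN1 : const (-1).
Proof. by exists (-1); rewrite rmorphN1. Qed.
Let const4 : const 4^-1.
Proof. by exists 4^-1; rewrite fmorphV rmorph_nat. Qed.
Let const_d j c : const c -> d j c = 0.
Proof. by move=> [u ->]; exact: d_const. Qed.

Let R1 e : W e -> C (rel1 (d 0) (d 1) I e).
Proof. by move=> [p ->]; apply: Cons_rel; left; exists p. Qed.
Let R2 : C (rel2 (d 0) (d 1) I J).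
Proof. by apply: Cons_rel; right. Qed.

Lemma red_nabla j e : red e -> red (d j e).
Proof.
have [[WL LI LV] Lc] := hyps.
have LJ : L J by exact: localized_tofrac.
have WI : W I by eexists.
have WJ : W J by eexists.
have j01 : j = 0 \/ j = 1.
  by case: j => [[|[|j]] //= hj]; [left|right]; apply/val_inj.
have LD := localizedD h_neq0; have LM := @localizedM _ h.
have CD := @Cons_add R (@R1R2 R) h; have CM := @consequenceM.
have Cd k := @Cons_nabla R (@R1R2 R) h k.
case: j01 => ->.
  exact: (red_d0 (d_derivation 0) (d_derivation 1) IF_neq0 four_neq0 LD LM (@Ld 0) (@Ld 1)
    LI LV LJ Lc consequence0 CD CM (@Cd 0) (@Cd 1) (constn 0) constN1 constn const4
    (@const_d 0) (@const_d 1) WI WJ (@Wd 0) (@Wd 1) WL R1 R2).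
exact: (red_d1 (d_derivation 0) (d_derivation 1) IF_neq0 LD LM (@Ld 0) (@Ld 1)
    LI LV LJ Lc consequence0 CD CM (@Cd 0) (@Cd 1) (constn 0) constN1 constn
    (@const_d 0) (@const_d 1) WI (@Wd 0) (@Wd 1) WL R1).
Qed.

End Consequences.

(** * Independence of the normal symbols *)

Lemma msubst_eq (I : choiceType) (R : idomainType) (S : comNzRingType) (c : R -> S)
    (h h' : I -> S) (p : {malg R[{cmonom I}]}) :
  (forall i, i \in mvars p -> h i = h' i) -> msubst c h p = msubst c h' p.
Proof.
move=> e; rewrite /msubst !mmapE; apply: eq_big_seq => m mp; congr (_ * _).
apply: eq_big_seq => i im; rewrite e //.
by apply/bigfcupP; exists m; rewrite ?mp.
Qed.

Lemma der_rest (K : fieldType) (D : K -> K) (hD : derivation D) c g t t' : D c = 0 ->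
  D g - c * t' = D (g - c * t) + c * (D t - t').
Proof. by move=> Dc; rewrite (derB hD) (derM hD) Dc; ring. Qed.

Lemma der_rest3 (K : fieldType) (D : K -> K) (hD : derivation D) c1 c2 c3 g t1 t2 t3 u1 u2 u3 :
  D c1 = 0 -> D c2 = 0 -> D c3 = 0 ->
  D g - (c1 * u1 + c2 * u2 + c3 * u3) = D (g - (c1 * t1 + c2 * t2 + c3 * t3)) +
    (c1 * (D t1 - u1) + c2 * (D t2 - u2) + c3 * (D t3 - u3)).
Proof.
move=> h1 h2 h3; rewrite (derB hD) !(der_add hD) (derM hD c1) (derM hD c2) (derM hD c3).
by rewrite h1 h2 h3; ring.
Qed.

Lemma frame_contr_std (S : comPzRingType) (w : nat -> nat -> S) i j k m :
  frame_contr (1, 0) (0, 1) w i j k m = w (i + k)%N (j + m)%N.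
Proof.
elim: i k m => [|i IHi] k m; last first.
  rewrite -[frame_contr _ _ _ i.+1 j]/(contr (1, 0) (frame_contr (1, 0) (0, 1) w i j)).
  rewrite /contr [(1, 0).1]/= [(1, 0).2]/= mul1r mul0r addr0 IHi addnS.
by [].
elim: j k m => [|j IHj] k m //.
rewrite -[frame_contr _ _ _ 0 j.+1]/(contr (0, 1) (frame_contr (1, 0) (0, 1) w 0 j)).
rewrite /contr [(0, 1).1]/= [(0, 1).2]/= mul1r mul0r add0r IHj addnS.
by [].
Qed.

(** At (1, 0) the frame is standard if [w 0 1 = 0] and [w 1 0 = 1 / 2]. Then
    [tau 1 0 = w 1 0 / w 0 0] forces [w 0 0 = 1 / (2 * th 1 0)], whence the scaling. *)
Lemma tau_std (F : numFieldType) (th : nat -> nat -> F) i j :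
    th 0 0 = 1 -> th 0 1 = 0 -> th 1 0 != 0 ->
  tau 1 0 (fun i j => th i j / (2 * th 1 0)) i j = th i j.
Proof.
move=> h00 h01 h10; rewrite /tau.
have -> : euler_field (1 : F) 0 = (1, 0) by [].
have -> : hamilton_field (fun i j => th i j / (2 * th 1 0)) = (0, 1).
  rewrite /hamilton_field h01; congr (_, _); first by rewrite mul0r mulr0.
  by field.
by rewrite frame_contr_std h00 !addn0; field.
Qed.

Section CrossSection.
Variable R : realType.
Local Notation K := (jet_field R).
Local Notation kc := (@const_field R).
Local Notation t := (tau (cx R) (cy R) (@wF R)).
Local Notation nabla := (@nablas R).

(* Regular functions near the cross-section that involve tau i j for i + j <= n
   only. *)
Inductive order_le (n : nat) : K -> Prop :=
| Order_const c : order_le n (kc c)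
| Order_tau i j : (i + j <= n)%N -> order_le n (t i j)
| Order_inv : (0 < n)%N -> order_le n (t 1 0)^-1
| Order_add f g : order_le n f -> order_le n g -> order_le n (f + g)
| Order_mul f g : order_le n f -> order_le n g -> order_le n (f * g).

Lemma order_leW n m f : (n <= m)%N -> order_le n f -> order_le m f.
Proof.
move=> nm; elim=> [c|i j ij|n0|f' g _ r1 _ r2|f' g _ r1 _ r2].
- exact: Order_const.
- by apply: Order_tau; apply: leq_trans nm.
- by apply: Order_inv; apply: leq_trans nm.
- exact: Order_add.
exact: Order_mul.
Qed.

Lemma order_leN n f : order_le n f -> order_le n (- f).
Proof.
move=> h; have -> : - f = kc (-1) * f.
  by have -> : kc (-1) = -1; [exact: rmorphN1|rewrite mulN1r].
by apply: Order_mul => //; apply: Order_const.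
Qed.

Lemma order_leB n f g : order_le n f -> order_le n g -> order_le n (f - g).
Proof. by move=> hf hg; apply: Order_add => //; apply: order_leN. Qed.

Lemma order_le_nat n k : order_le n k%:R.
Proof. by have <- : kc k%:R = k%:R; [exact: rmorph_nat|exact: Order_const]. Qed.

Lemma order_le0 n : order_le n 0.
Proof. by have <- : kc 0 = 0; [exact: raddf0|exact: Order_const]. Qed.

Lemma order_le_rest n k i j a b : (0 < n)%N -> (i + j <= n)%N -> (0 < k -> 0 < j)%N ->
    (0 < k -> order_le n a)%N -> (0 < k -> order_le n b)%N ->
  order_le n (k%:R * (- (a / t 1 0) * t i.+1 j.-1 + b / t 1 0 * t i j)).
Proof.
move=> n0 ij; case: k => [|k]; first by move=> *; rewrite mul0r; exact: order_le0.
move=> /(_ isT) j0 /(_ isT) ha /(_ isT) hb.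
apply: Order_mul; first exact: order_le_nat.
apply: Order_add; apply: Order_mul.
- by apply: order_leN; apply: Order_mul => //; apply: Order_inv.
- by apply: Order_tau; case: j j0 ij => //= j _; rewrite addSnnS.
- by apply: Order_mul => //; apply: Order_inv.
exact: Order_tau.
Qed.

(** For [0 < j] the derivative of [v2] brings in the second-order functions [tau 1 1] and [tau 2 0],
    so [n] must then be at least 2. *)
Lemma nabla1_tau_rest n i j : (0 < n)%N -> (i + j <= n)%N -> (0 < j -> 1 < n)%N ->
  order_le n (nabla 0 (t i j) - t i.+1 j).
Proof.
move=> n0 ij j2.
have e := along1_tau_rest (Dx_derivation R) (Dy_derivation R) (Dx_x R) (Dx_y R) (Dy_x R)
  (Dy_y R) (@Dx_w R) (@Dy_w R) (w_neq0 R) (E_neq0 R) i j.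
apply: (eq_ind _ (order_le n) _ _ (esym e)).
apply: order_leB; last by apply: Order_mul; exact: Order_tau.
apply: Order_add; first by apply: Order_mul; [exact: order_le_nat|exact: Order_tau].
by apply: order_le_rest => // j0; apply: Order_tau; apply: j2.
Qed.

Lemma nabla2_tau_rest n i j : (0 < n)%N -> (i + j <= n)%N -> (0 < j -> 1 < n)%N ->
  order_le n (nabla 1 (t i j) - t i j.+1).
Proof.
move=> n0 ij j2.
have e := along2_tau_rest (Dx_derivation R) (Dy_derivation R) (Dx_x R) (Dx_y R) (Dy_x R)
  (Dy_y R) (@Dx_w R) (@Dy_w R) (w_neq0 R) (E_neq0 R) i j.
have e1 : nabla 1 (t i j) = along (@Dx R) (@Dy R) (hamilton_field (@wF R)) (t i j).
  exact: (congr1 (fun F => F (t i j)) (nabla2E R)).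
have {}e := etrans (congr1 (fun u => u - t i j.+1) e1) e.
apply: (eq_ind _ (order_le n) _ _ (esym e)).
apply: Order_add; last by apply: order_le_rest => // j0; apply: Order_tau; apply: j2.
case: i ij {e e1} => [|i] ij; first by rewrite mul0r; exact: order_le0.
by apply: Order_mul; [exact: order_le_nat|apply: Order_tau; rewrite addnS -addSn].
Qed.

Lemma I2_cases (k : 'I_2) : k = 0 \/ k = 1.
Proof. by case: k => [[|[|k]] //= hk]; [left|right]; apply/val_inj. Qed.

Lemma order_le_nabla k n f : order_le n f -> order_le n.+1 (nabla k f).
Proof.
have hD := nablas_derivation R k.
have tau_case i j : (i + j <= n)%N -> order_le n.+1 (nabla k (t i j)).
  move=> ij; have j2 : (0 < j -> 1 < n.+1)%N.
    by move=> j0; rewrite ltnS (leq_trans j0) // (leq_trans _ ij) // leq_addl.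
  have ij1 : (i + j <= n.+1)%N by exact: leqW.
  case: (I2_cases k) => -> .
    rewrite -[nabla 0 _](subrK (t i.+1 j)); apply: Order_add.
      exact: nabla1_tau_rest.
    by apply: Order_tau; rewrite addSn.
  rewrite -[nabla 1 _](subrK (t i j.+1)); apply: Order_add.
    exact: nabla2_tau_rest.
  by apply: Order_tau; rewrite addnS.
elim=> [c|i j|n0|f' g h1 r1 h2 r2|f' g h1 r1 h2 r2].
- by rewrite nablas_const; exact: order_le0.
- exact: tau_case.
- rewrite (derV hD (tau10_neq0 (w_neq0 R) (E_neq0 R))) expr2 invfM.
  apply: order_leN; apply: Order_mul; first exact: tau_case.
  by apply: Order_mul; apply: Order_inv.
- by rewrite (der_add hD); apply: Order_add.
rewrite (derM hD); apply: Order_add; apply: Order_mul => //; exact: order_leW (leqnSn n) _.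
Qed.

Definition jetI a b : K := iter a (nabla 0) (iter b (nabla 1) (I1' R)).
Definition jetJ b : K := iter b (nabla 1) (I2c' R).

Definition restI a b : K := jetI a b - kc 2^-1 * t a.+1 b.
Definition restJ b : K :=
  jetJ b - (kc 8^-1 * t 2 b + kc 4^-1 * t 1 b.+1 + kc 8^-1 * t 0 b.+2).

(** The remainder is one order below the leading term: a derivation raises it by one order, and
    takes the leading term to the next one up to the lower-order terms of the recurrence. *)
Lemma order_le_restI a b : order_le (a + b) (restI a b).
Proof.
elim: a => [|a IHa].
  elim: b => [|b IHb].
    rewrite /restI /jetI /= I1E /tauI -const_field_half mulrC subrr.
    exact: order_le0.
  rewrite /restI -[jetI 0 b.+1]/(nabla 1 (jetI 0 b)).
  rewrite (der_rest (nablas_derivation R 1) _ (t 1 b)) ?nablas_const //.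
  apply: Order_add; first exact: order_le_nabla.
  apply: Order_mul; first exact: Order_const.
  by apply: nabla2_tau_rest; rewrite ?add1n ?add0n //; case: (b).
rewrite /restI -[jetI a.+1 b]/(nabla 0 (jetI a b)).
rewrite (der_rest (nablas_derivation R 0) _ (t a.+1 b)) ?nablas_const //.
apply: Order_add; first exact: order_le_nabla.
apply: Order_mul; first exact: Order_const.
by apply: nabla1_tau_rest => //; case: (b) => // b' _; rewrite addnS.
Qed.

Lemma order_le_restJ b : order_le b.+1 (restJ b).
Proof.
elim: b => [|b IHb].
  have e (F : fieldType) (c8 c4 p q r : F) : 8 != 0 :> F -> 4 != 0 :> F -> c8 = 8^-1 ->
      c4 = 4^-1 -> (p + 2 * q + r) / 8 - (c8 * p + c4 * q + c8 * r) = 0.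
    by move=> h8 h4 -> ->; field; rewrite h8 h4.
  rewrite /restJ /jetJ /= I2cE /tauJ e ?natK_neq0 //; first exact: order_le0.
    by have -> : 8 = kc 8; [exact/esym/rmorph_nat|exact: fmorphV].
  by have -> : 4 = kc 4; [exact/esym/rmorph_nat|exact: fmorphV].
rewrite /restJ -[jetJ b.+1]/(nabla 1 (jetJ b)).
rewrite (der_rest3 (nablas_derivation R 1) _ (t 2 b) (t 1 b.+1) (t 0 b.+2)) ?nablas_const //.
apply: Order_add; first exact: order_le_nabla.
apply: Order_add; first apply: Order_add; apply: Order_mul; try exact: Order_const;
  by apply: nabla2_tau_rest.
Qed.

Lemma jetI_rest a b : jetI a b = restI a b + kc 2^-1 * t a.+1 b.
Proof. by rewrite subrK. Qed.
Lemma jetJ_rest b :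
  jetJ b = restJ b + (kc 8^-1 * t 2 b + kc 4^-1 * t 1 b.+1 + kc 8^-1 * t 0 b.+2).
Proof. by rewrite subrK. Qed.

Lemma order_le_jetI a b : order_le (a + b).+1 (jetI a b).
Proof.
rewrite jetI_rest; apply: Order_add; first exact: order_leW (leqnSn _) (order_le_restI a b).
by apply: Order_mul; [exact: Order_const|apply: Order_tau; rewrite addSn].
Qed.

Lemma order_le_jetJ b : order_le b.+2 (jetJ b).
Proof.
rewrite jetJ_rest; apply: Order_add; first exact: order_leW (leqnSn _) (order_le_restJ b).
by apply: Order_add; first apply: Order_add; apply: Order_mul; try exact: Order_const;
  apply: Order_tau.
Qed.

(* The normalized jets: at the point (1, 0), with frame v1 = (1, 0), v2 = (0, 1),
   so that the prescribed numbers th i j are the values of the invariants tau i j. *)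
Definition section_jet (th : nat -> nat -> R) : jet R :=
  jet_of 1 0 (fun i j => th i j / (2 * th 1 0)).

Definition normalized (th : nat -> nat -> R) : Prop :=
  [/\ th 0 0 = 1, th 0 1 = 0 & th 1 0 != 0].

Lemma takes_value_tau th i j : normalized th -> takes_value (t i j) (section_jet th) (th i j).
Proof.
move=> [h00 h01 h10]; rewrite -[in X in takes_value _ _ X](tau_std i j h00 h01 h10).
have vw k m : takes_value (wF R k m) (section_jet th) (th k m / (2 * th 1 0)).
  have e : jet_eval (section_jet th) (wpoly R k m) = th k m / (2 * th 1 0).
    exact: (jet_of_wpoly 1 0 (fun i j => th i j / (2 * th 1 0))).
  exact: (eq_ind _ (takes_value _ _) (takes_value_w (section_jet th) k m) _ e).
apply: (fval_tau (takes_value_var (section_jet th) JX) (takes_value_var (section_jet th) JY) vw).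
by rewrite h00 mul1r invr_eq0 mulf_neq0 // pnatr_eq0.
Qed.

(** The value exists since only [tau 1 0] is inverted and [th 1 0] is nonzero, and it is built from
    the [th i j] with [i + j <= n] alone. *)
Lemma order_le_value n f th th' : order_le n f -> normalized th -> normalized th' ->
    (forall i j, (i + j <= n)%N -> th i j = th' i j) ->
  exists c, takes_value f (section_jet th) c /\ takes_value f (section_jet th') c.
Proof.
move=> hf hth hth' agree.
elim: hf => [c|i j ij|n0|f' g _ [c1 [r1 s1]] _ [c2 [r2 s2]]|f' g _ [c1 [r1 s1]] _ [c2 [r2 s2]]].
- by exists c; split; apply: takes_value_const.
- exists (th i j); split; first exact: takes_value_tau.
  by rewrite agree //; apply: takes_value_tau.
- have e : th 1 0 = th' 1 0 by apply: agree.
  exists (th 1 0)^-1; split.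
    by apply: (fvalV (phi := jet_eval _) (takes_value_tau 1 0 hth)); case: hth.
  by rewrite e; apply: (fvalV (phi := jet_eval _) (takes_value_tau 1 0 hth')); case: hth'.
- exists (c1 + c2); split; [exact: (fvalD (phi := jet_eval _) r1 r2)|].
  exact: (fvalD (phi := jet_eval _) s1 s2).
exists (c1 * c2); split; [exact: (fvalM (phi := jet_eval _) r1 r2)|].
exact: (fvalM (phi := jet_eval _) s1 s2).
Qed.

(** The default 0 is harmless: this is used for functions bounded by [order_le] at normalized jets,
    where a value exists. *)
Definition value_at (f : K) (s : jet R) : R :=
  if pselect (exists c, takes_value f s c) is left e then projT1 (cid e) else 0.

Lemma value_atP f s c : takes_value f s c -> value_at f s = c.
Proof.
move=> fc; rewrite /value_at; case: pselect => [e|[]]; last by exists c.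
by case: (cid e) => c' /= fc'; exact: (fval_uniq (phi := jet_eval s) fc' fc).
Qed.

Lemma value_at_order n f th : order_le n f -> normalized th ->
  takes_value f (section_jet th) (value_at f (section_jet th)).
Proof.
by move=> hf hth; have [c [h _]] := order_le_value hf hth hth (fun _ _ _ => erefl);
  rewrite (value_atP h).
Qed.

Lemma value_stable n f th th' c : order_le n f -> normalized th -> normalized th' ->
    (forall i j, (i + j <= n)%N -> th i j = th' i j) ->
  takes_value f (section_jet th) c -> takes_value f (section_jet th') c.
Proof.
move=> hf hth hth' agree fc; have [c' [h h']] := order_le_value hf hth hth' agree.
by rewrite (fval_uniq (phi := jet_eval _) fc h).
Qed.

Section Realize.
Variables (tI : nat -> nat -> R) (tJ : nat -> R).
Hypothesis tI_neq0 : tI 0 0 != 0.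

(** Triangular system: once the entries up to order n + 1 are fixed, so are the remainders, and the
    free entries of order n + 2 are solved for from the leading terms. *)
Lemma realize n : exists th, [/\ normalized th, th 1 0 = 2 * tI 0 0,
  forall a b, (a + b <= n)%N -> takes_value (jetI a b) (section_jet th) (tI a b) &
  forall b, (b.+1 <= n)%N -> takes_value (jetJ b) (section_jet th) (tJ b)].
Proof.
have two_neq0 : 2 != 0 :> R by rewrite pnatr_eq0.
elim: n => [|n [th [nth e10 hI hJ]]].
  pose th i j : R := match i, j with 0, 0 => 1 | 1, 0 => 2 * tI 0 0 | _, _ => 0 end.
  have nth : normalized th by split => //; rewrite mulf_neq0.
  exists th; split=> // a b; rewrite leqn0 addn_eq0 => /andP[/eqP-> /eqP->].
  rewrite jetI_rest /restI /jetI /= I1E /tauI -const_field_half [_ * kc _]mulrC.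
  rewrite subrr add0r.
  have -> : tI 0 0 = 2^-1 * (2 * tI 0 0) by rewrite mulrA mulVf // mul1r.
  exact: (fvalM (phi := jet_eval _) (takes_value_const _ _) (takes_value_tau 1 0 nth)).
pose s := section_jet th.
(* [cI a b] will be the entry [th' a.+1 b] and [cJ b] the entry [th' 0 b.+2]; the coefficients
   invert those in [restI] and [restJ]. In [cJ] the entries [th' 2 b] and [th' 1 b.+1] are already
   known as [cI 1 b] and [cI 0 b.+1]. *)
pose cI a b := 2 * (tI a b - value_at (restI a b) s).
pose cJ b := 8 * (tJ b - value_at (restJ b) s - (8^-1 * cI 1 b + 4^-1 * cI 0%N b.+1)).
pose th' i j := if (i + j <= n.+1)%N then th i j else
  match i with 0 => cJ j.-2 | i'.+1 => cI i' j end.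
have agree i j : (i + j <= n.+1)%N -> th i j = th' i j by rewrite /th' => ->.
have nth' : normalized th' by case: nth => h1 h2 h3; split; rewrite -agree.
exists th'; split; [exact: nth'|by rewrite -agree| |].
  move=> a b; rewrite leq_eqVlt ltnS => /orP[/eqP eab|ab]; last first.
    apply: (value_stable _ nth nth' _ (hI a b ab)); first exact: order_le_jetI.
    by move=> i j hij; apply: agree; apply: leq_trans hij _.
  rewrite jetI_rest.
  have -> : tI a b = value_at (restI a b) s + 2^-1 * th' a.+1 b.
    by rewrite /th' addSn eab ltnn /cI mulrA mulVf // mul1r addrC subrK.
  apply: (fvalD (phi := jet_eval _)); last first.
    exact: (fvalM (phi := jet_eval _) (takes_value_const _ _) (takes_value_tau _ _ nth')).
  have rI := order_le_restI a b; rewrite eab in rI.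
  exact: (value_stable rI nth nth' agree (value_at_order rI nth)).
move=> b; rewrite ltnS leq_eqVlt => /orP[/eqP eb|hb]; last first.
  apply: (value_stable (order_le_jetJ b) nth nth' _ (hJ b hb)) => i j hij.
  by apply: agree; apply: leq_trans hij _.
rewrite jetJ_rest.
have -> : tJ b = value_at (restJ b) s +
    (8^-1 * th' 2 b + 4^-1 * th' 1 b.+1 + 8^-1 * th' 0 b.+2).
  rewrite /th' /= -eb !addSn !add0n !ltnn /= /cJ.
  by move: (value_at _ _) (cI 1 b) (cI 0%N b.+1) (tJ b) => u1 u2 u3 u4; field.
have vt c i j : takes_value (kc c * t i j) (section_jet th') (c * th' i j).
  exact: (fvalM (phi := jet_eval _) (takes_value_const _ _) (takes_value_tau _ _ nth')).
have vJ : takes_value (restJ b) (section_jet th') (value_at (restJ b) s).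
  have rJ := order_le_restJ b.
  apply: (value_stable rJ nth nth' _ (value_at_order rJ nth)) => i j hij.
  by apply: agree; apply: leq_trans hij _; rewrite eb.
exact: (fvalD (phi := jet_eval _) vJ (fvalD (fvalD (vt _ _ _) (vt _ _ _)) (vt _ _ _))).
Qed.

End Realize.
End CrossSection.

(** * Normal forms and completeness of the relations *)

Section NormalForms.
Variable R : realType.
Local Notation K := (jet_field R).
Local Notation DP := (diff_poly R).
Local Notation DF := (diff_field R).
Local Notation evalD := (@evalD R).
Local Notation d := (@formal_nabla R).
Local Notation h := (dsym R [::] 0).
Local Notation I := ((dsym R [::] 0)%:F : DF).
Local Notation J := ((dsym R [::] 1)%:F : DF).
Local Notation C := (consequence (@R1R2 R) h).
Local Notation const := (fun e : DF => exists c, e = constD c).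
Local Notation normalD := (normal (d 0) (d 1) const I J).
Local Notation red := (reduces (localized h) C normalD).

(* inl (a, b) stands for nabla_1^a nabla_2^b I'_1 and inr b for nabla_2^b I'_2c. *)
Definition normal_index : Type := (nat * nat + nat)%type.
HB.instance Definition _ := Choice.on normal_index.
Local Notation NP := {malg R[{cmonom normal_index}]}.

Definition normal_word (v : normal_index) : seq 'I_2 * 'I_2 :=
  match v with
  | inl (a, b) => (nseq a 0 ++ nseq b 1, 0)
  | inr b => (nseq b 1, 1)
  end.
Definition normal_sym (v : normal_index) : DP := dsym R (normal_word v).1 (normal_word v).2.
Definition normal_poly : NP -> DP := msubst malgC normal_sym.

Lemma normal_poly_morphism : zmod_morphism normal_poly * monoid_morphism normal_poly.
Proof. by split; [exact: msubst_additive|exact: msubst_multiplicative]. Qed.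
HB.instance Definition _ := GRing.isZmodMorphism.Build NP DP normal_poly normal_poly_morphism.1.
HB.instance Definition _ := GRing.isMonoidMorphism.Build NP DP normal_poly normal_poly_morphism.2.

Lemma normal_polyC (c : R) : normal_poly c%:MP = c%:MP.
Proof. exact: (msubstC malgC). Qed.
Lemma normal_polyX v : normal_poly (mvar R v) = normal_sym v.
Proof. exact: (msubstX malgC). Qed.

Lemma iter_d j n u i : iter n (d j) (dsym R u i)%:F = (dsym R (nseq n j ++ u) i)%:F.
Proof.
elim: n => [|n IH]; first exact: erefl.
by apply: etrans (congr1 (d j) IH) _; apply: d_sym.
Qed.

(** The denominator [h] is itself a normal symbol, so bringing fractions to a common denominator
    keeps the numerators normal. *)
Lemma normal_closure e : ring_closure normalD e ->
  exists q n, e = (normal_poly q)%:F / h%:F ^+ n.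
Proof.
pose X0 : NP := mvar R (inl (0%N, 0%N)).
have X0h n : (normal_poly (X0 ^+ n))%:F = h%:F ^+ n.
  have e0 : normal_poly X0 = h := normal_polyX (inl (0%N, 0%N)).
  by rewrite -tofracXn -e0; congr (_%:F); exact: rmorphXn.
have nuD q1 q2 : (normal_poly (q1 + q2))%:F = (normal_poly q1)%:F + (normal_poly q2)%:F.
  exact: etrans (congr1 (@FracField.tofrac DP) (raddfD normal_poly q1 q2)) (tofracD _ _).
have nuM q1 q2 : (normal_poly (q1 * q2))%:F = (normal_poly q1)%:F * (normal_poly q2)%:F.
  exact: etrans (congr1 (@FracField.tofrac DP) (rmorphM normal_poly q1 q2)) (tofracM _ _).
have hF n : h%:F ^+ n != 0 :> DF by rewrite expf_neq0 // tofrac_eq0 h_neq0.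
elim=> {e} [e [[[c ->]|->|[a [b ->]]]|[b ->]]|e1 e2 _ [q1 [n1 ->]] _ [q2 [n2 ->]]
    |e1 e2 _ [q1 [n1 ->]] _ [q2 [n2 ->]]].
- exists c%:MP, 0%N; rewrite expr0 divr1; exact: (congr1 (@FracField.tofrac DP) (esym (normal_polyC c))).
- exists 1, 1%N; rewrite expr1; apply: etrans (esym (mul1r _)) _.
  apply: (congr1 (fun u => u / _)); apply: etrans (esym (tofrac1 _)) _.
  exact: (congr1 (@FracField.tofrac DP) (esym (rmorph1 normal_poly))).
- exists (mvar R (inl (a, b))), 0%N; rewrite expr0 divr1 iter_d iter_d cats0.
  exact: (congr1 (@FracField.tofrac DP) (esym (normal_polyX (inl (a, b))))).
- exists (mvar R (inr b)), 0%N; rewrite expr0 divr1 iter_d cats0.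
  exact: (congr1 (@FracField.tofrac DP) (esym (normal_polyX (inr b)))).
- exists (q1 * X0 ^+ n2 + q2 * X0 ^+ n1), (n1 + n2)%N.
  apply: etrans (addf_div _ _ (hF n1) (hF n2)) _.
  apply: (congr2 (fun u v => u / v)); last exact: (esym (exprD _ _ _)).
  apply: esym; apply: etrans (nuD _ _) _; apply: congr2;
    exact: (etrans (nuM _ _) (congr1 (fun u => _ * u) (X0h _))).
exists (q1 * q2), (n1 + n2)%N; apply: etrans (mulf_div _ _ _ _) _.
apply: (congr2 (fun u v => u / v)); last exact: (esym (exprD _ _ _)).
exact: esym (nuM _ _).
Qed.

Lemma red_poly p : red p%:F.
Proof.
have CD := @Cons_add R (@R1R2 R) h; have CM := @consequenceM R.
have LD := localizedD (h_neq0 R); have LM := @localizedM _ h.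
have Lc c : const c -> localized h c by move=> [u ->]; apply: localized_tofrac.
have dW j u : (exists p : DP, u = p%:F) -> exists p : DP, d j u = p%:F.
  by move=> [q ->]; rewrite dF; eexists.
have LW u : (exists p : DP, u = p%:F) -> localized h u.
  by move=> [q ->]; apply: localized_tofrac.
have Liter a b k : localized h (iter a (d 0) (iter b (d 1) (dsym R [::] k)%:F)).
  by rewrite !iter_d; apply: localized_tofrac.
have nL b : normalD b -> localized h b.
  move=> [[/Lc //|->|[a [b' ->]]]|[b' ->]]; [exact: localizedV|exact: Liter|].
  exact: (Liter 0).
have base e : normalD e -> red e := red_base LD LM (consequence0 R) nL (e := e).
move: p; apply: malg_ind => [c|[u i]|p q hp hq|p q hp hq].
- by apply: base; left; apply: Or31; exists c.
- elim: u => [|j u IH].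
    case: (I2_cases i) => ->; apply: base; last by right; exists 0%N.
    by left; apply: Or33; exists 0%N, 0%N.
  apply: (eq_ind _ red (red_nabla j IH)); exact: d_sym.
- by apply: (eq_ind _ red (redD LD CD hp hq)); rewrite tofracD.
by apply: (eq_ind _ red (redM LD LM CD CM nL hp hq)); rewrite tofracM.
Qed.

Definition normal_val (v : normal_index) : K :=
  match v with inl (a, b) => jetI R a b | inr b => jetJ R b end.

Lemma evalD_normal_sym v : evalD (normal_sym v) = normal_val v.
Proof.
have it (j : 'I_2) n u i : nabla_word (@nablas R) (nseq n j ++ u) (invs R i) =
    iter n (nablas j) (nabla_word (@nablas R) u (invs R i)).
  by elim: n => [|n IH] //; rewrite iterS -IH.
case: v => [[a b]|b]; apply: etrans (evalDX R _ _) _.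
  by rewrite it -[nseq b 1]cats0 it.
by rewrite -[(normal_word _).1]cats0 it.
Qed.

Lemma evalD_normal_poly q : evalD (normal_poly q) = msubst (@scal_field R) normal_val q.
Proof.
apply: (malg_rmorph_ext (f := evalD \o normal_poly) (g := msubst (@scal_field R) normal_val)).
  move=> c; apply: etrans (congr1 evalD (normal_polyC c)) _.
  apply: etrans (evalDC c) _; apply: etrans (esym (scal_fieldE c)) _.
  exact: esym (msubstC (@scal_field R) _ _).
move=> v; apply: etrans (congr1 evalD (normal_polyX v)) _.
by apply: etrans (evalD_normal_sym v) _; exact: esym (msubstX (@scal_field R) _ _).
Qed.

(** A nonzero [q] is nonzero at some real point, and [realize] supplies a jet at which the normal
    invariants occurring in [q] have these coordinates as values. The factor [X0] keeps the value
    prescribed for I'_1 nonzero, as [realize] requires. *)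
Lemma normal_independent q : evalD (normal_poly q) = 0 -> q = 0.
Proof.
move=> eq0; apply/eqP/negP => /negP q0.
pose X0 : NP := mvar R (inl (0%N, 0%N)).
have X00 : X0 != 0.
  apply/eqP => e; have := normal_polyX (inl (0%N, 0%N)); rewrite -/X0 e raddf0 => e'.
  by move: (h_neq0 R); rewrite -[h]/(normal_sym (inl (0%N, 0%N))) -e' eqxx.
have [t ht] := malg_nonvanishing (real_infinite R) (mulf_neq0 q0 X00).
have := eq_ind _ (fun u => u != 0) ht _ (rmorphM (msubst idfun t) q X0).
rewrite mulf_eq0 negb_or => /andP[tq tX].
have t0 : t (inl (0%N, 0%N)) != 0.
  exact: (eq_ind _ (fun u => u != 0) tX _ (msubstX idfun t (inl (0%N, 0%N)))).
pose ord (v : normal_index) := match v with inl (a, b) => (a + b)%N | inr b => b.+1 end.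
pose r : seq normal_index := mvars q; pose n := \max_(v <- r) ord v.
have [th [nth _ hI hJ]] := @realize R (fun a b => t (inl (a, b))) (fun b => t (inr b)) t0 n.
(* Only the finitely many variables of [q] have their values prescribed; [t'] takes the actual value
   for all of them and agrees with [t] on these. *)
pose s := section_jet th; pose t' v := value_at (normal_val v) s.
have nval v : takes_value (normal_val v) s (t' v).
  by case: v => [[a b]|b]; [exact: value_at_order (order_le_jetI R a b) nth|
    exact: value_at_order (order_le_jetJ R b) nth].
have tt' v : v \in mvars q -> t' v = t v.
  move=> vq; have le : (ord v <= n)%N := @leq_bigmax_seq _ r predT ord v vq isT.
  by apply: value_atP; case: v le {vq} => [[a b]|b] le; [exact: hI|exact: hJ].
have vC (c : R) : takes_value (scal_field c) s (idfun c).
  exact: (eq_ind _ (fun u => takes_value u s c) (takes_value_const s c) _ (esym (scal_fieldE c))).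
have := fval_msubst (phi := jet_eval s) (c := @scal_field R) (c' := idfun) vC nval q.
rewrite -evalD_normal_poly eq0 (msubst_eq idfun tt') => v0.
have e0 := fval_uniq (phi := jet_eval s) v0 (fval0 (jet_eval s)).
by case/eqP: tq; exact: e0.
Qed.

(** Modulo [C], [p] equals a normal polynomial over a power of [h]. By soundness this fraction also
    evaluates to zero, so by independence it is zero, and [p] itself lies in [C]. *)
Lemma relation_consequence p : evalD p = 0 -> C p%:F.
Proof.
move=> p0; have [_ [e' [he' ce']]] := red_poly p.
have [q [n eq]] := normal_closure he'.
have ve' : frac_val evalD e' 0.
  have vp : frac_val evalD p%:F 0.
    exact: (eq_ind _ (frac_val evalD p%:F) (fval_tofrac evalD p) _ p0).
  have := fvalB vp (consequence_sound ce').
  by rewrite subr0 opprB addrC subrK.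
have hn : evalD (h ^+ n) != 0.
  have e : evalD (h ^+ n) = I1' R ^+ n.
    by apply: etrans (rmorphXn evalD n h) _; congr (_ ^+ n); exact: evalD_h.
  by rewrite e expf_neq0 // I1_neq0.
have vq := fval_frac (phi := evalD) (normal_poly q) hn.
rewrite tofracXn -eq in vq.
have div0 (F : fieldType) (a b : F) : b != 0 -> a / b = 0 -> a = 0.
  by move=> b0 e; rewrite -(divfK b0 a) e mul0r.
have qq := normal_independent (div0 _ _ _ hn (fval_uniq vq ve')).
have e'0 : e' = 0.
  have z : normal_poly 0 = 0 by exact: raddf0.
  apply: etrans eq _; move: qq => ->.
  by apply: etrans (congr1 (fun u : DP => u%:F / _) z) _; rewrite tofrac0 mul0r.
by rewrite e'0 subr0 in ce'.
Qed.

End NormalForms.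

Theorem theorem8p2 (R : realType) :
  let I := pick2 (I1' R) (I2c' R) in
  let nabla := pick2 (@nabla1 R) (@nabla2 R) in
  [/\ (forall i, diff_invariant (I i)) /\
      (forall j, invariant_derivation (nabla j)),
      forall f : jet_field R,
        diff_invariant f <-> rationally_generated nabla I f,
      forall f : jet_field R, rel1 (@nabla1 R) (@nabla2 R) (I1' R) f = 0,
      rel2 (@nabla1 R) (@nabla2 R) (I1' R) (I2c' R) = 0
    & forall p : diff_poly R,
        diff_eval nabla I p = 0 ->
        consequence (@R1R2 R) (dsym R [::] 0) (FracField.tofrac p)].
Proof.
split.
- split=> i; rewrite /pick2; case: ifP => _.
  + exact: I1_invariant.
  + exact: I2c_invariant.
  + exact: nabla1_invariant.
  exact: nabla2_invariant.
- by move=> f; split; [exact: invariant_generated|exact: generated_invariant].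
- exact: nablas_rel1.
- exact: nablas_rel2.
exact: relation_consequence.
Qed.
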